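(* One has $$\sum_{n=0}^{\infty}\frac{1}{n+1}\sum_{k=0}^{n}\binom{n}{k}(-1)^k\, k\,\log^2(k+1)=\gamma_1-\log(2\pi)-\frac12\gamma^2+\frac{1}{24}\pi^2+\frac12\log^2(2\pi).$$
   Context: Here $\gamma$ is Euler's constant and $\gamma_1$ is the first Stieltjes constant of the Riemann zeta function, where the Stieltjes constants $\gamma_p$ are defined by the Laurent expansion about $s=1$: $\zeta(s)=\frac{1}{s-1}+\sum_{p=0}^{\infty}\frac{(-1)^p}{p!}\gamma_p(s-1)^p$ (so $\gamma_0=\gamma$). The notation $\log^2 y$ means $(\log y)^2$. The double sum is an iterated sum: the inner finite sum over $k$ is computed first, then the series over $n$. *)

(* Defs.v *)
From Stdlib Require Import Reals Factorial.
From Coquelicot Require Import Coquelicot.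

Open Scope R_scope.

Definition Cexp (z : C) : C :=
  (exp (Re z) * cos (Im z), exp (Re z) * sin (Im z)).

(* The term (n+1)^{-s} = exp (- s log (n+1)) of the Dirichlet series, indexed
   from n = 0. *)
Definition zeta_term (s : C) (n : nat) : C :=
  Cexp (- s * RtoC (ln (INR (S n))))%C.

(* The Riemann zeta function: the holomorphic continuation to C \ {1} of the
   Dirichlet series.  By the identity theorem this determines [Z] everywhere
   except at the pole, where the value of [Z] is irrelevant. *)
Definition is_riemann_zeta (Z : C -> C) : Prop :=
  (forall s : C, 1 < Re s ->
     @is_series C_AbsRing C_NormedModule (zeta_term s) (Z s)) /\
  (forall s : C, s <> RtoC 1 -> @ex_derive C_AbsRing C_NormedModule Z s).

(* The Laurent expansion of [Z] on some punctured disc around 1: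
   Z(s) = 1/(s-1) + sum_p (-1)^p / p! * g_p * (s-1)^p. *)
Definition is_stieltjes (Z : C -> C) (g : nat -> R) : Prop :=
  exists r : R, 0 < r /\
    forall s : C, s <> RtoC 1 -> Cmod (s - RtoC 1) < r ->
      @is_pseries C_AbsRing C_NormedModule
        (fun p => RtoC ((-1) ^ p / INR (Factorial.fact p) * g p))
        (s - RtoC 1)%C
        (Z s - / (s - RtoC 1))%C.

(* The n-th term of the sequence is H_{n+1} - log (n+1). *)
Definition euler_gamma : R :=
  real (Lim_seq (fun n => sum_n (fun k => / INR (S k)) n - ln (INR (S n)))).

(* Main.v *)
Require Import Defs.
From Stdlib Require Import Reals Lra Lia Factorial.
From Coquelicot Require Import Coquelicot.

Open Scope R_scope.

(** Write [bdiff 1 n F] for [(-1)^n Delta^n F], [g = ln^2] and [f(x) = (x - 1) g(x)]. The inner sum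
    of the series is [bdiff 1 n f 1], and formally [sum_n bdiff 1 n F / (n+1) = (D / Delta) F].
    With [h(x)] the partial Hasse series at [x], [h(x+1) - h(x)] tends to [f'(x)] (Newton's formula
    for the derivative) and [h(x) = f(x) - f'(x)/2 + o(1)], so the series is
    [lim (f(m) - f'(m)/2 - sum_(j < m) f'(j)) = 2 c - s - ln (2 PI)], where [c] and [s] are the
    Euler-Maclaurin constants of [ln x / x] and [ln^2 x].

    Expanding [sum n^(-1-e) - 1/e] to first order as [e -> 0+] gives [gamma_1 = c]; only real
    arguments [> 1] of zeta are needed.

    The value of [s], in substance that of [zeta''(0)], replaces the functional equation by a
    discrete Fourier argument. The real part of [ln^2 (1 - r w)] is summed over the [M]-th roots of
    unity [w] with the power series [ln^2 (1 - z) = sum 2 H_(n-1) z^n / n]; letting [r -> 1] gives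
    [sum_(0<j<M) (ln^2 (2 sin (PI j/M)) - PI^2 (j/M - 1/2)^2) + ln^2 M
     = 2 sum_m (rho(M m) - rho(m)) / m] with [rho(k) = H_(k-1) - ln k - gamma]. As [M -> oo] the
    right side tends to [gamma^2 + 2 c + PI^2/6], while on the left
    [ln (2 sin y) = ln (2 y) + ln (sin y / y)] and the trapezoidal rule bring in [2 s + ln^2 (2 PI)]. *)

(** * Finite sums and elementary estimates *)


(** From order 2 on the derivatives of [ln^2] change sign, and over the range [[x, x + n]] of an
    n-th difference they vary so much that a supremum bound is useless for large [n]. High
    differences are therefore compared with those of [1/x], [1/(x - 1)] and [x ln x + 1/x], which
    have one sign and are explicit or telescope. The resulting bounds are uniform in the number of
    terms, and this uniformity is what permits exchanging the limit of the partial sums with the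
    limit in the base point.

    Three constants occur because [f'(x) = ln^2 x + 2 ln x - 2 ln x / x]. The one of [ln x],
    Stirling's, comes from the same roots of unity with [ln (1 - r w)] to the first power. The
    Euler-Maclaurin constants are first only shown to exist, with an error [O(ln n / n)]; the rate
    matters because Stirling's remainder is later multiplied by [ln n].

    On the circle the root [w = 1] is singular as [r -> 1]. Its contribution [ln^2 (1 - r)] is
    cancelled by subtracting suitable multiples of the series of [ln^2 (1 - q)] and [ln (1 - q)] at
    [q = r^M], which at the same time makes the coefficients summable. *)

Fixpoint psum (f : nat -> R) (n : nat) : R :=
  match n with O => 0 | S m => psum f m + f m end.

Lemma sum_n_psum (f : nat -> R) (n : nat) : sum_n f n = psum f (S n).
Proof.
  induction n as [|n IH].
  - rewrite sum_O. simpl. ring.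
  - rewrite sum_Sn, IH. reflexivity.
Qed.

Lemma psum_ext (f g : nat -> R) (n : nat) :
  (forall k, (k < n)%nat -> f k = g k) -> psum f n = psum g n.
Proof.
  induction n as [|n IH]; intros H; simpl; [easy|].
  rewrite IH by (intros; apply H; lia). rewrite H by lia. easy.
Qed.

Lemma psum_plus (f g : nat -> R) (n : nat) :
  psum (fun k => f k + g k) n = psum f n + psum g n.
Proof. induction n as [|n IH]; simpl; [ring|rewrite IH; ring]. Qed.

Lemma psum_minus (f g : nat -> R) (n : nat) :
  psum (fun k => f k - g k) n = psum f n - psum g n.
Proof. induction n as [|n IH]; simpl; [ring|rewrite IH; ring]. Qed.

Lemma psum_scal (c : R) (f : nat -> R) (n : nat) :
  psum (fun k => c * f k) n = c * psum f n.
Proof. induction n as [|n IH]; simpl; [ring|rewrite IH; ring]. Qed.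

Lemma psum_const (c : R) (n : nat) : psum (fun _ => c) n = INR n * c.
Proof. induction n as [|n IH]; [simpl; ring|]. simpl psum. rewrite IH, S_INR. ring. Qed.

Lemma psum_le (f g : nat -> R) (n : nat) :
  (forall k, (k < n)%nat -> f k <= g k) -> psum f n <= psum g n.
Proof.
  induction n as [|n IH]; intros H; simpl; [lra|].
  apply Rplus_le_compat; [apply IH; intros; apply H; lia|apply H; lia].
Qed.

Lemma psum_Rabs (f : nat -> R) (n : nat) :
  Rabs (psum f n) <= psum (fun k => Rabs (f k)) n.
Proof.
  induction n as [|n IH]; simpl; [rewrite Rabs_R0; lra|].
  eapply Rle_trans; [apply Rabs_triang|lra].
Qed.

Lemma psum_telescope (u : nat -> R) (n : nat) :
  psum (fun k => u (S k) - u k) n = u n - u O.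
Proof. induction n as [|n IH]; simpl; [ring|rewrite IH; ring]. Qed.

Lemma psum_Sl (f : nat -> R) (n : nat) :
  psum f (S n) = f O + psum (fun k => f (S k)) n.
Proof.
  induction n as [|n IH]; [simpl; ring|].
  change (psum f (S n) + f (S n) = f O + (psum (fun k => f (S k)) n + f (S n))).
  rewrite IH. ring.
Qed.

Lemma psum_add (f : nat -> R) (n m : nat) :
  psum f (n + m) = psum f n + psum (fun k => f (n + k)%nat) m.
Proof.
  induction m as [|m IH]; [rewrite Nat.add_0_r; simpl; ring|].
  rewrite Nat.add_succ_r. simpl. rewrite IH. ring.
Qed.

Lemma psum_rev (f : nat -> R) (n : nat) :
  psum (fun k => f (n - 1 - k)%nat) n = psum f n.
Proof.
  induction n as [|n IH]; [easy|].
  rewrite psum_Sl. simpl psum at 2.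
  rewrite <- IH.
  replace (S n - 1 - 0)%nat with n by lia.
  rewrite Rplus_comm. f_equal. apply psum_ext. intros k Hk. f_equal. lia.
Qed.

Lemma is_series_psum (a : nat -> R) (l : R) :
  is_series a l <-> is_lim_seq (psum a) l.
Proof.
  rewrite (is_lim_seq_incr_1 (psum a)).
  split; intros H.
  - apply is_lim_seq_ext with (2 := H). intros n. apply sum_n_psum.
  - eapply filterlim_ext; [|exact H]. intros n. symmetry. apply sum_n_psum.
Qed.

Lemma is_lim_seq_eps (u : nat -> R) (l : R) :
  is_lim_seq u l <->
  forall e : R, 0 < e -> exists N, forall n, (N <= n)%nat -> Rabs (u n - l) < e.
Proof.
  rewrite <- is_lim_seq_spec. split.
  - intros H e He. destruct (H (mkposreal e He)) as [N HN]. exists N. apply HN.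
  - intros H e. destruct (H e (cond_pos e)) as [N HN]. exists N. apply HN.
Qed.

Lemma is_lim_seq_0_le (u v : nat -> R) (N : nat) :
  (forall n, (N <= n)%nat -> Rabs (u n) <= v n) -> is_lim_seq v 0 -> is_lim_seq u 0.
Proof.
  intros H Hv. apply is_lim_seq_eps. intros e He.
  destruct (proj1 (is_lim_seq_eps v 0) Hv e He) as [N' HN'].
  exists (max N N'). intros n Hn.
  specialize (H n ltac:(lia)). specialize (HN' n ltac:(lia)).
  rewrite Rminus_0_r in *. apply Rabs_def2 in HN'. lra.
Qed.

Lemma is_lim_seq_dist (u : nat -> R) (l : R) :
  is_lim_seq (fun n => u n - l) 0 -> is_lim_seq u l.
Proof.
  intros H. apply is_lim_seq_ext with (fun n => (u n - l) + l). intros; ring.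
  replace (Finite l) with (Finite (0 + l)) by (f_equal; ring).
  apply is_lim_seq_plus'; [exact H|apply is_lim_seq_const].
Qed.

Lemma is_lim_seq_inv_S : is_lim_seq (fun n => / INR (S n)) 0.
Proof.
  apply (is_lim_seq_incr_1 (fun n => / INR n)).
  replace (Finite 0) with (Rbar_inv p_infty) by easy.
  apply is_lim_seq_inv; [apply is_lim_seq_INR|easy].
Qed.

Lemma is_lim_seq_scal_0 (c : R) (u : nat -> R) :
  is_lim_seq u 0 -> is_lim_seq (fun n => c * u n) 0.
Proof.
  intros H. replace (Finite 0) with (Rbar_mult c 0) by (simpl; f_equal; ring).
  now apply is_lim_seq_scal_l.
Qed.

Lemma mean_value (f f' : R -> R) (a b : R) :
  a <= b -> (forall x, a <= x <= b -> is_derive f x (f' x)) ->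
  exists c, a <= c <= b /\ f b - f a = f' c * (b - a).
Proof.
  intros Hab Hf.
  destruct (MVT_gen f a b f') as [c [Hc E]];
    rewrite ?Rmin_left, ?Rmax_right in * by lra.
  - intros x Hx. apply Hf. lra.
  - intros x Hx. apply continuity_pt_filterlim.
    apply (ex_derive_continuous (K := R_AbsRing) (V := R_NormedModule)).
    eexists. apply Hf. lra.
  - exists c. split; assumption.
Qed.

Lemma ln_le_sub_1 (x : R) : 0 < x -> ln x <= x - 1.
Proof.
  intros Hx. pose proof (exp_ineq1_le (ln x)). rewrite exp_ln in H by lra. lra.
Qed.

(** The inequality [ln t <= t - 1] at [t = x / y] and at its inverse. The slack [- 1] is kept
    because [ln_sub_harmonic] spends it on the gap between a harmonic number and a logarithm. *)
Lemma ln_div_bound (x y : R) : 0 < x -> 0 < y -> Rabs (ln x - ln y) <= x / y + y / x - 1.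
Proof.
  intros Hx Hy.
  assert (H1 := ln_le_sub_1 (x / y) ltac:(apply Rdiv_lt_0_compat; lra)).
  assert (H2 := ln_le_sub_1 (y / x) ltac:(apply Rdiv_lt_0_compat; lra)).
  rewrite ln_div in H1, H2 by lra.
  assert (0 < x / y) by (apply Rdiv_lt_0_compat; lra).
  assert (0 < y / x) by (apply Rdiv_lt_0_compat; lra).
  apply Rabs_le. lra.
Qed.

Lemma ln_nonneg (x : R) : 1 <= x -> 0 <= ln x.
Proof. intros H. rewrite <- ln_1. apply ln_le; lra. Qed.

Lemma ln_succ_bounds (x : R) : 0 < x -> / (x + 1) <= ln (x + 1) - ln x <= / x.
Proof.
  intros Hx. split.
  - assert (H := ln_le_sub_1 (x / (x + 1)) ltac:(apply Rdiv_lt_0_compat; lra)).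
    rewrite ln_div in H by lra.
    replace (x / (x + 1) - 1) with (- / (x + 1)) in H by (field; lra). lra.
  - assert (H := ln_le_sub_1 ((x + 1) / x) ltac:(apply Rdiv_lt_0_compat; lra)).
    rewrite ln_div in H by lra.
    replace ((x + 1) / x - 1) with (/ x) in H by (field; lra). lra.
Qed.

Definition harmonic (n : nat) : R := psum (fun k => / INR (S k)) n.

Lemma INR_S_pos (n : nat) : 0 < INR (S n).
Proof. apply lt_0_INR. lia. Qed.

Lemma INR_S_ge_1 (n : nat) : 1 <= INR (S n).
Proof. rewrite S_INR. pose proof (pos_INR n). lra. Qed.

Lemma ln_le_harmonic (n : nat) : ln (INR (S n)) <= harmonic n.
Proof.
  induction n as [|n IH].
  - simpl. rewrite ln_1. unfold harmonic. simpl. lra.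
  - change (harmonic (S n)) with (harmonic n + / INR (S n)).
    pose proof (ln_succ_bounds (INR (S n)) (INR_S_pos n)) as B.
    rewrite <- S_INR in B. lra.
Qed.

Lemma harmonic_le_ln (n : nat) : harmonic (S n) <= 1 + ln (INR (S n)).
Proof.
  induction n as [|n IH].
  - unfold harmonic. simpl. rewrite ln_1. lra.
  - change (harmonic (S (S n))) with (harmonic (S n) + / INR (S (S n))).
    pose proof (ln_succ_bounds (INR (S n)) (INR_S_pos n)) as B.
    rewrite <- S_INR in B. lra.
Qed.

Lemma is_derive_mult_const (f : R -> R) (x l c : R) :
  is_derive f x l -> is_derive (fun y => f y * c) x (l * c).
Proof.
  intros H. rewrite Rmult_comm.
  apply (is_derive_ext (fun y => c * f y)); [intros; apply Rmult_comm|].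
  now apply is_derive_scal.
Qed.

Lemma is_derive_shift (f : R -> R) (x l c : R) :
  is_derive f (x + c) l -> is_derive (fun y => f (y + c)) x l.
Proof.
  intros H. replace l with (scal 1 l) by (unfold scal; simpl; unfold mult; simpl; ring).
  apply (is_derive_comp f (fun y => y + c)); [exact H|].
  auto_derive; [easy|ring].
Qed.

(** * Finite differences with a step *)


(* Sign convention: [(-1)^n] times the usual n-th difference with step [h]. *)
Fixpoint bdiff (h : R) (n : nat) (F : R -> R) (x : R) : R :=
  match n with
  | O => F x
  | S m => bdiff h m F x - bdiff h m F (x + h)
  end.

(** Pascal's rule. This form identifies the inner sum of the theorem as a difference at 1, and shows
    that only the values at the nodes [x + k h] matter. *)
Lemma bdiff_binomial (h : R) (n : nat) (F : R -> R) (x : R) :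
  bdiff h n F x =
  psum (fun k => Binomial.C n k * (-1) ^ k * F (x + INR k * h)) (S n).
Proof.
  revert x. induction n as [|n IH]; intros x.
  - simpl. unfold Binomial.C. simpl. rewrite Rmult_0_l, Rplus_0_r. field.
  - cbn [bdiff]. rewrite !IH.
    rewrite (psum_Sl _ (S n)).
    rewrite (psum_Sl _ n).
    change (psum (fun k => Binomial.C n k * (-1) ^ k * F (x + h + INR k * h)) (S n))
      with (psum (fun k => Binomial.C n k * (-1) ^ k * F (x + h + INR k * h)) n
            + Binomial.C n n * (-1) ^ n * F (x + h + INR n * h)).
    change (psum (fun k => Binomial.C (S n) (S k) * (-1) ^ S k * F (x + INR (S k) * h)) (S n))
      with (psum (fun k => Binomial.C (S n) (S k) * (-1) ^ S k * F (x + INR (S k) * h)) n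
            + Binomial.C (S n) (S n) * (-1) ^ S n * F (x + INR (S n) * h)).
    assert (C0 : forall m, Binomial.C m 0 = 1).
    { intros m. unfold Binomial.C. rewrite Nat.sub_0_r. simpl. field. apply INR_fact_neq_0. }
    assert (Cn : forall m, Binomial.C m m = 1).
    { intros m. unfold Binomial.C. rewrite Nat.sub_diag. simpl. field. apply INR_fact_neq_0. }
    rewrite !Cn, !C0.
    rewrite (psum_ext (fun k => Binomial.C (S n) (S k) * (-1) ^ S k * F (x + INR (S k) * h))
      (fun k => Binomial.C n (S k) * (-1) ^ S k * F (x + INR (S k) * h)
                - Binomial.C n k * (-1) ^ k * F (x + h + INR k * h))).
    2:{ intros k Hk. rewrite <- (pascal n k) by lia.
        replace (x + INR (S k) * h) with (x + h + INR k * h) by (rewrite S_INR; ring).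
        simpl. ring. }
    rewrite psum_minus.
    replace (x + INR (S n) * h) with (x + h + INR n * h) by (rewrite S_INR; ring).
    simpl. ring.
Qed.

Lemma bdiff_ext (h : R) (n : nat) (F G : R -> R) (x : R) :
  (forall k, (k <= n)%nat -> F (x + INR k * h) = G (x + INR k * h)) ->
  bdiff h n F x = bdiff h n G x.
Proof.
  intros H. rewrite !bdiff_binomial. apply psum_ext. intros k Hk.
  rewrite H by lia. easy.
Qed.

Lemma bdiff_plus (h : R) (n : nat) (F G : R -> R) (x : R) :
  bdiff h n (fun y => F y + G y) x = bdiff h n F x + bdiff h n G x.
Proof. revert x. induction n as [|n IH]; intros x; simpl; [easy|rewrite !IH; ring]. Qed.

Lemma bdiff_scal (h c : R) (n : nat) (F : R -> R) (x : R) :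
  bdiff h n (fun y => c * F y) x = c * bdiff h n F x.
Proof. revert x. induction n as [|n IH]; intros x; simpl; [easy|rewrite !IH; ring]. Qed.

Lemma bdiff_minus (h : R) (n : nat) (F G : R -> R) (x : R) :
  bdiff h n (fun y => F y - G y) x = bdiff h n F x - bdiff h n G x.
Proof. revert x. induction n as [|n IH]; intros x; simpl; [easy|rewrite !IH; ring]. Qed.

Lemma bdiff_shift (h c : R) (n : nat) (F : R -> R) (x : R) :
  bdiff h n (fun y => F (y + c)) x = bdiff h n F (x + c).
Proof.
  revert x. induction n as [|n IH]; intros x; simpl; [easy|].
  rewrite !IH. f_equal. f_equal. ring.
Qed.

Lemma bdiff_S_l (h : R) (n : nat) (F : R -> R) (x : R) :
  bdiff h (S n) F x = bdiff h n (fun y => F y - F (y + h)) x.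
Proof. rewrite bdiff_minus, bdiff_shift. easy. Qed.

Lemma bdiff_step_0 (n : nat) (F : R -> R) (x : R) : bdiff 0 (S n) F x = 0.
Proof. simpl. rewrite Rplus_0_r. ring. Qed.

(** [F] is a tower of successive derivatives. One difference is taken off the function instead of
    the base point: [F i y - F i (y + h)] is again a tower, and the mean value theorem makes its
    n-th member [- h] times a value of [F (S n)], whose sign is known. *)
Lemma bdiff_nonneg (h : R) (n : nat) (F : nat -> R -> R) (x : R) :
  0 <= h ->
  (forall i y, (i < n)%nat -> x <= y <= x + INR n * h -> is_derive (F i) y (F (S i) y)) ->
  (forall y, x <= y <= x + INR n * h -> 0 <= (-1) ^ n * F n y) ->
  0 <= bdiff h n (F O) x.
Proof.
  intros Hh. revert F. induction n as [|n IH]; intros F Hd Hs.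
  - specialize (Hs x). simpl in *. lra.
  - rewrite bdiff_S_l.
    assert (E : INR (S n) * h = INR n * h + h) by (rewrite S_INR; ring).
    apply (IH (fun i y => F i y - F i (y + h))).
    + intros i y Hi Hy. apply (is_derive_minus (F i) (fun y => F i (y + h))).
      * apply Hd; [lia|lra].
      * apply (is_derive_shift (F i)), Hd; [lia|lra].
    + intros y Hy.
      destruct (mean_value (F n) (F (S n)) y (y + h)) as [c [Hc Ec]].
      * lra.
      * intros z Hz. apply Hd; [lia|lra].
      * specialize (Hs c ltac:(lra)). simpl in Hs.
        replace ((-1) ^ n * (F n y - F n (y + h))) with (- ((-1) ^ n * (F n (y + h) - F n y)))
          by ring.
        rewrite Ec. replace (y + h - y) with h by ring.
        replace (- ((-1) ^ n * (F (S n) c * h))) with ((-1 * (-1) ^ n * F (S n) c) * h) by ring.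
        apply Rmult_le_pos; lra.
Qed.

(** Positivity for [G - F] and [G + F]. Derivatives are compared pointwise while the conclusion
    keeps the exact difference of [G], so nothing is lost to the variation of the derivatives over
    [[x, x + n h]]. *)
Lemma bdiff_dominated (h : R) (n : nat) (F G : nat -> R -> R) (x : R) :
  0 <= h ->
  (forall i y, (i < n)%nat -> x <= y <= x + INR n * h -> is_derive (F i) y (F (S i) y)) ->
  (forall i y, (i < n)%nat -> x <= y <= x + INR n * h -> is_derive (G i) y (G (S i) y)) ->
  (forall y, x <= y <= x + INR n * h -> Rabs (F n y) <= (-1) ^ n * G n y) ->
  Rabs (bdiff h n (F O) x) <= bdiff h n (G O) x.
Proof.
  intros Hh HF HG H.
  assert (S1 : forall y, x <= y <= x + INR n * h -> Rabs ((-1) ^ n * F n y) <= (-1) ^ n * G n y).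
  { intros y Hy. rewrite Rabs_mult, pow_1_abs, Rmult_1_l. now apply H. }
  assert (A : 0 <= bdiff h n (fun y => G O y - F O y) x).
  { apply (bdiff_nonneg h n (fun i y => G i y - F i y)); [easy| |].
    - intros i y Hi Hy. apply (is_derive_minus (G i) (F i)); auto.
    - intros y Hy. specialize (S1 y Hy). apply Rabs_le_between in S1. lra. }
  assert (B : 0 <= bdiff h n (fun y => G O y + F O y) x).
  { apply (bdiff_nonneg h n (fun i y => G i y + F i y)); [easy| |].
    - intros i y Hi Hy. apply (is_derive_plus (G i) (F i)); auto.
    - intros y Hy. specialize (S1 y Hy). apply Rabs_le_between in S1. lra. }
  rewrite bdiff_minus in A. rewrite bdiff_plus in B. apply Rabs_le. lra.
Qed.

(** The supremum bound, used at orders up to 3 only, where it extracts negative powers of [x]. *)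
Lemma bdiff_bound (h K : R) (n : nat) (F : nat -> R -> R) (x : R) :
  0 <= h ->
  (forall i y, (i < n)%nat -> x <= y <= x + INR n * h -> is_derive (F i) y (F (S i) y)) ->
  (forall y, x <= y <= x + INR n * h -> Rabs (F n y) <= K) ->
  Rabs (bdiff h n (F O) x) <= K * h ^ n.
Proof.
  intros Hh. revert F K. induction n as [|n IH]; intros F K Hd HK.
  - simpl. specialize (HK x). simpl in HK. lra.
  - rewrite bdiff_S_l.
    assert (E : INR (S n) * h = INR n * h + h) by (rewrite S_INR; ring).
    replace (K * h ^ S n) with ((K * h) * h ^ n) by (simpl; ring).
    apply (IH (fun i y => F i y - F i (y + h))).
    + intros i y Hi Hy. apply (is_derive_minus (F i) (fun y => F i (y + h))).
      * apply Hd; [lia|lra].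
      * apply (is_derive_shift (F i)), Hd; [lia|lra].
    + intros y Hy.
      destruct (mean_value (F n) (F (S n)) y (y + h)) as [c [Hc Ec]].
      * lra.
      * intros z Hz. apply Hd; [lia|lra].
      * rewrite Rabs_minus_sym, Ec, Rabs_mult.
        replace (y + h - y) with h by ring. rewrite (Rabs_right h) by lra.
        apply Rmult_le_compat_r; [lra|]. apply HK. lra.
Qed.

(** The product [n! h^n / (x (x + h) ... (x + n h))], with one factor [i h / (x + i h)] for each
    order. *)
Fixpoint inv_diff (h : R) (n : nat) (x : R) : R :=
  match n with
  | O => / x
  | S m => inv_diff h m x * (INR (S m) * h / (x + INR (S m) * h))
  end.

Lemma inv_diff_shift (h : R) (n : nat) (x : R) :
  0 < x -> 0 <= h -> inv_diff h n (x + h) * (x + INR (S n) * h) = inv_diff h n x * x.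
Proof.
  intros Hx Hh. induction n as [|n IH].
  - simpl. field. split; lra.
  - change (inv_diff h (S n) (x + h)) with
      (inv_diff h n (x + h) * (INR (S n) * h / (x + h + INR (S n) * h))).
    change (inv_diff h (S n) x) with (inv_diff h n x * (INR (S n) * h / (x + INR (S n) * h))).
    assert (0 <= INR (S n) * h) by (apply Rmult_le_pos; [apply pos_INR|lra]).
    rewrite (S_INR (S n)).
    set (t := INR (S n) * h) in *.
    replace (x + (INR (S n) + 1) * h) with (x + t + h) by (unfold t; ring).
    replace (x + h + t) with (x + t + h) by ring.
    replace (inv_diff h n (x + h) * (t / (x + t + h)) * (x + t + h))
      with ((inv_diff h n (x + h) * (x + t)) * t / (x + t)) by (field; lra).
    rewrite IH. field. lra.
Qed.

Lemma bdiff_inv (h : R) (n : nat) (x : R) :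
  0 < x -> 0 <= h -> bdiff h n Rinv x = inv_diff h n x.
Proof.
  intros Hx Hh. revert x Hx. induction n as [|n IH]; intros x Hx; [easy|].
  cbn [bdiff]. rewrite !IH by lra.
  pose proof (inv_diff_shift h n x Hx Hh) as E.
  change (inv_diff h (S n) x) with (inv_diff h n x * (INR (S n) * h / (x + INR (S n) * h))).
  assert (0 <= INR (S n) * h) by (apply Rmult_le_pos; [apply pos_INR|lra]).
  set (t := INR (S n) * h) in *.
  replace (inv_diff h n (x + h)) with (inv_diff h n x * x / (x + t)).
  - field. lra.
  - rewrite <- E. field. lra.
Qed.

(** For [x >= 1] and [h <= 1] the i-th factor of [inv_diff] is at most [i / (i + 1)], and the
    product of these telescopes. The bound is free of [h], as is required once [h] is an unknown
    intermediate point. *)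
Lemma bdiff_inv_bound (h : R) (n : nat) (x : R) :
  1 <= x -> 0 <= h <= 1 -> 0 <= bdiff h n Rinv x <= / INR (S n).
Proof.
  intros Hx Hh. rewrite bdiff_inv by lra. induction n as [|n IH].
  - simpl. split; [left; apply Rinv_0_lt_compat; lra|].
    apply Rinv_le_contravar; lra.
  - change (inv_diff h (S n) x) with (inv_diff h n x * (INR (S n) * h / (x + INR (S n) * h))).
    pose proof (INR_S_pos n) as Hn.
    assert (Ht : 0 <= INR (S n) * h) by (apply Rmult_le_pos; lra).
    assert (Q : 0 <= INR (S n) * h / (x + INR (S n) * h) <= INR (S n) / INR (S (S n))).
    { split; [apply Rdiv_le_0_compat; lra|].
      rewrite (S_INR (S n)).
      apply Rmult_le_reg_r with (x + INR (S n) * h); [lra|].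
      apply Rmult_le_reg_r with (INR (S n) + 1); [lra|].
      replace (INR (S n) * h / (x + INR (S n) * h) * (x + INR (S n) * h) * (INR (S n) + 1))
        with (INR (S n) * (INR (S n) * h + h)) by (field; lra).
      replace (INR (S n) / (INR (S n) + 1) * (x + INR (S n) * h) * (INR (S n) + 1))
        with (INR (S n) * (x + INR (S n) * h)) by (field; lra).
      apply Rmult_le_compat_l; lra. }
    split; [apply Rmult_le_pos; lra|].
    replace (/ INR (S (S n))) with (/ INR (S n) * (INR (S n) / INR (S (S n)))).
    + apply Rmult_le_compat; lra.
    + pose proof (INR_S_pos (S n)). field. lra.
Qed.

(** Leibniz's rule for differences: a linear factor has only one nonzero difference, hence two
    terms. The factor [n] of the second term meets the weight [1 / (n + 1)] of the Hasse series. *)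
Lemma bdiff_mul_linear (c : R) (n : nat) (F : R -> R) (x : R) :
  bdiff 1 n (fun y => (y - c) * F y) x
  = (x - c) * bdiff 1 n F x - INR n * bdiff 1 (pred n) F (x + 1).
Proof.
  revert x. induction n as [|n IH]; intros x; [simpl; ring|].
  simpl bdiff at 1. rewrite !IH. rewrite S_INR. cbn [pred].
  destruct n as [|n]; [simpl; ring|].
  cbn [pred]. change (bdiff 1 (S (S n)) F x) with (bdiff 1 (S n) F x - bdiff 1 (S n) F (x + 1)).
  change (bdiff 1 (S n) F (x + 1)) with (bdiff 1 n F (x + 1) - bdiff 1 n F (x + 1 + 1)).
  ring.
Qed.

Lemma bdiff_telescope (h : R) (n m : nat) (F : R -> R) (x : R) :
  psum (fun k => bdiff h (n + k) F (x + h)) m = bdiff h n F x - bdiff h (n + m) F x.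
Proof.
  rewrite (psum_ext _ (fun k => (-1) * (bdiff h (n + S k) F x - bdiff h (n + k) F x))).
  - rewrite psum_scal, (psum_telescope (fun k => bdiff h (n + k) F x)).
    rewrite Nat.add_0_r. ring.
  - intros k _. rewrite Nat.add_succ_r. simpl. ring.
Qed.

(** The node [x + (a + k) h] moves with speed [a + k], and Leibniz's rule for this linear weight
    yields the two terms. The offset [a] serves the induction: taking off one difference turns [a]
    into [S a]. *)
Lemma is_derive_bdiff_step (F F' : R -> R) (x h : R) (n a : nat) :
  (forall k : nat, is_derive F (x + INR k * h) (F' (x + INR k * h))) ->
  is_derive (fun h => bdiff h n F (x + INR a * h)) h
    (INR a * bdiff h n F' (x + INR a * h)
     - INR n * bdiff h (pred n) F' (x + INR (S a) * h)).
Proof.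
  intros HF. revert a. induction n as [|n IH]; intros a.
  - change (is_derive (fun h => F (x + INR a * h)) h
      (INR a * F' (x + INR a * h) - INR 0 * F' (x + INR (S a) * h))).
    replace (INR a * F' (x + INR a * h) - INR 0 * F' (x + INR (S a) * h))
      with (scal (INR a) (F' (x + INR a * h))) by (unfold scal; simpl; unfold mult; simpl; ring).
    apply (is_derive_comp F (fun h => x + INR a * h)); [apply HF|].
    auto_derive; [easy|ring].
  - apply (is_derive_ext (fun h => bdiff h n F (x + INR a * h) - bdiff h n F (x + INR (S a) * h))).
    { intros t. cbn [bdiff]. f_equal. f_equal. rewrite S_INR. ring. }
    assert (EQ : INR a * bdiff h (S n) F' (x + INR a * h)
       - INR (S n) * bdiff h (pred (S n)) F' (x + INR (S a) * h)
       = (INR a * bdiff h n F' (x + INR a * h)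
          - INR n * bdiff h (pred n) F' (x + INR (S a) * h))
         - (INR (S a) * bdiff h n F' (x + INR (S a) * h)
          - INR n * bdiff h (pred n) F' (x + INR (S (S a)) * h))).
    { cbn [pred]. cbn [bdiff].
      replace (x + INR a * h + h) with (x + INR (S a) * h) by (rewrite S_INR; ring).
      assert (E2 : x + INR (S (S a)) * h = x + INR (S a) * h + h) by (rewrite (S_INR (S a)); ring).
      rewrite E2. set (p := x + INR (S a) * h). rewrite (S_INR n), (S_INR a).
      destruct n as [|n]; [cbn [bdiff pred]; simpl INR; ring|].
      cbn [pred].
      change (bdiff h (S n) F' p) with (bdiff h n F' p - bdiff h n F' (p + h)).
      ring. }
    rewrite EQ. apply (is_derive_minus (fun h => bdiff h n F (x + INR a * h))
      (fun h => bdiff h n F (x + INR (S a) * h))); apply IH.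
Qed.

(** * Differences of the squared logarithm *)


Definition inv_der (n : nat) (y : R) : R := (-1) ^ n * INR (fact n) / y ^ S n.

Definition xlnx_der (n : nat) (y : R) : R :=
  match n with
  | O => y * ln y
  | S O => ln y + 1
  | S (S m) => inv_der m y
  end.

(** Differentiating [(ln y - H) / y ^ S m] brings out the factor [- S m] and replaces [H] by
    [H + 1 / S m]; this is how harmonic numbers enter. *)
Definition lnsq_der (n : nat) (y : R) : R :=
  match n with
  | O => ln y ^ 2
  | S m => 2 * (-1) ^ m * INR (fact m) * (ln y - harmonic m) / y ^ S m
  end.

Lemma is_derive_inv_der (n : nat) (y : R) :
  0 < y -> is_derive (inv_der n) y (inv_der (S n) y).
Proof.
  intros Hy. unfold inv_der.
  assert (y ^ S n <> 0) by (apply pow_nonzero; lra).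
  assert (y ^ n <> 0) by (apply pow_nonzero; lra).
  auto_derive; [easy|].
  change (fact (S n)) with (S n * fact n)%nat. rewrite mult_INR.
  replace (match n with O => 1 | S _ => INR n + 1 end) with (INR n + 1) by (destruct n; simpl; ring).
  rewrite S_INR. simpl pow. field. split; lra.
Qed.

Lemma is_derive_xlnx_der (n : nat) (y : R) :
  0 < y -> is_derive (xlnx_der n) y (xlnx_der (S n) y).
Proof.
  intros Hy. destruct n as [|[|n]].
  - unfold xlnx_der. auto_derive; [easy|field; lra].
  - unfold xlnx_der. auto_derive; [easy|].
    unfold inv_der. simpl. field. lra.
  - apply is_derive_inv_der, Hy.
Qed.

Lemma is_derive_lnsq_der (n : nat) (y : R) :
  0 < y -> is_derive (lnsq_der n) y (lnsq_der (S n) y).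
Proof.
  intros Hy. destruct n as [|n].
  - unfold lnsq_der. auto_derive; [easy|].
    unfold harmonic. simpl. field. lra.
  - unfold lnsq_der.
    assert (y ^ S n <> 0) by (apply pow_nonzero; lra).
    assert (y ^ n <> 0) by (apply pow_nonzero; lra).
    auto_derive; [easy|].
    change (fact (S n)) with (S n * fact n)%nat. rewrite mult_INR.
    change (harmonic (S n)) with (harmonic n + / INR (S n)).
    pose proof (INR_S_pos n).
    replace (match n with O => 1 | S _ => INR n + 1 end) with (INR n + 1) by (destruct n; simpl; ring).
    rewrite S_INR in *. simpl pow. field. repeat split; lra.
Qed.

(** [harmonic (S n)] exceeds [ln (INR (S n))] by something between 0 and 1, which the [- 1] of
    [ln_div_bound] absorbs. The symmetric bound becomes polynomial after clearing denominators,
    hence easy to compare with the derivatives of [1 / y]. *)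
Lemma ln_sub_harmonic (n : nat) (y : R) :
  0 < y -> Rabs (ln y - harmonic (S n)) <= y / INR (S n) + INR (S n) / y.
Proof.
  intros Hy. pose proof (INR_S_pos n) as Hn.
  pose proof (ln_div_bound y (INR (S n)) Hy Hn) as B.
  pose proof (harmonic_le_ln n). pose proof (ln_le_harmonic n) as L.
  assert (0 < / INR (S n)) by now apply Rinv_0_lt_compat.
  assert (harmonic (S n) = harmonic n + / INR (S n)) by easy.
  apply Rabs_le_between in B. apply Rabs_le. lra.
Qed.

Lemma lnsq_der_bound (n : nat) (y : R) :
  0 < y ->
  Rabs (lnsq_der (S (S n)) y)
  <= 2 * INR (fact (S n)) * (y / INR (S n) + INR (S n) / y) / y ^ S (S n).
Proof.
  intros Hy. unfold lnsq_der. unfold Rdiv at 1. rewrite !Rabs_mult, pow_1_abs.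
  assert (0 < y ^ S (S n)) by (apply pow_lt; lra).
  assert (0 < / y ^ S (S n)) by now apply Rinv_0_lt_compat.
  rewrite (Rabs_right 2) by lra.
  rewrite (Rabs_right (INR _)) by (apply Rle_ge, pos_INR).
  rewrite (Rabs_right (/ _)) by lra. rewrite Rmult_1_r.
  apply Rmult_le_compat_r; [lra|]. apply Rmult_le_compat_l.
  - apply Rmult_le_pos; [lra|apply pos_INR].
  - now apply ln_sub_harmonic.
Qed.

Lemma sign_inv_der (n : nat) (y : R) : (-1) ^ n * inv_der n y = INR (fact n) / y ^ S n.
Proof.
  unfold inv_der. unfold Rdiv. rewrite <- !Rmult_assoc, <- Rpow_mult_distr.
  replace (-1 * -1) with 1 by ring. rewrite pow1. ring.
Qed.

Lemma inv_der_0 (y : R) : inv_der 0 y = / y.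
Proof. unfold inv_der. simpl. unfold Rdiv. rewrite !Rmult_1_r, !Rmult_1_l. easy. Qed.

Lemma bdiff_inv_der (h : R) (n : nat) (x : R) : bdiff h n (inv_der 0) x = bdiff h n Rinv x.
Proof. apply bdiff_ext. intros. apply inv_der_0. Qed.

Lemma is_lim_seq_bdiff_lnsq (x : R) :
  1 <= x -> is_lim_seq (fun n => bdiff 1 n (lnsq_der 0) x) 0.
Proof.
  (* With [n = m + 2] and [y <= x + n], one has [y / (m + 1) <= x + 2] and [y <= (x + 2) n], so that
     [y^2 / (m + 1) + (m + 1)] is at most [((x + 2)^2 + 1) n]; the factor 2 is that of
     [lnsq_der]. *)
  intros Hx. set (C := 2 * ((x + 2) ^ 2 + 1)).
  assert (HC : 0 <= C) by (unfold C; pose proof (pow2_ge_0 (x + 2)); lra).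
  apply is_lim_seq_0_le with (v := fun n => C * / INR (S n)) (N := 2%nat).
  2:{ apply is_lim_seq_scal_0, is_lim_seq_inv_S. }
  intros n Hn. destruct n as [|[|m]]; [lia|lia|].
  eapply Rle_trans.
  - apply (bdiff_dominated 1 (S (S m)) lnsq_der (fun i y => C * inv_der i y)); [lra| | |].
    + intros i y _ Hy. apply is_derive_lnsq_der. lra.
    + intros i y _ Hy. apply (is_derive_scal (inv_der i)). apply is_derive_inv_der. lra.
    + intros y Hy. rewrite Rmult_1_r in Hy.
      eapply Rle_trans; [apply lnsq_der_bound; lra|].
      replace ((-1) ^ S (S m) * (C * inv_der (S (S m)) y))
        with (C * ((-1) ^ S (S m) * inv_der (S (S m)) y)) by ring.
      rewrite sign_inv_der.
      change (fact (S (S m))) with (S (S m) * fact (S m))%nat. rewrite mult_INR.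
      pose proof (INR_fact_lt_0 (S m)) as HF. set (FF := INR (fact (S m))) in *.
      rewrite !S_INR in Hy. rewrite !S_INR. pose proof (pos_INR m) as Hm.
      set (t := INR m) in *.
      change (y ^ S (S (S m))) with (y * y ^ S (S m)).
      assert (HP : 0 < y ^ S (S m)) by (apply pow_lt; lra).
      set (P := y ^ S (S m)) in *.
      apply Rmult_le_reg_r with (P * y); [apply Rmult_lt_0_compat; lra|].
      replace (2 * FF * (y / (t + 1) + (t + 1) / y) / P * (P * y))
        with (FF * (2 * (y / (t + 1) * y + (t + 1)))) by (field; lra).
      replace (C * ((t + 1 + 1) * FF / (y * P)) * (P * y))
        with (FF * (C * (t + 2))) by (field; lra).
      apply Rmult_le_compat_l; [lra|].
      assert (y / (t + 1) <= x + 2).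
      { apply Rmult_le_reg_r with (t + 1); [lra|].
        replace (y / (t + 1) * (t + 1)) with y by (field; lra). nra. }
      assert (y <= (x + 2) * (t + 2)) by nra.
      assert (y / (t + 1) * y <= (x + 2) * ((x + 2) * (t + 2))).
      { apply Rmult_le_compat; try lra. apply Rdiv_le_0_compat; lra. }
      unfold C. nra.
  - rewrite bdiff_scal, bdiff_inv_der. apply Rmult_le_compat_l; [easy|].
    apply bdiff_inv_bound; lra.
Qed.

Lemma pow_succ_lower (z : R) (k : nat) : 0 <= z -> z ^ S k + INR (S k) * z ^ k <= (z + 1) ^ S k.
Proof.
  intros Hz. induction k as [|k IH]; [simpl; lra|].
  change ((z + 1) ^ S (S k)) with ((z + 1) * (z + 1) ^ S k).
  apply Rle_trans with ((z + 1) * (z ^ S k + INR (S k) * z ^ k)).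
  - assert (0 <= z ^ k) by (apply pow_le; lra).
    rewrite (S_INR (S k)). set (N := INR (S k)).
    assert (0 <= N) by apply pos_INR. simpl. 
    assert (0 <= N * z ^ k) by (apply Rmult_le_pos; lra). nra.
  - apply Rmult_le_compat_l; lra.
Qed.

(** Here the comparison function is [1 / (y - 1)]. Against [1 / y] the ratio of derivatives would
    contain the unbounded term [n / y]; the shift multiplies it by a high power of [(y - 1) / y],
    which compensates by [pow_succ_lower]. The hypothesis [2 <= x] keeps [y - 1] in the range of
    [bdiff_inv_bound]. *)
Lemma bdiff_lnsq_der_1 (x h : R) (n : nat) :
  2 <= x -> 0 <= h <= 1 ->
  Rabs (bdiff h (S n) (lnsq_der 1) x) <= (2 * x + 4) * / INR (S (S n)).
Proof.
  intros Hx Hh.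
  eapply Rle_trans.
  - apply (bdiff_dominated h (S n) (fun i => lnsq_der (S i))
             (fun i y => (2 * x + 4) * inv_der i (y - 1))); [lra| | |].
    + intros i y _ Hy. apply is_derive_lnsq_der. lra.
    + intros i y _ Hy. apply (is_derive_scal (fun y => inv_der i (y - 1))).
      apply (is_derive_shift (inv_der i) y _ (-1)). apply is_derive_inv_der. lra.
    + intros y Hy.
      assert (Hy2 : y <= x + INR (S n)).
      { assert (INR (S n) * h <= INR (S n) * 1) by (apply Rmult_le_compat_l; [apply pos_INR|lra]).
        lra. }
      eapply Rle_trans; [apply lnsq_der_bound; lra|].
      replace ((-1) ^ S n * ((2 * x + 4) * inv_der (S n) (y - 1)))
        with ((2 * x + 4) * ((-1) ^ S n * inv_der (S n) (y - 1))) by ring.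
      rewrite sign_inv_der.
      pose proof (INR_fact_lt_0 (S n)) as HF. set (FF := INR (fact (S n))) in *.
      pose proof (INR_S_ge_1 n) as Hn.
      assert (HP : 0 < (y - 1) ^ S (S n)) by (apply pow_lt; lra).
      assert (HQ : 0 < y ^ S (S n)) by (apply pow_lt; lra).
      assert (L1 : (y - 1) ^ S (S n) <= y ^ S (S n)) by (apply pow_incr; lra).
      assert (L2 : INR (S n) * (y - 1) ^ S (S n) <= y * y ^ S (S n)).
      { pose proof (pow_succ_lower (y - 1) (S (S n)) ltac:(lra)) as L.
        replace (y - 1 + 1) with y in L by ring.
        change (y * y ^ S (S n)) with (y ^ S (S (S n))).
        assert (0 <= (y - 1) ^ S (S (S n))) by (apply pow_le; lra).
        rewrite (S_INR (S (S n))), (S_INR (S n)) in L. nra. }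
      set (P := (y - 1) ^ S (S n)) in *. set (Q := y ^ S (S n)) in *.
      apply Rmult_le_reg_r with (P * Q); [apply Rmult_lt_0_compat; lra|].
      replace (2 * FF * (y / INR (S n) + INR (S n) / y) / Q * (P * Q))
        with (FF * (2 * (y / INR (S n) * P) + 2 * (INR (S n) * P / y))) by (field; lra).
      replace ((2 * x + 4) * (FF / P) * (P * Q)) with (FF * ((2 * x + 4) * Q)) by (field; lra).
      apply Rmult_le_compat_l; [lra|].
      assert (y / INR (S n) <= x + 1).
      { apply Rmult_le_reg_r with (INR (S n)); [lra|].
        replace (y / INR (S n) * INR (S n)) with y by (field; lra). nra. }
      assert (y / INR (S n) * P <= (x + 1) * Q).
      { apply Rmult_le_compat; try lra. apply Rdiv_le_0_compat; lra. }
      assert (INR (S n) * P / y <= Q).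
      { apply Rmult_le_reg_r with y; [lra|].
        replace (INR (S n) * P / y * y) with (INR (S n) * P) by (field; lra). lra. }
      lra.
  - rewrite (bdiff_scal h (2 * x + 4) (S n) (fun y => inv_der 0 (y - 1))).
    rewrite (bdiff_shift h (-1) (S n) (inv_der 0)), bdiff_inv_der.
    apply Rmult_le_compat_l; [lra|]. apply bdiff_inv_bound; lra.
Qed.

(* The derivative of the left side in the step [h] telescopes; the mean value theorem is applied
   in [h] over [[0, 1]]. *)
Lemma psum_bdiff_step_error (x : R) (N : nat) :
  2 <= x ->
  exists h, 0 <= h <= 1 /\
    psum (fun n => bdiff 1 (S n) (lnsq_der 0) x / INR (S n)) N
    = bdiff h N (lnsq_der 1) x - lnsq_der 1 x.
Proof.
  intros Hx.
  destruct (mean_value (fun h => psum (fun n => bdiff h (S n) (lnsq_der 0) x / INR (S n)) N)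
    (fun h => bdiff h N (lnsq_der 1) x - lnsq_der 1 x) 0 1) as [h [Hh E]]; [lra| |].
  - intros h Hh.
    replace (bdiff h N (lnsq_der 1) x - lnsq_der 1 x)
      with (psum (fun n => - bdiff h n (lnsq_der 1) (x + h)) N).
    2:{ assert (T : psum (fun n => bdiff h n (lnsq_der 1) (x + h)) N
                    = lnsq_der 1 x - bdiff h N (lnsq_der 1) x)
          by exact (bdiff_telescope h 0 N (lnsq_der 1) x).
        rewrite (psum_ext _ (fun n => (-1) * bdiff h n (lnsq_der 1) (x + h))) by (intros; ring).
        rewrite psum_scal, T. ring. }
    induction N as [|N IH]; simpl psum; [apply (is_derive_const 0)|].
    apply (is_derive_plus (fun h => psum (fun n => bdiff h (S n) (lnsq_der 0) x / INR (S n)) N)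
      (fun h => bdiff h (S N) (lnsq_der 0) x / INR (S N))); [exact IH|].
    pose proof (INR_S_pos N) as HN.
    replace (- bdiff h N (lnsq_der 1) (x + h))
      with ((INR 0 * bdiff h (S N) (lnsq_der 1) (x + INR 0 * h)
             - INR (S N) * bdiff h (pred (S N)) (lnsq_der 1) (x + INR 1 * h)) * / INR (S N)).
    2:{ cbn [pred]. simpl (INR 0). simpl (INR 1). rewrite Rmult_1_l. field. lra. }
    apply (is_derive_mult_const (fun h => bdiff h (S N) (lnsq_der 0) x)).
    apply (is_derive_ext (fun h => bdiff h (S N) (lnsq_der 0) (x + INR 0 * h))).
    { intros t. f_equal. simpl. ring. }
    apply is_derive_bdiff_step. intros k. apply is_derive_lnsq_der.
    assert (0 <= INR k * h) by (apply Rmult_le_pos; [apply pos_INR|lra]). lra.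
  - exists h. split; [easy|].
    assert (Z : psum (fun n => bdiff 0 (S n) (lnsq_der 0) x / INR (S n)) N = 0).
    { rewrite (psum_ext _ (fun _ => 0)).
      - rewrite psum_const. ring.
      - intros k _. rewrite bdiff_step_0. unfold Rdiv. ring. }
    rewrite Z in E. lra.
Qed.

(** This is [D = ln (1 + Delta)] applied to [ln^2]. The error of a partial sum is exactly one
    difference of the derivative with an unknown step in [[0, 1]], and the bound on it holds for all
    such steps at once. *)
Lemma is_lim_seq_newton_derivative (x : R) :
  2 <= x ->
  is_lim_seq (psum (fun n => bdiff 1 (S n) (lnsq_der 0) x / INR (S n))) (- lnsq_der 1 x).
Proof.
  intros Hx. apply is_lim_seq_dist.
  apply is_lim_seq_0_le with (v := fun n => (2 * x + 4) * / INR (S n)) (N := 1%nat).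
  - intros n Hn. destruct n as [|n]; [lia|].
    destruct (psum_bdiff_step_error x (S n) Hx) as [h [Hh E]]. rewrite E.
    replace (bdiff h (S n) (lnsq_der 1) x - lnsq_der 1 x - - lnsq_der 1 x)
      with (bdiff h (S n) (lnsq_der 1) x) by ring.
    now apply bdiff_lnsq_der_1.
  - apply is_lim_seq_scal_0, is_lim_seq_inv_S.
Qed.

(** * The Hasse series as a limit *)


(* On the Laplace side [ln^2] has density [2 (ln t + gamma) / t], which is dominated by
   [2 / t^2 + 2], the density of this function; the linear part is invisible from the second
   difference on. *)
Definition lnsq_majorant (n : nat) (y : R) : R := 2 * xlnx_der n y + 2 * inv_der n y.

Lemma is_derive_lnsq_majorant (n : nat) (y : R) :
  0 < y -> is_derive (lnsq_majorant n) y (lnsq_majorant (S n) y).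
Proof.
  intros Hy. apply (is_derive_plus (fun y => 2 * xlnx_der n y) (fun y => 2 * inv_der n y)).
  - apply (is_derive_scal (xlnx_der n)), is_derive_xlnx_der, Hy.
  - apply (is_derive_scal (inv_der n)), is_derive_inv_der, Hy.
Qed.

(** With [N = n + 1], the terms [y / N] and [N / y] of [lnsq_der_bound] match the derivatives of
    [2 x ln x] and [2 / x] respectively; what remains is [y^2 + N^2 <= y^2 + N (N + 1)]. *)
Lemma bdiff_lnsq_dominated (n : nat) (x : R) :
  0 < x ->
  Rabs (bdiff 1 (S (S n)) (lnsq_der 0) x) <= bdiff 1 (S (S n)) (lnsq_majorant 0) x.
Proof.
  intros Hx. apply bdiff_dominated; [lra| | |].
  - intros i y _ Hy. apply is_derive_lnsq_der. lra.
  - intros i y _ Hy. apply is_derive_lnsq_majorant. lra.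
  - intros y Hy.
    eapply Rle_trans; [apply lnsq_der_bound; lra|].
    replace ((-1) ^ S (S n) * lnsq_majorant (S (S n)) y)
      with (2 * ((-1) ^ n * inv_der n y) + 2 * ((-1) ^ S (S n) * inv_der (S (S n)) y)).
    2:{ unfold lnsq_majorant. cbn [xlnx_der]. simpl pow. ring. }
    rewrite !sign_inv_der.
    change (fact (S (S n))) with (S (S n) * (S n * fact n))%nat.
    change (fact (S n)) with (S n * fact n)%nat. rewrite !mult_INR.
    rewrite (S_INR (S n)).
    pose proof (INR_fact_lt_0 n) as HF. pose proof (INR_S_pos n) as HN.
    set (FF := INR (fact n)) in *. set (N := INR (S n)) in *.
    assert (HP : 0 < y ^ S n) by (apply pow_lt; lra).
    change (y ^ S (S (S n))) with (y * (y * y ^ S n)).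
    change (y ^ S (S n)) with (y * y ^ S n). set (P := y ^ S n) in *.
    clearbody P N FF.
    apply Rmult_le_reg_r with (y * y * P); [repeat apply Rmult_lt_0_compat; lra|].
    replace (2 * (N * FF) * (y / N + N / y) / (y * P) * (y * y * P))
      with (2 * FF * (y * y + N * N)) by (field; lra).
    replace ((2 * (FF / P) + 2 * ((N + 1) * (N * FF) / (y * (y * P)))) * (y * y * P))
      with (2 * FF * (y * y + N * (N + 1))) by (field; lra).
    apply Rmult_le_compat_l; [lra|]. rewrite Rmult_plus_distr_l. lra.
Qed.

Lemma bdiff_majorant_nonneg (n : nat) (x : R) :
  0 < x -> 0 <= bdiff 1 (S (S n)) (lnsq_majorant 0) x.
Proof.
  intros Hx. eapply Rle_trans; [apply Rabs_pos|now apply bdiff_lnsq_dominated].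
Qed.

Lemma inv_pow_le (x y : R) (n : nat) : 0 < x <= y -> 0 < / y ^ n <= / x ^ n.
Proof.
  intros H. split.
  - apply Rinv_0_lt_compat, pow_lt. lra.
  - apply Rinv_le_contravar; [apply pow_lt; lra|apply pow_incr; lra].
Qed.

Lemma inv_pow_le_prev (x : R) (n : nat) : 1 <= x -> / x ^ S n <= / x ^ n.
Proof.
  intros Hx. assert (0 < x ^ n) by (apply pow_lt; lra).
  apply Rinv_le_contravar; [easy|]. simpl. nra.
Qed.

(** The second derivative of the majorant is [2 / y + 4 / y^3], hence 6. The third has modulus
    [2 / y^2 + 12 / y^4], hence the 14 of the next lemma. *)
Lemma bdiff_majorant_2 (x : R) : 1 <= x -> bdiff 1 2 (lnsq_majorant 0) x <= 6 / x.
Proof.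
  intros Hx. eapply Rle_trans; [apply Rle_abs|].
  replace (6 / x) with (6 / x * 1 ^ 2) by ring.
  apply bdiff_bound; [lra| |].
  - intros i y _ Hy. apply is_derive_lnsq_majorant. lra.
  - intros y Hy. unfold lnsq_majorant, xlnx_der, inv_der.
    pose proof (inv_pow_le x y 1 ltac:(lra)). pose proof (inv_pow_le x y 3 ltac:(lra)).
    pose proof (inv_pow_le_prev x 1 ltac:(lra)). pose proof (inv_pow_le_prev x 2 ltac:(lra)).
    rewrite (pow_1 x) in *. unfold Rdiv. simpl (fact _). simpl INR.
    apply Rabs_le. simpl ((-1) ^ _). lra.
Qed.

Lemma bdiff_majorant_3 (x : R) : 1 <= x -> bdiff 1 3 (lnsq_majorant 0) x <= 14 / x ^ 2.
Proof.
  intros Hx. eapply Rle_trans; [apply Rle_abs|].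
  replace (14 / x ^ 2) with (14 / x ^ 2 * 1 ^ 3) by ring.
  apply bdiff_bound; [lra| |].
  - intros i y _ Hy. apply is_derive_lnsq_majorant. lra.
  - intros y Hy. unfold lnsq_majorant, xlnx_der, inv_der.
    pose proof (inv_pow_le x y 2 ltac:(lra)). pose proof (inv_pow_le x y 4 ltac:(lra)).
    pose proof (inv_pow_le_prev x 2 ltac:(lra)). pose proof (inv_pow_le_prev x 3 ltac:(lra)).
    unfold Rdiv. simpl (fact _). simpl INR.
    apply Rabs_le. simpl ((-1) ^ _). lra.
Qed.

Lemma lnsq_der_1_2_bound (x y : R) :
  2 <= x -> x <= y <= x + 2 ->
  Rabs (lnsq_der 1 y) <= 2 * (2 + ln x) / x /\ Rabs (lnsq_der 2 y) <= 2 * (2 + ln x) / x ^ 2.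
Proof.
  intros Hx Hy.
  pose proof (ln_nonneg x ltac:(lra)). pose proof (ln_nonneg y ltac:(lra)).
  assert (L : ln y <= ln x + 1).
  { assert (B := ln_le_sub_1 (y / x) ltac:(apply Rdiv_lt_0_compat; lra)).
    rewrite ln_div in B by lra.
    assert (y / x <= 2).
    { apply Rmult_le_reg_r with x; [lra|]. replace (y / x * x) with y by (field; lra). lra. }
    lra. }
  unfold lnsq_der, harmonic. simpl psum. simpl INR. simpl ((-1) ^ _).
  pose proof (inv_pow_le x y 1 ltac:(lra)) as P1. pose proof (inv_pow_le x y 2 ltac:(lra)) as P2.
  rewrite (pow_1 x) in P1. rewrite (Rplus_0_l (/ 1)), Rinv_1, Rminus_0_r.
  unfold Rdiv. rewrite !Rabs_mult, (Rabs_right (/ y ^ 1)), (Rabs_right (/ y ^ 2)) by lra.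
  split; (apply Rmult_le_compat; [repeat apply Rmult_le_pos; apply Rabs_pos|lra| |lra]);
    rewrite (Rabs_right 2), Rabs_R1 by lra.
  - rewrite Rabs_right by lra. lra.
  - assert (Rabs (ln y - 1) <= 2 + ln x) by (apply Rabs_le; lra).
    rewrite Rabs_m1. lra.
Qed.

Definition xlnsq (y : R) : R := (y - 1) * lnsq_der 0 y.
Definition xlnsq' (y : R) : R := lnsq_der 0 y + (y - 1) * lnsq_der 1 y.

Definition hasse_psum (x : R) (N : nat) : R := psum (fun n => bdiff 1 n xlnsq x / INR (S n)) N.

(** By Leibniz's rule the summand splits into [- (x - 1)] times a term of Newton's series for the
    derivative and a term in which the weight cancels exactly and which telescopes. At [x = 1] the
    first part vanishes, so Newton's series is needed only from 2 on, where it has been shown to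
    converge. *)
Lemma is_lim_seq_hasse_diff (x : R) :
  x = 1 \/ 2 <= x ->
  is_lim_seq (fun N => hasse_psum (x + 1) N - hasse_psum x N) (xlnsq' x).
Proof.
  intros Hx.
  apply is_lim_seq_ext with (fun N =>
    - (x - 1) * psum (fun n => bdiff 1 (S n) (lnsq_der 0) x / INR (S n)) N
    + (lnsq_der 0 x - bdiff 1 N (lnsq_der 0) x)).
  - intros N. unfold hasse_psum. rewrite <- psum_minus, <- psum_scal.
    assert (T : psum (fun n => bdiff 1 n (lnsq_der 0) (x + 1)) N
                = lnsq_der 0 x - bdiff 1 N (lnsq_der 0) x)
      by exact (bdiff_telescope 1 0 N (lnsq_der 0) x).
    rewrite <- T, <- psum_plus. apply psum_ext. intros k _.
    pose proof (bdiff_mul_linear 1 (S k) (lnsq_der 0) x) as E.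
    change (bdiff 1 (S k) (fun y => (y - 1) * lnsq_der 0 y) x)
      with (bdiff 1 k xlnsq x - bdiff 1 k xlnsq (x + 1)) in E.
    cbn [pred] in E. pose proof (INR_S_pos k).
    replace (bdiff 1 k xlnsq (x + 1)) with
      (bdiff 1 k xlnsq x - ((x - 1) * bdiff 1 (S k) (lnsq_der 0) x -
                            INR (S k) * bdiff 1 k (lnsq_der 0) (x + 1))) by lra.
    set (b := bdiff 1 (S k) (lnsq_der 0) x). field. lra.
  - assert (L0 : is_lim_seq (fun N => lnsq_der 0 x - bdiff 1 N (lnsq_der 0) x) (lnsq_der 0 x)).
    { replace (Finite (lnsq_der 0 x)) with (Finite (lnsq_der 0 x - 0)) by (f_equal; ring).
      apply is_lim_seq_minus'; [apply is_lim_seq_const|apply is_lim_seq_bdiff_lnsq; lra]. }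
    destruct Hx as [-> | Hx].
    + replace (xlnsq' 1) with (lnsq_der 0 1) by (unfold xlnsq'; ring).
      apply is_lim_seq_ext with (2 := L0). intros n. ring.
    + replace (Finite (xlnsq' x)) with (Finite (- (x - 1) * - lnsq_der 1 x + lnsq_der 0 x))
        by (unfold xlnsq'; f_equal; ring).
      apply is_lim_seq_plus'; [|exact L0].
      apply (is_lim_seq_scal_l _ (- (x - 1)) (- lnsq_der 1 x)).
      now apply is_lim_seq_newton_derivative.
Qed.

(** Leibniz's rule leaves a difference of [ln^2] weighted by [x - 1] and one of lower order whose
    weight [n / (n + 1)] is below 1. Both are dominated by differences of the majorant, whose sums
    telescope to single differences at [x - 1] and [x]. Starting at index 3 makes the first of order
    3, so that its [1 / (x - 1)^2] beats the factor [x - 1]. *)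
Lemma hasse_tail (x : R) (N : nat) :
  2 <= x ->
  Rabs (psum (fun n => bdiff 1 (3 + n) xlnsq x / INR (S (3 + n))) N) <= 14 / (x - 1) + 6 / x.
Proof.
  intros Hx.
  eapply Rle_trans; [apply psum_Rabs|].
  apply Rle_trans with
    (psum (fun n => (x - 1) * bdiff 1 (3 + n) (lnsq_majorant 0) (x - 1 + 1)
                    + bdiff 1 (2 + n) (lnsq_majorant 0) (x + 1)) N).
  - apply psum_le. intros k _. unfold xlnsq. rewrite bdiff_mul_linear.
    replace (x - 1 + 1) with x by ring.
    change (3 + k)%nat with (S (S (S k))). change (2 + k)%nat with (S (S k)). cbn [pred].
    pose proof (bdiff_lnsq_dominated (S k) x ltac:(lra)) as D1.
    pose proof (bdiff_lnsq_dominated k (x + 1) ltac:(lra)) as D2.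
    set (a := bdiff 1 (S (S (S k))) (lnsq_der 0) x) in *.
    set (b := bdiff 1 (S (S k)) (lnsq_der 0) (x + 1)) in *.
    set (A := bdiff 1 (S (S (S k))) (lnsq_majorant 0) x) in *.
    set (B := bdiff 1 (S (S k)) (lnsq_majorant 0) (x + 1)) in *.
    pose proof (INR_S_ge_1 (S (S k))) as Hk. rewrite (S_INR (S (S (S k)))).
    set (t := INR (S (S (S k)))) in *.
    unfold Rdiv. rewrite Rabs_mult, (Rabs_right (/ (t + 1))).
    2:{ apply Rle_ge. left. apply Rinv_0_lt_compat. lra. }
    apply Rmult_le_reg_r with (t + 1); [lra|].
    rewrite Rmult_assoc, Rinv_l, Rmult_1_r by lra.
    eapply Rle_trans; [apply Rabs_triang|]. rewrite Rabs_Ropp, !Rabs_mult.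
    rewrite (Rabs_right (x - 1)), (Rabs_right t) by lra.
    pose proof (Rabs_pos a). pose proof (Rabs_pos b).
    assert ((x - 1) * Rabs a <= (x - 1) * A) by (apply Rmult_le_compat_l; lra).
    assert (t * Rabs b <= t * B) by (apply Rmult_le_compat_l; lra).
    assert (0 <= (x - 1) * A) by (apply Rmult_le_pos; lra).
    nra.
  - rewrite psum_plus, psum_scal, !bdiff_telescope.
    pose proof (bdiff_majorant_nonneg (S N) (x - 1) ltac:(lra)) as N1.
    pose proof (bdiff_majorant_nonneg N x ltac:(lra)) as N2.
    change (3 + N)%nat with (S (S (S N))). change (2 + N)%nat with (S (S N)).
    pose proof (bdiff_majorant_3 (x - 1) ltac:(lra)) as B3.
    pose proof (bdiff_majorant_2 x ltac:(lra)) as B2.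
    apply Rplus_le_compat; [|lra].
    replace (14 / (x - 1)) with ((x - 1) * (14 / (x - 1) ^ 2)) by (field; lra).
    apply Rmult_le_compat_l; lra.
Qed.

(** Index 0 gives [f], index 1 gives [- f' / 2] up to [2 l / x] with [l = 2 + ln x], index 2 is at
    most [2 l / x], and the tail is at most [34 / x <= 17 l / x]; together 21. The bound is uniform
    in [N]. *)
Lemma hasse_psum_asymptotic (x : R) (N : nat) :
  2 <= x ->
  Rabs (hasse_psum x (3 + N) - (xlnsq x - xlnsq' x / 2)) <= 21 * (2 + ln x) / x.
Proof.
  intros Hx. unfold hasse_psum. rewrite psum_add.
  pose proof (hasse_tail x N Hx) as T.
  change (fun n => bdiff 1 (3 + n) xlnsq x / INR (S (3 + n)))
    with (fun k => bdiff 1 (3 + k) xlnsq x / INR (S (3 + k))) in T.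
  set (t := psum (fun k => bdiff 1 (3 + k) xlnsq x / INR (S (3 + k))) N) in *.
  replace (psum (fun n => bdiff 1 n xlnsq x / INR (S n)) 3)
    with (xlnsq x + bdiff 1 1 xlnsq x / 2 + bdiff 1 2 xlnsq x / 3)
    by (simpl; field).
  set (l := 2 + ln x). pose proof (ln_nonneg x ltac:(lra)) as Hl.
  assert (G1 : forall z, x <= z <= x + 1 -> Rabs (bdiff 1 1 (lnsq_der 0) z) <= 2 * l / x).
  { intros z Hz. replace (2 * l / x) with (2 * l / x * 1 ^ 1) by ring.
    apply bdiff_bound; [lra| |].
    - intros i y _ Hy. apply is_derive_lnsq_der. simpl in Hy. lra.
    - intros y Hy. simpl in Hy. apply lnsq_der_1_2_bound; lra. }
  assert (G2 : Rabs (bdiff 1 2 (lnsq_der 0) x) <= 2 * l / x ^ 2).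
  { replace (2 * l / x ^ 2) with (2 * l / x ^ 2 * 1 ^ 2) by ring.
    apply bdiff_bound; [lra| |].
    - intros i y _ Hy. apply is_derive_lnsq_der. simpl in Hy. lra.
    - intros y Hy. simpl in Hy. apply lnsq_der_1_2_bound; lra. }
  assert (G3 : Rabs (bdiff 1 1 (lnsq_der 0) x + lnsq_der 1 x) <= 2 * l / x ^ 2).
  { cbn [bdiff].
    destruct (mean_value (lnsq_der 0) (lnsq_der 1) x (x + 1)) as [c [Hc E]]; [lra| |].
    { intros y Hy. apply is_derive_lnsq_der. lra. }
    destruct (mean_value (lnsq_der 1) (lnsq_der 2) x c) as [d [Hd E2]]; [lra| |].
    { intros y Hy. apply is_derive_lnsq_der. lra. }
    replace (lnsq_der 0 x - lnsq_der 0 (x + 1) + lnsq_der 1 x)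
      with (- (lnsq_der 2 d * (c - x))) by (rewrite <- E2; lra).
    rewrite Rabs_Ropp, Rabs_mult.
    destruct (lnsq_der_1_2_bound x d Hx ltac:(lra)) as [_ B].
    rewrite (Rabs_right (c - x)) by lra. fold l in B.
    pose proof (Rabs_pos (lnsq_der 2 d)). nra. }
  assert (Q : (x - 1) * (2 * l / x ^ 2) <= 2 * l / x).
  { apply Rmult_le_reg_r with (x ^ 2); [apply pow_lt; lra|].
    replace ((x - 1) * (2 * l / x ^ 2) * x ^ 2) with ((x - 1) * (2 * l)) by (field; lra).
    replace (2 * l / x * x ^ 2) with (x * (2 * l)) by (field; lra).
    unfold l. nra. }
  assert (F2 : Rabs (bdiff 1 2 xlnsq x) <= 6 * l / x).
  { unfold xlnsq. rewrite bdiff_mul_linear. cbn [pred]. simpl INR.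
    eapply Rle_trans; [apply Rabs_triang|]. rewrite Rabs_Ropp, !Rabs_mult.
    rewrite (Rabs_right (x - 1)), (Rabs_right (1 + 1)) by lra.
    specialize (G1 (x + 1) ltac:(lra)).
    assert ((x - 1) * Rabs (bdiff 1 2 (lnsq_der 0) x) <= (x - 1) * (2 * l / x ^ 2))
      by (apply Rmult_le_compat_l; lra).
    replace (6 * l / x) with (2 * l / x + 2 * (2 * l / x)) by (field; lra). lra. }
  assert (F1 : Rabs (bdiff 1 1 xlnsq x + xlnsq' x) <= 4 * l / x).
  { unfold xlnsq, xlnsq'. rewrite bdiff_mul_linear. cbn [pred]. simpl INR.
    replace ((x - 1) * bdiff 1 1 (lnsq_der 0) x - 1 * bdiff 1 0 (lnsq_der 0) (x + 1) +
      (lnsq_der 0 x + (x - 1) * lnsq_der 1 x))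
      with ((x - 1) * (bdiff 1 1 (lnsq_der 0) x + lnsq_der 1 x) + bdiff 1 1 (lnsq_der 0) x)
      by (cbn [bdiff]; ring).
    eapply Rle_trans; [apply Rabs_triang|]. rewrite !Rabs_mult.
    rewrite (Rabs_right (x - 1)) by lra.
    specialize (G1 x ltac:(lra)).
    assert ((x - 1) * Rabs (bdiff 1 1 (lnsq_der 0) x + lnsq_der 1 x)
      <= (x - 1) * (2 * l / x ^ 2)) by (apply Rmult_le_compat_l; lra).
    replace (4 * l / x) with (2 * l / x + 2 * l / x) by (field; lra). lra. }
  assert (Hx0 : 0 < / x) by (apply Rinv_0_lt_compat; lra).
  assert (X1 : 14 / (x - 1) <= 28 / x).
  { apply Rmult_le_reg_r with (x * (x - 1)); [nra|].
    replace (14 / (x - 1) * (x * (x - 1))) with (14 * x) by (field; lra).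
    replace (28 / x * (x * (x - 1))) with (28 * (x - 1)) by (field; lra). lra. }
  assert (X2 : 2 / x <= l / x) by (unfold l, Rdiv; apply Rmult_le_compat_r; lra).
  apply Rabs_le_between in F1. apply Rabs_le_between in F2. apply Rabs_le_between in T.
  unfold Rdiv in *. apply Rabs_le. lra.
Qed.

Lemma is_lim_seq_ln_over_S : is_lim_seq (fun n => ln (INR (S n)) / INR (S n)) 0.
Proof.
  apply (is_lim_seq_incr_1 (fun n => ln (INR n) / INR n)).
  apply (is_lim_comp_seq (fun y => ln y / y) INR p_infty 0).
  - apply is_lim_div_ln_p.
  - exists 0%nat. intros n _. easy.
  - apply is_lim_seq_INR.
Qed.

Lemma is_lim_seq_ln_const_over_S (c d : R) :
  is_lim_seq (fun n => c * (d + ln (INR (S n))) / INR (S n)) 0.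
Proof.
  apply is_lim_seq_ext with (fun n => c * (d * / INR (S n) + ln (INR (S n)) / INR (S n))).
  { intros n. field. apply not_0_INR. lia. }
  apply is_lim_seq_scal_0.
  replace (Finite 0) with (Finite (0 + 0)) by (f_equal; ring).
  apply is_lim_seq_plus'; [apply is_lim_seq_scal_0, is_lim_seq_inv_S|apply is_lim_seq_ln_over_S].
Qed.

(** Moving the base point from 1 to [m + 1] costs the sum of [f'], and at a distant base point every
    long partial sum is close to [f - f' / 2]. Convergence of the series at 1 is a result here and
    not an assumption. *)
Theorem is_lim_seq_hasse_psum (V : R) :
  is_lim_seq (fun m => xlnsq (INR (S m)) - xlnsq' (INR (S m)) / 2
                       - psum (fun j => xlnsq' (INR (S j))) m) V ->
  is_lim_seq (hasse_psum 1) V.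
Proof.
  intros HV. apply is_lim_seq_eps. intros e He.
  destruct (proj1 (is_lim_seq_eps _ _) HV (e / 3) ltac:(lra)) as [N1 H1].
  destruct (proj1 (is_lim_seq_eps _ _) (is_lim_seq_ln_const_over_S 21 2) (e / 3) ltac:(lra))
    as [N2 H2].
  (* The base point is fixed before the number of terms; this is legitimate since the asymptotic
     bound does not depend on the latter. *)
  set (m := S (max N1 N2)).
  specialize (H1 m ltac:(lia)). specialize (H2 m ltac:(lia)).
  assert (Hm : 2 <= INR (S m)).
  { unfold m. rewrite !S_INR. pose proof (pos_INR (Nat.max N1 N2)). lra. }
  assert (D : is_lim_seq (fun N => hasse_psum (INR (S m)) N - hasse_psum 1 N)
                (psum (fun j => xlnsq' (INR (S j))) m)).
  { clear. induction m as [|m IH].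
    - apply is_lim_seq_ext with (fun _ => 0); [intros; simpl; ring|apply is_lim_seq_const].
    - simpl psum. eapply is_lim_seq_ext.
      2:{ apply is_lim_seq_plus'; [exact IH|].
          apply (is_lim_seq_hasse_diff (INR (S m))). rewrite S_INR.
          destruct m as [|m]; [left; simpl; ring|right].
          rewrite S_INR. pose proof (pos_INR m). lra. }
      intros N. cbv beta. rewrite (S_INR (S m)). ring. }
  destruct (proj1 (is_lim_seq_eps _ _) D (e / 3) ltac:(lra)) as [N3 H3].
  exists (3 + N3)%nat. intros n Hn.
  specialize (H3 n ltac:(lia)).
  pose proof (hasse_psum_asymptotic (INR (S m)) (n - 3) Hm) as A.
  replace (3 + (n - 3))%nat with n in A by lia.
  rewrite Rminus_0_r in H2.
  apply Rabs_def2 in H1. apply Rabs_def2 in H2. apply Rabs_def2 in H3.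
  apply Rabs_le_between in A. apply Rabs_def1; lra.
Qed.

(** * Dominated series and Euler-Maclaurin constants *)


Lemma psum_diff_le (a M : nat -> R) (n m : nat) :
  (forall k, Rabs (a k) <= M k) -> (n <= m)%nat ->
  Rabs (psum a m - psum a n) <= psum M m - psum M n.
Proof.
  intros H Hnm. replace m with (n + (m - n))%nat by lia. rewrite !psum_add.
  replace (psum a n + psum (fun k => a (n + k)%nat) (m - n) - psum a n)
    with (psum (fun k => a (n + k)%nat) (m - n)) by ring.
  replace (psum M n + psum (fun k => M (n + k)%nat) (m - n) - psum M n)
    with (psum (fun k => M (n + k)%nat) (m - n)) by ring.
  eapply Rle_trans; [apply psum_Rabs|]. apply psum_le. intros. apply H.
Qed.

Lemma is_lim_seq_Rabs_le (u : nat -> R) (l B : R) (N : nat) :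
  is_lim_seq u l -> (forall n, (N <= n)%nat -> Rabs (u n) <= B) -> Rabs l <= B.
Proof.
  intros Hu H.
  apply (is_lim_seq_le_loc (fun n => Rabs (u n)) (fun _ => B) (Rabs l) B).
  - exists N. exact H.
  - now apply (is_lim_seq_abs u l).
  - apply is_lim_seq_const.
Qed.

Lemma series_tail_le (a M : nat -> R) (s m : R) (N : nat) :
  (forall k, Rabs (a k) <= M k) -> is_series a s -> is_series M m ->
  Rabs (s - psum a N) <= m - psum M N.
Proof.
  intros H Ha HM. apply is_series_psum in Ha. apply is_series_psum in HM.
  apply (is_lim_seq_le_loc (fun n => Rabs (psum a n - psum a N)) (fun n => psum M n - psum M N)
           (Rabs (s - psum a N)) (m - psum M N)).
  - exists N. intros n Hn. now apply psum_diff_le.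
  - apply (is_lim_seq_abs _ (s - psum a N)). apply is_lim_seq_minus'; [easy|apply is_lim_seq_const].
  - apply is_lim_seq_minus'; [easy|apply is_lim_seq_const].
Qed.

Lemma is_lim_seq_psum (a : nat -> nat -> R) (b : nat -> R) (N : nat) :
  (forall n, is_lim_seq (fun i => a i n) (b n)) ->
  is_lim_seq (fun i => psum (a i) N) (psum b N).
Proof.
  intros H. induction N as [|N IH]; [apply is_lim_seq_const|].
  simpl. apply is_lim_seq_plus'; auto.
Qed.

Lemma tannery (a : nat -> nat -> R) (b M : nat -> R) (s : nat -> R) :
  (forall i n, Rabs (a i n) <= M n) -> ex_series M ->
  (forall i, is_series (a i) (s i)) ->
  (forall n, is_lim_seq (fun i => a i n) (b n)) ->
  ex_series b /\ is_lim_seq s (Series b).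
Proof.
  intros H [m HM] Hs Hb.
  assert (HbM : forall n, Rabs (b n) <= M n).
  { intros n. apply (is_lim_seq_Rabs_le (fun i => a i n) _ _ 0); auto. }
  assert (Eb : ex_series b).
  { apply (ex_series_le b M); [exact HbM|now exists m]. }
  split; [easy|].
  apply is_lim_seq_eps. intros e He.
  destruct (proj1 (is_lim_seq_eps _ _) (proj1 (is_series_psum _ _) HM) (e / 3) ltac:(lra))
    as [N HN].
  specialize (HN N ltac:(lia)). apply Rabs_def2 in HN.
  destruct (proj1 (is_lim_seq_eps _ _) (is_lim_seq_psum a b N Hb) (e / 3) ltac:(lra)) as [I HI].
  exists I. intros i Hi. specialize (HI i Hi). apply Rabs_def2 in HI.
  pose proof (series_tail_le (a i) M (s i) m N (H i) (Hs i) HM) as T1.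
  pose proof (series_tail_le b M (Series b) m N HbM (Series_correct _ Eb) HM) as T2.
  apply Rabs_le_between in T1. apply Rabs_le_between in T2.
  apply Rabs_def1; lra.
Qed.

Lemma ex_series_nonneg_bounded (a : nat -> R) (B : R) :
  (forall n, 0 <= a n) -> (forall n, psum a n <= B) -> ex_series a.
Proof.
  intros H HB.
  destruct (ex_finite_lim_seq_incr (psum a) B) as [l Hl].
  - intros n. simpl. specialize (H n). lra.
  - exact HB.
  - exists l. now apply is_series_psum.
Qed.

(** [u - K v] increases, [u + K v] decreases and their gap tends to 0: adjacent sequences provide
    the limit and the rate together. *)
Lemma is_lim_seq_rate (u v : nat -> R) (K : R) :
  (forall n, Rabs (u (S n) - u n) <= K * (v n - v (S n))) -> is_lim_seq v 0 ->
  exists l : R, is_lim_seq u l /\ forall n, Rabs (u n - l) <= K * v n.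
Proof.
  intros H Hv.
  assert (Hs : forall n, - (K * (v n - v (S n))) <= u (S n) - u n <= K * (v n - v (S n)))
    by (intros n; now apply Rabs_le_between).
  set (w := fun n => u n - K * v n). set (z := fun n => u n + K * v n).
  assert (Hw : forall n, w n <= w (S n)) by (intros n; specialize (Hs n); unfold w; lra).
  assert (Hz : forall n, z (S n) <= z n) by (intros n; specialize (Hs n); unfold z; lra).
  assert (HK : is_lim_seq (fun n => K * v n) 0) by now apply is_lim_seq_scal_0.
  destruct (ex_lim_seq_adj w z Hw Hz) as [[l Hl] [[l' Hl'] E]].
  { apply is_lim_seq_ext with (fun n => 2 * (K * v n)); [intros; unfold w, z; ring|].
    now apply is_lim_seq_scal_0. }
  assert (l' = l).
  { apply is_lim_seq_unique in Hl. apply is_lim_seq_unique in Hl'.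
    rewrite Hl, Hl' in E. now injection E. }
  subst l'. exists l. split.
  - apply is_lim_seq_ext with (fun n => w n + K * v n); [intros; unfold w; ring|].
    replace (Finite l) with (Finite (l + 0)) by (f_equal; ring).
    now apply is_lim_seq_plus'.
  - intros n. pose proof (is_lim_seq_incr_compare w l Hl Hw n).
    pose proof (is_lim_seq_decr_compare z l Hl' Hz n). unfold w, z in *.
    apply Rabs_le. lra.
Qed.

(** The integral of [(1 + ln t) / t^2] from [x] to infinity is [(2 + ln x) / x]; the 3 leaves room
    for comparing with a discrete difference. *)
Definition lntail (x : R) : R := (3 + ln x) / x.

Lemma lntail_diff (x : R) : 1 <= x -> (1 + ln (x + 1)) / x ^ 2 <= 2 * (lntail x - lntail (x + 1)).
Proof.
  intros Hx. unfold lntail.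
  destruct (ln_succ_bounds x ltac:(lra)) as [_ B].
  pose proof (ln_nonneg x Hx) as L.
  assert (Hinv : / x <= 1) by (rewrite <- Rinv_1; apply Rinv_le_contravar; lra).
  apply Rmult_le_reg_r with (x ^ 2 * (x + 1)).
  { apply Rmult_lt_0_compat; [apply pow_lt; lra|lra]. }
  replace ((1 + ln (x + 1)) / x ^ 2 * (x ^ 2 * (x + 1))) with ((1 + ln (x + 1)) * (x + 1))
    by (field; lra).
  replace (2 * ((3 + ln x) / x - (3 + ln (x + 1)) / (x + 1)) * (x ^ 2 * (x + 1)))
    with (2 * x * (3 + ln x - x * (ln (x + 1) - ln x))) by (field; lra).
  assert (x * (ln (x + 1) - ln x) <= 1).
  { apply Rle_trans with (x * / x); [apply Rmult_le_compat_l; lra|right; field; lra]. }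
  apply Rle_trans with ((2 + ln x) * (2 * x)).
  - apply Rmult_le_compat; try lra. pose proof (ln_nonneg (x + 1) ltac:(lra)). lra.
  - rewrite Rmult_comm. apply Rmult_le_compat_l; lra.
Qed.

Lemma is_lim_seq_lntail : is_lim_seq (fun n => lntail (INR (S n))) 0.
Proof.
  unfold lntail.
  apply is_lim_seq_ext with (fun n => 3 * / INR (S n) + ln (INR (S n)) / INR (S n)).
  { intros n. field. apply not_0_INR. lia. }
  replace (Finite 0) with (Finite (0 + 0)) by (f_equal; ring).
  apply is_lim_seq_plus'; [apply is_lim_seq_scal_0, is_lim_seq_inv_S|].
  apply is_lim_seq_ln_over_S.
Qed.

Lemma ex_series_ln_over_sq : ex_series (fun n => (1 + ln (INR (S n) + 1)) / INR (S n) ^ 2).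
Proof.
  apply ex_series_nonneg_bounded with (2 * lntail 1).
  - intros n. pose proof (INR_S_ge_1 n). apply Rdiv_le_0_compat; [|apply pow_lt; lra].
    pose proof (ln_nonneg (INR (S n) + 1) ltac:(lra)). lra.
  - intros n. eapply Rle_trans.
    + apply psum_le. intros k _. apply lntail_diff, INR_S_ge_1.
    + rewrite psum_scal.
      rewrite (psum_ext _ (fun k => (-1) * (lntail (INR (S (S k))) - lntail (INR (S k))))).
      2:{ intros k _. rewrite (S_INR (S k)). ring. }
      rewrite psum_scal, (psum_telescope (fun k => lntail (INR (S k)))).
      change (INR 1) with 1.
      assert (0 <= lntail (INR (S n))).
      { unfold lntail. pose proof (INR_S_ge_1 n). pose proof (ln_nonneg _ H).
        apply Rdiv_le_0_compat; lra. }
      lra.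
Qed.

(** The error, as a function of the width [t] of the cell, has derivative
    [t / 2 * (f' (a + t) - f' c)] for some [c] in the cell. Only the oscillation [w] of [f'] enters,
    so the lemma serves both when [f''] is bounded and when [f'] is merely uniformly continuous. *)
Lemma trapezoid_cell (F f f' : R -> R) (a h w : R) :
  0 <= h ->
  (forall y, a <= y <= a + h -> is_derive F y (f y)) ->
  (forall y, a <= y <= a + h -> is_derive f y (f' y)) ->
  (forall y z, a <= y <= a + h -> a <= z <= a + h -> Rabs (f' y - f' z) <= w) ->
  Rabs (h / 2 * (f a + f (a + h)) - (F (a + h) - F a)) <= h ^ 2 / 2 * w.
Proof.
  intros Hh HF Hf Hw.
  assert (w0 : 0 <= w).
  { eapply Rle_trans; [apply Rabs_pos|apply (Hw a a); lra]. }
  set (e := fun t => t / 2 * (f a + f (a + t)) - (F (a + t) - F a)).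
  destruct (mean_value e (fun t => / 2 * (f a + f (a + t)) + t / 2 * f' (a + t) - f (a + t)) 0 h)
    as [t [Ht E]]; [easy| |].
  - intros t Ht. unfold e.
    pose proof (Hf (a + t) ltac:(lra)) as D1. pose proof (HF (a + t) ltac:(lra)) as D2.
    auto_derive.
    + repeat split; [exists (f' (a + t)); exact D1|exists (f (a + t)); exact D2].
    + apply is_derive_unique in D1. apply is_derive_unique in D2.
      change (Derive f (a + t)) with (Derive (fun x : R => f x) (a + t)) in D1.
      change (Derive F (a + t)) with (Derive (fun x : R => F x) (a + t)) in D2.
      rewrite D1, D2. field.
  - assert (e0 : e 0 = 0) by (unfold e; rewrite Rplus_0_r; field).
    rewrite e0 in E. change (h / 2 * (f a + f (a + h)) - (F (a + h) - F a)) with (e h).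
    replace (e h) with (e h - 0) by ring. rewrite E.
    destruct (mean_value f f' a (a + t)) as [c [Hc Ec]]; [lra| |].
    { intros y Hy. apply Hf. lra. }
    replace (/ 2 * (f a + f (a + t)) + t / 2 * f' (a + t) - f (a + t))
      with (t / 2 * (f' (a + t) - f' c)).
    2:{ replace (t / 2 * (f' (a + t) - f' c)) with (t / 2 * f' (a + t) - / 2 * (f' c * (a + t - a)))
          by field. rewrite <- Ec. field. }
    rewrite !Rabs_mult. rewrite (Rabs_right (t / 2)), (Rabs_right (h - 0)) by lra.
    specialize (Hw (a + t) c ltac:(lra) ltac:(lra)).
    pose proof (Rabs_pos (f' (a + t) - f' c)).
    replace (h ^ 2 / 2 * w) with (h / 2 * w * h) by field. rewrite Rminus_0_r.
    apply Rmult_le_compat_r; [easy|]. apply Rmult_le_compat; lra.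
Qed.

(** Each step of the sequence is a trapezoid error, at most [C / 2 * (1 + ln (x + 1)) / x^2], which
    [lntail_diff] turns into a difference of [C * lntail]. *)
Lemma euler_maclaurin_constant (F f f' f'' : R -> R) (C : R) :
  (forall y, 1 <= y -> is_derive F y (f y)) ->
  (forall y, 1 <= y -> is_derive f y (f' y)) ->
  (forall y, 1 <= y -> is_derive f' y (f'' y)) ->
  (forall y, 1 <= y -> Rabs (f'' y) <= C * (1 + ln y) / y ^ 2) ->
  exists l : R, forall n,
    Rabs (psum (fun k => f (INR (S k))) (S n) - F (INR (S n)) - f (INR (S n)) / 2 - l)
    <= C * lntail (INR (S n)).
Proof.
  intros HF Hf Hf' HC.
  assert (C0 : 0 <= C).
  { specialize (HC 1 ltac:(lra)). rewrite ln_1 in HC.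
    pose proof (Rabs_pos (f'' 1)). replace (C * (1 + 0) / 1 ^ 2) with C in HC by field. lra. }
  destruct (is_lim_seq_rate
    (fun n => psum (fun k => f (INR (S k))) (S n) - F (INR (S n)) - f (INR (S n)) / 2)
    (fun n => lntail (INR (S n))) C) as [l [_ Hl]].
  - intros n. pose proof (INR_S_ge_1 n) as Hx.
    pose proof (lntail_diff (INR (S n)) Hx) as LD.
    set (x := INR (S n)) in *.
    pose proof (ln_nonneg (x + 1) ltac:(lra)) as Lp.
    assert (T := trapezoid_cell F f f' x 1 (C * (1 + ln (x + 1)) / x ^ 2) ltac:(lra)
      ltac:(intros; apply HF; lra) ltac:(intros; apply Hf; lra)).
    change (psum (fun k => f (INR (S k))) (S (S n)))
      with (psum (fun k => f (INR (S k))) (S n) + f (INR (S (S n)))).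
    replace (INR (S (S n))) with (x + 1) by (unfold x; now rewrite (S_INR (S n))).
    match goal with |- Rabs ?A <= _ =>
      replace A with (1 / 2 * (f x + f (x + 1)) - (F (x + 1) - F x)) by field end.
    eapply Rle_trans; [apply T|].
    + assert (G : forall y z, x <= y <= z -> z <= x + 1 ->
                Rabs (f' z - f' y) <= C * (1 + ln (x + 1)) / x ^ 2).
      { intros y z Hy Hz.
        destruct (mean_value f' f'' y z) as [c [Hc E]]; [lra| |].
        { intros; apply Hf'; lra. }
        rewrite E, Rabs_mult, (Rabs_right (z - y)) by lra.
        specialize (HC c ltac:(lra)).
        assert (ln c <= ln (x + 1)) by (apply ln_le; lra).
        assert (I : 0 < / c ^ 2 <= / x ^ 2).
        { split; [apply Rinv_0_lt_compat, pow_lt; lra|].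
          apply Rinv_le_contravar; [apply pow_lt; lra|apply pow_incr; lra]. }
        pose proof (ln_nonneg c ltac:(lra)).
        assert (C * (1 + ln c) / c ^ 2 <= C * (1 + ln (x + 1)) / x ^ 2).
        { unfold Rdiv. apply Rmult_le_compat; try lra.
          - apply Rmult_le_pos; lra.
          - apply Rmult_le_compat_l; lra. }
        pose proof (Rabs_pos (f'' c)). nra. }
      intros y z Hy Hz. destruct (Rle_dec y z).
      * rewrite Rabs_minus_sym. apply G; lra.
      * apply G; lra.
    + replace (1 ^ 2 / 2 * (C * (1 + ln (x + 1)) / x ^ 2))
        with (C / 2 * ((1 + ln (x + 1)) / x ^ 2)) by (field; lra).
      replace (C * (lntail x - lntail (x + 1)))
        with (C / 2 * (2 * (lntail x - lntail (x + 1)))) by field.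
      apply Rmult_le_compat_l; lra.
  - exact is_lim_seq_lntail.
  - exists l. exact Hl.
Qed.

(** * The first Stieltjes constant *)


Lemma is_series_C_Re (a : nat -> C) (l : C) :
  @is_series C_AbsRing C_NormedModule a l -> is_series (fun n => Re (a n)) (Re l).
Proof.
  intros H. apply is_series_psum, is_lim_seq_incr_1.
  apply is_lim_seq_ext with (fun n => Re (@sum_n C_AbelianMonoid a n)).
  - intros n. induction n as [|n IH].
    + rewrite sum_O. simpl. ring.
    + rewrite sum_Sn. change (Re (plus (sum_n a n) (a (S n))))
        with (Re (sum_n a n) + Re (a (S n))). rewrite IH. reflexivity.
  - apply (filterlim_comp nat C R (@sum_n C_AbelianMonoid a) Re _ (locally l)).
    + exact H.
    + destruct l as [x y]. apply (continuous_fst x y).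
Qed.

Lemma zeta_term_real (e : R) (n : nat) :
  Re (zeta_term (RtoC (1 + e)) n) = exp (- e * ln (INR (S n))) / INR (S n).
Proof.
  unfold zeta_term, Cexp.
  match goal with |- Re (exp ?a * cos ?b, _) = _ =>
    replace a with (- e * ln (INR (S n)) + - ln (INR (S n)));
    [replace b with 0|] end.
  - cbn [Re fst]. rewrite cos_0, exp_plus, exp_Ropp, exp_ln by apply INR_S_pos.
    unfold Rdiv. ring.
  - unfold Im, RtoC, Copp, Cmult. cbn [fst snd]. ring.
  - unfold Re, RtoC, Copp, Cmult. cbn [fst snd]. ring.
Qed.

Lemma pow_n_RtoC (x : R) (n : nat) : @pow_n C_Ring (RtoC x) n = RtoC (x ^ n).
Proof.
  induction n as [|n IH]; [reflexivity|].
  simpl pow_n. rewrite IH. change (Cmult (RtoC x) (RtoC (x ^ n)) = RtoC (x ^ S n)).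
  rewrite <- RtoC_mult. reflexivity.
Qed.

Lemma stieltjes_real_pseries (Z : C -> C) (g : nat -> R) :
  is_stieltjes Z g ->
  exists r, 0 < r /\ forall e, 0 < e < r ->
    is_series (fun p => (-1) ^ p / INR (fact p) * g p * e ^ p) (Re (Z (RtoC (1 + e))) - / e).
Proof.
  intros [r [Hr H]]. exists r. split; [easy|]. intros e He.
  assert (E : (RtoC (1 + e) - RtoC 1)%C = RtoC e).
  { rewrite <- RtoC_minus. f_equal. ring. }
  specialize (H (RtoC (1 + e))). rewrite E in H.
  assert (P : is_pseries (fun p => RtoC ((-1) ^ p / INR (fact p) * g p)) (RtoC e)
                (Z (RtoC (1 + e)) - / RtoC e)%C).
  { apply H.
    - intros A. apply RtoC_inj in A. lra.
    - rewrite Cmod_R, Rabs_right by lra. easy. }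
  apply is_series_C_Re in P.
  replace (Re (Z (RtoC (1 + e))) - / e) with (Re (Z (RtoC (1 + e)) - / RtoC e)%C).
  - eapply is_series_ext; [|exact P].
    intros n. cbv beta. rewrite pow_n_RtoC.
    change (Re (RtoC (e ^ n) * RtoC ((-1) ^ n / INR (fact n) * g n))%C
            = (-1) ^ n / INR (fact n) * g n * e ^ n).
    rewrite <- RtoC_mult. simpl. ring.
  - rewrite <- RtoC_inv by lra. reflexivity.
Qed.

(** With [k = n + 1], this is [k^(-1-e)] minus the integral of [t^(-1-e)] over [[k, k + 1]]; the
    integrals add up to [1 / e], the polar part of zeta. [zeta_diff_0] is the same quantity at
    [e = 0]. *)
Definition zeta_diff (e : R) (n : nat) : R :=
  exp (- e * ln (INR (S n))) / INR (S n)
  + (exp (- e * ln (INR (S n) + 1)) - exp (- e * ln (INR (S n)))) / e.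

Definition zeta_diff_0 (n : nat) : R :=
  / INR (S n) - (ln (INR (S n) + 1) - ln (INR (S n))).

Lemma is_lim_seq_ln_INR_S : is_lim_seq (fun n => ln (INR (S n))) p_infty.
Proof.
  apply (is_lim_seq_incr_1 (fun n => ln (INR n))).
  apply (is_lim_comp_seq ln INR p_infty p_infty).
  - apply is_lim_ln_p.
  - now exists 0%nat.
  - apply is_lim_seq_INR.
Qed.

Lemma is_series_zeta_diff (Z : C -> C) (e : R) :
  is_riemann_zeta Z -> 0 < e -> is_series (zeta_diff e) (Re (Z (RtoC (1 + e))) - / e).
Proof.
  intros [H _] He.
  specialize (H (RtoC (1 + e)) ltac:(simpl; lra)).
  apply is_series_C_Re, is_series_psum in H.
  apply is_series_psum.
  apply is_lim_seq_ext with (fun N => psum (fun n => Re (zeta_term (RtoC (1 + e)) n)) N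
    + (/ e * exp (- e * ln (INR (S N))) - / e)).
  - intros N. unfold zeta_diff. rewrite psum_plus. f_equal.
    + apply psum_ext. intros k _. apply zeta_term_real.
    + rewrite (psum_ext _ (fun k => / e * (exp (- e * ln (INR (S (S k)))) -
                                           exp (- e * ln (INR (S k)))))).
      2:{ intros k _. rewrite (S_INR (S k)). unfold Rdiv. ring. }
      rewrite psum_scal, (psum_telescope (fun k => exp (- e * ln (INR (S k))))).
      change (INR 1) with 1. rewrite ln_1, Rmult_0_r, exp_0. ring.
  - apply is_lim_seq_plus'; [exact H|].
    replace (Finite (- / e)) with (Finite (/ e * 0 - / e)) by (f_equal; ring).
    apply is_lim_seq_minus'; [|apply is_lim_seq_const].
    apply (is_lim_seq_scal_l _ (/ e) 0).
    apply (is_lim_comp_seq exp (fun N => - e * ln (INR (S N))) m_infty 0).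
    + apply is_lim_exp_m.
    + now exists 0%nat.
    + replace m_infty with (Rbar_mult (- e) p_infty).
      * apply is_lim_seq_scal_l, is_lim_seq_ln_INR_S.
      * simpl. destruct (Rle_dec 0 (- e)); [|easy]. exfalso. lra.
Qed.

(** For [k y = (y^(-e) - 1) / y] the numerator is [k x] minus the integral of [k] over [[x, x + 1]],
    that is [k x - k c]. A second mean value leaves [1 - (1 + e) y^(-e)] over [y^2], which is [O(e)]
    up to a logarithm; dividing by [e] gives a majorant independent of [e]. *)
Lemma zeta_diff_quotient_bound (e : R) (n : nat) :
  0 < e ->
  Rabs ((zeta_diff e n - zeta_diff_0 n) / e) <= (1 + ln (INR (S n) + 1)) / INR (S n) ^ 2.
Proof.
  intros He. unfold zeta_diff, zeta_diff_0.
  pose proof (INR_S_ge_1 n) as Hx. set (x := INR (S n)) in *. clearbody x.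
  set (k := fun y => (exp (- e * ln y) - 1) / y).
  set (K := fun y => (exp (- e * ln y) - 1) / e + ln y).
  destruct (mean_value K (fun y => - k y) x (x + 1)) as [c [Hc Ec]]; [lra| |].
  { intros y Hy. unfold K, k. auto_derive; [lra|field; lra]. }
  destruct (mean_value k (fun y => (1 - (1 + e) * exp (- e * ln y)) / y ^ 2) x c)
    as [d [Hd Ed]]; [lra| |].
  { intros y Hy. unfold k. auto_derive; [lra|field; lra]. }
  replace (exp (- e * ln x) / x + (exp (- e * ln (x + 1)) - exp (- e * ln x)) / e
            - (/ x - (ln (x + 1) - ln x)))
    with (k x + (K (x + 1) - K x)) by (unfold k, K; field; lra).
  rewrite Ec. replace (k x + - k c * (x + 1 - x)) with (- (k c - k x)) by ring.
  rewrite Ed.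
  pose proof (ln_nonneg d ltac:(lra)) as L0.
  assert (L1 : ln d <= ln (x + 1)) by (apply ln_le; lra).
  pose proof (exp_ineq1_le (- e * ln d)) as X1.
  assert (X2 : exp (- e * ln d) <= 1).
  { rewrite <- exp_0.
    destruct (Req_dec (ln d) 0) as [E0|E0].
    - rewrite E0, Rmult_0_r. lra.
    - left. apply exp_increasing. nra. }
  pose proof (exp_pos (- e * ln d)) as X3.
  set (E := exp (- e * ln d)) in *. clearbody E.
  unfold Rdiv. rewrite Rabs_mult, Rabs_Ropp, !Rabs_mult.
  rewrite (Rabs_right (/ e)), (Rabs_right (c - x)), (Rabs_right (/ d ^ 2)).
  2:{ apply Rle_ge. left. apply Rinv_0_lt_compat, pow_lt. lra. }
  2: lra.
  2:{ apply Rle_ge. left. apply Rinv_0_lt_compat. lra. }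
  assert (B : Rabs (1 - (1 + e) * E) <= e * (1 + ln (x + 1))).
  { apply Rabs_le. nra. }
  assert (I : 0 < / d ^ 2 <= / x ^ 2).
  { split; [apply Rinv_0_lt_compat, pow_lt; lra|].
    apply Rinv_le_contravar; [apply pow_lt; lra|apply pow_incr; lra]. }
  pose proof (Rabs_pos (1 - (1 + e) * E)) as B0.
  apply Rle_trans with (e * (1 + ln (x + 1)) * / x ^ 2 * 1 * / e).
  - apply Rmult_le_compat_r; [left; apply Rinv_0_lt_compat; lra|].
    apply Rmult_le_compat; try lra.
    + apply Rmult_le_pos; lra.
    + apply Rmult_le_compat; lra.
  - right. field. lra.
Qed.

Lemma exp_taylor_2 (u : R) : Rabs u <= 1 -> Rabs (exp u - 1 - u - u ^ 2 / 2) <= 3 * Rabs u ^ 3.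
Proof.
  intros Hu.
  assert (H1 : forall v, Rabs v <= 1 -> Rabs (exp v - 1) <= 3 * Rabs v).
  { intros v Hv.
    destruct (MVT_cor4 exp exp 0 (Rabs v)) with (b := v) as [c [Ec Hc]].
    - intros c _. auto_derive; [easy|ring].
    - rewrite Rminus_0_r. lra.
    - rewrite exp_0, !Rminus_0_r in *. rewrite Ec, Rabs_mult.
      apply Rmult_le_compat_r; [apply Rabs_pos|].
      rewrite (Rabs_right (exp c)) by (left; apply exp_pos).
      apply Rle_trans with (exp 1); [|apply exp_le_3].
      assert (c <= 1) by (apply Rabs_le_between in Hc; lra).
      destruct (Req_dec c 1) as [->|]; [lra|]. left. apply exp_increasing. lra. }
  assert (H2 : forall v, Rabs v <= 1 -> Rabs (exp v - 1 - v) <= 3 * Rabs v ^ 2).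
  { intros v Hv.
    destruct (MVT_cor4 (fun v => exp v - 1 - v) (fun v => exp v - 1) 0 (Rabs v)) with (b := v)
      as [c [Ec Hc]].
    - intros c _. auto_derive; [easy|ring].
    - rewrite Rminus_0_r. lra.
    - rewrite exp_0, !Rminus_0_r in *.
      replace (exp v - 1 - v) with (exp v - 1 - v - (1 - 1)) by ring.
      rewrite Ec, Rabs_mult.
      specialize (H1 c ltac:(lra)). pose proof (Rabs_pos v).
      pose proof (Rabs_pos (exp c - 1)). simpl. rewrite Rmult_1_r.
      rewrite <- Rmult_assoc. apply Rmult_le_compat_r; lra. }
  destruct (MVT_cor4 (fun v => exp v - 1 - v - v ^ 2 / 2) (fun v => exp v - 1 - v) 0 (Rabs u))
    with (b := u) as [c [Ec Hc]].
  - intros c _. auto_derive; [easy|field].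
  - rewrite Rminus_0_r. lra.
  - rewrite exp_0, !Rminus_0_r in *.
    replace (exp u - 1 - u - u ^ 2 / 2)
      with (exp u - 1 - u - u ^ 2 / 2 - (1 - 1 - 0 ^ 2 / 2)) by field.
    rewrite Ec, Rabs_mult.
    specialize (H2 c ltac:(lra)). pose proof (Rabs_pos u).
    pose proof (Rabs_pos (exp c - 1 - c)).
    replace (3 * Rabs u ^ 3) with (3 * Rabs u ^ 2 * Rabs u) by ring.
    apply Rmult_le_compat_r; [lra|]. eapply Rle_trans; [exact H2|].
    apply Rmult_le_compat_l; [lra|]. apply pow_incr. split; [apply Rabs_pos|lra].
Qed.

Lemma is_lim_seq_exp_quotient_2 (e : nat -> R) (l : R) :
  (forall i, 0 < e i) -> is_lim_seq e 0 ->
  is_lim_seq (fun i => (exp (- e i * l) - 1 + e i * l) / e i ^ 2) (l ^ 2 / 2).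
Proof.
  intros He H0. apply is_lim_seq_dist.
  assert (HL : is_lim_seq (fun i => e i * (Rabs l + 1)) 0).
  { apply is_lim_seq_ext with (fun i => (Rabs l + 1) * e i); [intros; ring|].
    now apply is_lim_seq_scal_0. }
  destruct (proj1 (is_lim_seq_eps _ _) HL 1 ltac:(lra)) as [N HN].
  apply is_lim_seq_0_le with (v := fun i => (3 * Rabs l ^ 3) * e i) (N := N).
  2:{ now apply is_lim_seq_scal_0. }
  intros i Hi. specialize (HN i Hi). specialize (He i). rewrite Rminus_0_r in HN.
  pose proof (Rabs_pos l) as Hl.
  assert (U : Rabs (- e i * l) = e i * Rabs l).
  { rewrite Rabs_mult, Rabs_Ropp, Rabs_right by lra. easy. }
  assert (T := exp_taylor_2 (- e i * l)). rewrite U in T.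
  apply Rabs_def2 in HN.
  specialize (T ltac:(nra)).
  replace ((exp (- e i * l) - 1 + e i * l) / e i ^ 2 - l ^ 2 / 2)
    with ((exp (- e i * l) - 1 - (- e i * l) - (- e i * l) ^ 2 / 2) * / e i ^ 2)
    by (field; lra).
  assert (HP : 0 < e i ^ 2) by (apply pow_lt; lra).
  rewrite Rabs_mult, (Rabs_right (/ e i ^ 2)) by (left; now apply Rinv_0_lt_compat).
  apply Rmult_le_reg_r with (e i ^ 2); [easy|].
  rewrite Rmult_assoc, Rinv_l, Rmult_1_r by lra.
  eapply Rle_trans; [exact T|]. right. ring.
Qed.

Lemma is_lim_seq_exp_quotient_1 (e : nat -> R) (l : R) :
  (forall i, 0 < e i) -> is_lim_seq e 0 ->
  is_lim_seq (fun i => (exp (- e i * l) - 1) / e i) (- l).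
Proof.
  intros He H0.
  apply is_lim_seq_ext with (fun i => e i * ((exp (- e i * l) - 1 + e i * l) / e i ^ 2) + - l).
  { intros i. specialize (He i). field. lra. }
  replace (Finite (- l)) with (Finite (0 * (l ^ 2 / 2) + - l)) by (f_equal; ring).
  apply is_lim_seq_plus'; [|apply is_lim_seq_const].
  apply is_lim_seq_mult'; [easy|]. now apply is_lim_seq_exp_quotient_2.
Qed.

(** The derivative of [zeta_diff] in [e] at 0: minus [ln k / k], plus the integral of [ln t / t]
    over [[k, k + 1]], for [k = n + 1]. *)
Definition stieltjes_term (n : nat) : R :=
  - ln (INR (S n)) / INR (S n) + (ln (INR (S n) + 1) ^ 2 / 2 - ln (INR (S n)) ^ 2 / 2).

Lemma is_lim_seq_zeta_diff_quotient (e : nat -> R) (n : nat) :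
  (forall i, 0 < e i) -> is_lim_seq e 0 ->
  is_lim_seq (fun i => (zeta_diff (e i) n - zeta_diff_0 n) / e i) (stieltjes_term n).
Proof.
  intros He H0. unfold zeta_diff, zeta_diff_0, stieltjes_term.
  pose proof (INR_S_pos n) as Hx. set (x := INR (S n)) in *. clearbody x.
  apply is_lim_seq_ext with (fun i =>
    / x * ((exp (- e i * ln x) - 1) / e i)
    + ((exp (- e i * ln (x + 1)) - 1 + e i * ln (x + 1)) / e i ^ 2
       - (exp (- e i * ln x) - 1 + e i * ln x) / e i ^ 2)).
  { intros i. specialize (He i). field. lra. }
  replace (- ln x / x) with (/ x * (- ln x)) by (field; lra).
  apply is_lim_seq_plus'.
  - apply (is_lim_seq_scal_l _ (/ x) (- ln x)). now apply is_lim_seq_exp_quotient_1.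
  - apply is_lim_seq_minus'; now apply is_lim_seq_exp_quotient_2.
Qed.

(** The difference quotient of zeta minus its pole is computed twice along a sequence [e i -> 0]:
    from the Laurent series it tends to the coefficient [a 1 = - g 1], and termwise, by dominated
    convergence, to the sum of [stieltjes_term]. *)
Theorem stieltjes_1_series (Z : C -> C) (g : nat -> R) (G : R) :
  is_riemann_zeta Z -> is_stieltjes Z g -> is_series zeta_diff_0 G ->
  is_series stieltjes_term (- g 1%nat).
Proof.
  intros HZ Hg HG.
  destruct (stieltjes_real_pseries Z g Hg) as [r [Hr HP]].
  set (a := fun p => (-1) ^ p / INR (fact p) * g p) in *.
  set (e := fun i => r / 2 * / INR (S i)).
  assert (He : forall i, 0 < e i < r).
  { intros i. unfold e. pose proof (INR_S_ge_1 i).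
    assert (0 < / INR (S i)) by (apply Rinv_0_lt_compat; lra).
    assert (/ INR (S i) <= 1) by (rewrite <- Rinv_1; apply Rinv_le_contravar; lra).
    split; [apply Rmult_lt_0_compat; lra|]. nra. }
  assert (He0 : is_lim_seq e 0) by (apply is_lim_seq_scal_0, is_lim_seq_inv_S).
  set (s := fun i => Re (Z (RtoC (1 + e i))) - / e i).
  destruct (tannery (fun i n => (zeta_diff (e i) n - zeta_diff_0 n) / e i) stieltjes_term
    (fun n => (1 + ln (INR (S n) + 1)) / INR (S n) ^ 2) (fun i => (s i - G) / e i))
    as [Hex Hlim].
  - intros i n. apply zeta_diff_quotient_bound, He.
  - apply ex_series_ln_over_sq.
  - intros i. 
    apply (is_series_ext (fun n => scal (/ e i) (minus (zeta_diff (e i) n) (zeta_diff_0 n)))).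
    { intros n. unfold scal, minus, plus, opp, Rdiv. simpl. unfold mult. simpl. ring. }
    replace ((s i - G) / e i) with (scal (/ e i) (minus (s i) G)).
    2:{ unfold scal, minus, plus, opp, Rdiv. simpl. unfold mult. simpl. ring. }
    apply (is_series_scal (/ e i) (fun n => minus (zeta_diff (e i) n) (zeta_diff_0 n))).
    apply (is_series_minus (zeta_diff (e i)) zeta_diff_0); [|exact HG].
    apply is_series_zeta_diff; [easy|apply He].
  - intros n. apply is_lim_seq_zeta_diff_quotient; [apply He|easy].
  - assert (Hs : forall i, s i = PSeries a (e i)).
    { intros i. symmetry. apply is_series_unique. apply HP, He. }
    (* Convergence at the single positive point [e 0] already gives a positive radius. *)
    assert (CV : Rbar_lt 0 (CV_radius a)).
    { apply Rbar_lt_le_trans with (e 0%nat); [apply He|].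
      apply Rbar_not_lt_le. intros C.
      apply (CV_disk_outside a (e 0%nat)).
      - rewrite Rabs_right; [exact C|]. apply Rle_ge. left. apply He.
      - apply (ex_series_lim_0 (fun n => a n * e 0%nat ^ n)). eexists. apply HP, He. }
    assert (D : is_derive (PSeries a) 0 (a 1%nat)).
    { replace (a 1%nat) with (PSeries (PS_derive a) 0).
      - apply is_derive_PSeries. now rewrite Rabs_R0.
      - rewrite PSeries_0. unfold PS_derive. simpl INR. ring. }
    assert (Hq : is_lim_seq (fun i => (s i - a 0%nat) / e i) (a 1%nat)).
    { apply is_lim_seq_eps. intros d Hd.
      apply is_derive_Reals in D. destruct (D d Hd) as [delta Hdelta].
      destruct (proj1 (is_lim_seq_eps _ _) He0 delta (cond_pos delta)) as [N HN].
      exists N. intros i Hi. specialize (HN i Hi). rewrite Rminus_0_r in HN.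
      specialize (Hdelta (e i)). rewrite Rplus_0_l, PSeries_0 in Hdelta. rewrite Hs.
      apply Hdelta; [|easy]. specialize (He i). lra. }
    assert (L1 : is_lim_seq s (a 0%nat)).
    { apply is_lim_seq_ext with (fun i => e i * ((s i - a 0%nat) / e i) + a 0%nat).
      { intros i. specialize (He i). field. lra. }
      replace (Finite (a 0%nat)) with (Finite (0 * a 1%nat + a 0%nat)) by (f_equal; ring).
      apply is_lim_seq_plus'; [now apply is_lim_seq_mult'|apply is_lim_seq_const]. }
    assert (L2 : is_lim_seq s G).
    { apply is_lim_seq_ext with (fun i => e i * ((s i - G) / e i) + G).
      { intros i. specialize (He i). field. lra. }
      replace (Finite G) with (Finite (0 * Series stieltjes_term + G)) by (f_equal; ring).
      apply is_lim_seq_plus'; [now apply is_lim_seq_mult'|apply is_lim_seq_const]. }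
    (* Both are limits of [s]. This gives the two difference quotients the same base value and
       proves that the constant coefficient [g 0] equals [G]. *)
    assert (EG : a 0%nat = G).
    { apply is_lim_seq_unique in L1. apply is_lim_seq_unique in L2.
      rewrite L1 in L2. now injection L2. }
    rewrite EG in Hq.
    assert (ES : a 1%nat = Series stieltjes_term).
    { apply is_lim_seq_unique in Hq. apply is_lim_seq_unique in Hlim.
      rewrite Hq in Hlim. now injection Hlim. }
    replace (- g 1%nat) with (Series stieltjes_term).
    + now apply Series_correct.
    + rewrite <- ES. unfold a. simpl. field.
Qed.

(** * Power series of the logarithm on a circle *)


Lemma derive_dominated (f g f' g' : R -> R) (a b : R) :
  a <= b ->
  (forall x, a <= x <= b -> is_derive f x (f' x)) ->
  (forall x, a <= x <= b -> is_derive g x (g' x)) ->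
  (forall x, a <= x <= b -> Rabs (f' x) <= g' x) ->
  Rabs (f b - f a) <= g b - g a.
Proof.
  intros Hab Hf Hg H.
  destruct (mean_value (fun x => g x - f x) (fun x => g' x - f' x) a b Hab) as [c [Hc Ec]].
  { intros x Hx. apply (is_derive_minus g f); auto. }
  destruct (mean_value (fun x => g x + f x) (fun x => g' x + f' x) a b Hab) as [d [Hd Ed]].
  { intros x Hx. apply (is_derive_plus g f); auto. }
  pose proof (H c Hc) as B1. pose proof (H d Hd) as B2.
  apply Rabs_le_between in B1. apply Rabs_le_between in B2.
  apply Rabs_le. nra.
Qed.

(** The squared modulus of [1 - t e^(i a)]. *)
Definition quad (a t : R) : R := 1 - 2 * t * cos a + t ^ 2.

Lemma psum_cos_geometric (a t : R) (n : nat) :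
  quad a t * psum (fun m => t ^ m * cos (INR (S m) * a)) n
  = cos a - t - t ^ n * cos (INR (S n) * a) + t ^ S n * cos (INR n * a).
Proof.
  induction n as [|n IH].
  - replace (INR 1 * a) with a by (simpl; ring). replace (INR 0 * a) with 0 by (simpl; ring).
    rewrite cos_0. simpl. ring.
  - cbn [psum]. rewrite Rmult_plus_distr_l, IH. unfold quad.
    rewrite (S_INR (S n)).
    replace (INR n * a) with (INR (S n) * a - a) by (rewrite S_INR; ring).
    replace ((INR (S n) + 1) * a) with (INR (S n) * a + a) by ring.
    rewrite cos_plus, cos_minus. simpl. ring.
Qed.

Lemma psum_sin_geometric (a t : R) (n : nat) :
  quad a t * psum (fun m => t ^ m * sin (INR (S m) * a)) n
  = sin a - t ^ n * sin (INR (S n) * a) + t ^ S n * sin (INR n * a).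
Proof.
  induction n as [|n IH].
  - replace (INR 1 * a) with a by (simpl; ring). replace (INR 0 * a) with 0 by (simpl; ring).
    rewrite sin_0. simpl. ring.
  - cbn [psum]. rewrite Rmult_plus_distr_l, IH. unfold quad.
    rewrite (S_INR (S n)).
    replace (INR n * a) with (INR (S n) * a - a) by (rewrite S_INR; ring).
    replace ((INR (S n) + 1) * a) with (INR (S n) * a + a) by ring.
    rewrite sin_plus, sin_minus. simpl. ring.
Qed.

Lemma is_derive_psum_pow (c : nat -> R) (n : nat) (t : R) :
  is_derive (fun t => psum (fun m => t ^ S m * c m / INR (S m)) n) t
    (psum (fun m => t ^ m * c m) n).
Proof.
  induction n as [|n IH]; [apply (is_derive_const 0)|].
  cbn [psum].
  apply (is_derive_plus (fun t => psum (fun m => t ^ S m * c m / INR (S m)) n)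
    (fun t => t ^ S n * c n / INR (S n))); [exact IH|].
  pose proof (INR_S_pos n). auto_derive; [easy|].
  replace (match n with O => 1 | S _ => INR n + 1 end) with (INR (S n)) by reflexivity.
  field. lra.
Qed.

Lemma geometric_remainder_bound (t x y : R) (n : nat) :
  0 <= t <= 1 -> -1 <= x <= 1 -> -1 <= y <= 1 ->
  Rabs (- (t ^ n * x) + t ^ S n * y) <= 2 * t ^ n.
Proof.
  intros Ht Hx Hy. assert (0 <= t ^ n) by (apply pow_le; lra).
  assert (0 <= t * t ^ n <= t ^ n) by nra.
  simpl. apply Rabs_le. nra.
Qed.

(** [log_quad] and [- atan_quad] are the real and imaginary parts of [ln (1 - t e^(i a))]; treating
    them separately keeps the argument real. *)
Definition log_quad (a t : R) : R := / 2 * ln (quad a t).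
Definition atan_quad (a t : R) : R := atan (t * sin a / (1 - t * cos a)).

Lemma one_minus_cos_pos (a t : R) : 0 <= t <= 1 -> 0 < quad a t -> 0 < 1 - t * cos a.
Proof.
  unfold quad. intros Ht Hq. destruct (Rlt_or_le 0 (1 - t * cos a)) as [|C]; [easy|].
  exfalso. nra.
Qed.

Lemma is_derive_log_quad (a t : R) :
  0 < quad a t -> is_derive (log_quad a) t ((t - cos a) / quad a t).
Proof.
  intros Hq. unfold log_quad, quad in *. auto_derive; [lra|field; lra].
Qed.

Lemma is_derive_atan_quad (a t : R) :
  0 < 1 - t * cos a -> is_derive (atan_quad a) t (sin a / quad a t).
Proof.
  intros Hq. unfold atan_quad, quad. 
  assert (S2 : sin a ^ 2 = 1 - cos a ^ 2).
  { pose proof (sin2_cos2 a) as E. unfold Rsqr in E. simpl. lra. }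
  auto_derive; [lra|].
  set (s := sin a) in *. set (c := cos a) in *. clearbody s c.
  assert (0 < (1 - t * c) ^ 2) by (apply pow_lt; lra).
  assert (E : 1 - 2 * t * c + t ^ 2 = (1 - t * c) ^ 2 + t ^ 2 * s ^ 2) by (rewrite S2; ring).
  assert (0 <= t ^ 2 * s ^ 2).
  { apply Rmult_le_pos; apply pow2_ge_0. }
  rewrite E. field. split; [pose proof (pow2_ge_0 (t * s)); lra|lra].
Qed.

Lemma pow_integral_derive (K : R) (n : nat) (t : R) :
  is_derive (fun t => K * t ^ S n / INR (S n)) t (K * t ^ n).
Proof.
  pose proof (INR_S_pos n). auto_derive; [easy|].
  replace (match n with O => 1 | S _ => INR n + 1 end) with (INR (S n)) by reflexivity.
  field. lra.
Qed.

(** Both sides vanish at radius 0, and their derivatives in the radius are compared: the remainder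
    of the geometric sum is at most [2 t^n / d]. *)
Lemma log_quad_error (a r d : R) (n : nat) :
  0 <= r <= 1 -> 0 < d -> (forall t, 0 <= t <= r -> d <= quad a t) ->
  Rabs (psum (fun m => r ^ S m * cos (INR (S m) * a) / INR (S m)) n + log_quad a r)
  <= 2 / d * r ^ S n / INR (S n).
Proof.
  intros Hr Hd Hq.
  set (f := fun t => psum (fun m => t ^ S m * cos (INR (S m) * a) / INR (S m)) n + log_quad a t).
  assert (f0 : f 0 = 0).
  { unfold f. rewrite (psum_ext _ (fun _ => 0)).
    - rewrite psum_const. unfold log_quad, quad.
      replace (1 - 2 * 0 * cos a + 0 ^ 2) with 1 by ring. rewrite ln_1. ring.
    - intros k _. simpl. unfold Rdiv. ring. }
  change (Rabs (f r) <= 2 / d * r ^ S n / INR (S n)).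
  replace (f r) with (f r - f 0) by (rewrite f0; ring).
  replace (2 / d * r ^ S n / INR (S n))
    with (2 / d * r ^ S n / INR (S n) - 2 / d * 0 ^ S n / INR (S n))
    by (simpl; unfold Rdiv; ring).
  apply (derive_dominated f (fun t => 2 / d * t ^ S n / INR (S n))
    (fun t => psum (fun m => t ^ m * cos (INR (S m) * a)) n + (t - cos a) / quad a t)
    (fun t => 2 / d * t ^ n)); [lra| | |].
  - intros t Ht. specialize (Hq t Ht).
    apply (is_derive_plus (fun t => psum (fun m => t ^ S m * cos (INR (S m) * a) / INR (S m)) n)
      (log_quad a)); [apply is_derive_psum_pow|apply is_derive_log_quad; lra].
  - intros t _. apply pow_integral_derive.
  - intros t Ht. specialize (Hq t Ht).
    pose proof (psum_cos_geometric a t n) as G.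
    assert (Q : 0 < quad a t) by lra.
    replace (psum (fun m => t ^ m * cos (INR (S m) * a)) n + (t - cos a) / quad a t)
      with ((- (t ^ n * cos (INR (S n) * a)) + t ^ S n * cos (INR n * a)) * / quad a t).
    2:{ apply Rmult_eq_reg_l with (quad a t); [|lra]. rewrite Rmult_plus_distr_l, G. field. lra. }
    rewrite Rabs_mult, (Rabs_right (/ _)) by (left; now apply Rinv_0_lt_compat).
    replace (2 / d * t ^ n) with (2 * t ^ n * / d) by (field; lra).
    apply Rmult_le_compat; [apply Rabs_pos|left; now apply Rinv_0_lt_compat| |].
    + apply geometric_remainder_bound; [lra|apply COS_bound|apply COS_bound].
    + apply Rinv_le_contravar; lra.
Qed.

(** The value [r = 1] is allowed on purpose: for angles in [[PI/2, PI]] one may take [d = 1], and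
    the rate at the boundary is then uniform in the angle, on which the evaluation of the Basel sum
    relies. *)
Lemma atan_quad_error (a r d : R) (n : nat) :
  0 <= r <= 1 -> 0 < d -> (forall t, 0 <= t <= r -> d <= quad a t) ->
  Rabs (psum (fun m => r ^ S m * sin (INR (S m) * a) / INR (S m)) n - atan_quad a r)
  <= 2 / d * r ^ S n / INR (S n).
Proof.
  intros Hr Hd Hq.
  set (f := fun t => psum (fun m => t ^ S m * sin (INR (S m) * a) / INR (S m)) n - atan_quad a t).
  assert (f0 : f 0 = 0).
  { unfold f. rewrite (psum_ext _ (fun _ => 0)).
    - rewrite psum_const. unfold atan_quad.
      replace (0 * sin a / (1 - 0 * cos a)) with 0 by field. rewrite atan_0. ring.
    - intros k _. simpl. unfold Rdiv. ring. }
  change (Rabs (f r) <= 2 / d * r ^ S n / INR (S n)).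
  replace (f r) with (f r - f 0) by (rewrite f0; ring).
  replace (2 / d * r ^ S n / INR (S n))
    with (2 / d * r ^ S n / INR (S n) - 2 / d * 0 ^ S n / INR (S n))
    by (simpl; unfold Rdiv; ring).
  apply (derive_dominated f (fun t => 2 / d * t ^ S n / INR (S n))
    (fun t => psum (fun m => t ^ m * sin (INR (S m) * a)) n - sin a / quad a t)
    (fun t => 2 / d * t ^ n)); [lra| | |].
  - intros t Ht. specialize (Hq t Ht).
    apply (is_derive_minus (fun t => psum (fun m => t ^ S m * sin (INR (S m) * a) / INR (S m)) n)
      (atan_quad a)); [apply is_derive_psum_pow|apply is_derive_atan_quad].
    apply one_minus_cos_pos; lra.
  - intros t _. apply pow_integral_derive.
  - intros t Ht. specialize (Hq t Ht).
    pose proof (psum_sin_geometric a t n) as G.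
    assert (Q : 0 < quad a t) by lra.
    replace (psum (fun m => t ^ m * sin (INR (S m) * a)) n - sin a / quad a t)
      with ((- (t ^ n * sin (INR (S n) * a)) + t ^ S n * sin (INR n * a)) * / quad a t).
    2:{ apply Rmult_eq_reg_l with (quad a t); [|lra]. unfold Rminus at 1.
        rewrite Rmult_plus_distr_l, G. field. lra. }
    rewrite Rabs_mult, (Rabs_right (/ _)) by (left; now apply Rinv_0_lt_compat).
    replace (2 / d * t ^ n) with (2 * t ^ n * / d) by (field; lra).
    apply Rmult_le_compat; [apply Rabs_pos|left; now apply Rinv_0_lt_compat| |].
    + apply geometric_remainder_bound; [lra|apply SIN_bound|apply SIN_bound].
    + apply Rinv_le_contravar; lra.
Qed.

Lemma quad_lower (a r t : R) : 0 <= t <= r -> r < 1 -> (1 - r) ^ 2 <= quad a t.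
Proof.
  intros Ht Hr. unfold quad. pose proof (COS_bound a). 
  apply Rle_trans with ((1 - t) ^ 2); [apply pow_incr; lra|]. nra.
Qed.

(* At index 0 the coefficients below are [_ / 0 = 0]. *)
Definition cos_coef (a : R) (m : nat) : R := cos (INR m * a) / INR m.
Definition sin_coef (a : R) (m : nat) : R := sin (INR m * a) / INR m.

Lemma is_lim_seq_geom_bound (K r : R) :
  0 <= r < 1 -> is_lim_seq (fun n => K * r ^ S n / INR (S n)) 0.
Proof.
  intros Hr.
  apply is_lim_seq_0_le with (v := fun n => Rabs K * / INR (S n)) (N := 0%nat).
  2:{ apply is_lim_seq_scal_0, is_lim_seq_inv_S. }
  intros n _. unfold Rdiv. pose proof (INR_S_pos n) as Hn. apply Rinv_0_lt_compat in Hn.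
  rewrite !Rabs_mult, (Rabs_right (/ _)) by lra.
  apply Rmult_le_compat_r; [lra|]. rewrite <- Rmult_1_r. apply Rmult_le_compat_l; [apply Rabs_pos|].
  rewrite <- RPow_abs, <- (pow1 (S n)). apply pow_incr. rewrite Rabs_right; lra.
Qed.

Lemma is_series_cos_coef (a r : R) :
  0 <= r < 1 -> is_series (fun m => cos_coef a m * r ^ m) (- log_quad a r).
Proof.
  intros Hr. apply is_series_psum, is_lim_seq_incr_1, is_lim_seq_dist.
  apply is_lim_seq_0_le with (v := fun n => 2 / (1 - r) ^ 2 * r ^ S n / INR (S n)) (N := 0%nat).
  2:{ now apply is_lim_seq_geom_bound. }
  intros n _.
  replace (psum (fun m => cos_coef a m * r ^ m) (S n) - - log_quad a r)
    with (psum (fun m => r ^ S m * cos (INR (S m) * a) / INR (S m)) n + log_quad a r).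
  - apply log_quad_error; [lra|apply pow_lt; lra|]. intros t Ht. apply quad_lower; lra.
  - rewrite psum_Sl. unfold cos_coef at 1. simpl (INR 0). unfold Rdiv at 2. rewrite Rinv_0.
    rewrite (psum_ext (fun k => cos_coef a (S k) * r ^ S k)
      (fun m => r ^ S m * cos (INR (S m) * a) / INR (S m))).
    + ring.
    + intros k _. unfold cos_coef, Rdiv. ring.
Qed.

Lemma is_series_sin_coef (a r : R) :
  0 <= r < 1 -> is_series (fun m => sin_coef a m * r ^ m) (atan_quad a r).
Proof.
  intros Hr. apply is_series_psum, is_lim_seq_incr_1, is_lim_seq_dist.
  apply is_lim_seq_0_le with (v := fun n => 2 / (1 - r) ^ 2 * r ^ S n / INR (S n)) (N := 0%nat).
  2:{ now apply is_lim_seq_geom_bound. }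
  intros n _.
  replace (psum (fun m => sin_coef a m * r ^ m) (S n) - atan_quad a r)
    with (psum (fun m => r ^ S m * sin (INR (S m) * a) / INR (S m)) n - atan_quad a r).
  - apply atan_quad_error; [lra|apply pow_lt; lra|]. intros t Ht. apply quad_lower; lra.
  - rewrite psum_Sl. unfold sin_coef at 1. simpl (INR 0). unfold Rdiv at 2. rewrite Rinv_0.
    rewrite (psum_ext (fun k => sin_coef a (S k) * r ^ S k)
      (fun m => r ^ S m * sin (INR (S m) * a) / INR (S m))).
    + ring.
    + intros k _. unfold sin_coef, Rdiv. ring.
Qed.

Lemma atan_quad_1 (a : R) : 0 < a < 2 * PI -> atan_quad a 1 = (PI - a) / 2.
Proof.
  intros Ha. unfold atan_quad.
  assert (Hs : 0 < sin (a / 2)) by (apply sin_gt_0; lra).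
  rewrite !Rmult_1_l.
  replace (sin a / (1 - cos a)) with (tan ((PI - a) / 2)).
  - apply atan_tan. lra.
  - unfold tan.
    replace ((PI - a) / 2) with (PI / 2 - a / 2) by field.
    rewrite sin_shift, cos_shift.
    replace (sin a) with (2 * sin (a / 2) * cos (a / 2)).
    2:{ rewrite <- sin_2a. f_equal. field. }
    replace (1 - cos a) with (2 * sin (a / 2) * sin (a / 2)).
    2:{ replace a with (2 * (a / 2)) at 3 by field. rewrite cos_2a_sin. ring. }
    field. lra.
Qed.

Lemma log_quad_1 (a : R) : 0 < a < 2 * PI -> log_quad a 1 = ln (2 * sin (a / 2)).
Proof.
  intros Ha. unfold log_quad, quad.
  assert (Hs : 0 < sin (a / 2)) by (apply sin_gt_0; lra).
  replace (1 - 2 * 1 * cos a + 1 ^ 2) with ((2 * sin (a / 2)) * (2 * sin (a / 2))).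
  - rewrite ln_mult by lra. field.
  - replace (cos a) with (1 - 2 * sin (a / 2) * sin (a / 2)); [ring|].
    rewrite <- cos_2a_sin. f_equal. field.
Qed.

(** * The Basel sum and the roots of unity filter *)


Lemma ex_series_inv_sq : ex_series (fun n => / INR (S n) ^ 2).
Proof.
  apply (ex_series_le (fun n => / INR (S n) ^ 2) _) with (2 := ex_series_ln_over_sq).
  intros n. pose proof (INR_S_ge_1 n) as H.
  assert (0 < / INR (S n) ^ 2) by (apply Rinv_0_lt_compat, pow_lt; lra).
  pose proof (ln_nonneg (INR (S n) + 1) ltac:(lra)).
  change (Rabs (/ INR (S n) ^ 2) <= (1 + ln (INR (S n) + 1)) / INR (S n) ^ 2).
  rewrite Rabs_right by lra. unfold Rdiv. nra.
Qed.

Lemma cos_quarter_block (n : nat) :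
  let c k := cos (INR k * PI) - cos (INR k * (PI / 2)) in
  c (S (4 * n)) = -1 /\ c (S (S (4 * n))) = 2 /\
  c (S (S (S (4 * n)))) = -1 /\ c (S (S (S (S (4 * n))))) = 0.
Proof.
  assert (E : INR (4 * n) = 4 * INR n) by (rewrite mult_INR; simpl; ring).
  assert (P : forall x y z, x = y + 2 * INR z * PI -> cos x = cos y)
    by (intros x y z ->; apply cos_period).
  cbv beta zeta. rewrite !S_INR, E.
  assert (C3 : cos (PI + PI / 2) = 0) by (rewrite Rplus_comm, neg_cos, cos_PI2; ring).
  repeat split.
  - rewrite (P ((4 * INR n + 1) * PI) PI (2 * n)%nat), (P ((4 * INR n + 1) * (PI / 2)) (PI / 2) n), cos_PI, cos_PI2;
      rewrite ?plus_INR, ?mult_INR; simpl; field.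
  - rewrite (P ((4 * INR n + 1 + 1) * PI) (2 * PI) (2 * n)%nat), (P ((4 * INR n + 1 + 1) * (PI / 2)) PI n), cos_PI, cos_2PI;
      rewrite ?plus_INR, ?mult_INR; simpl; field.
  - rewrite (P ((4 * INR n + 1 + 1 + 1) * PI) PI (2 * n + 1)%nat), (P ((4 * INR n + 1 + 1 + 1) * (PI / 2)) (PI + PI / 2) n), C3, cos_PI;
      rewrite ?plus_INR, ?mult_INR; simpl; field.
  - rewrite (P ((4 * INR n + 1 + 1 + 1 + 1) * PI) (2 * PI) (2 * n + 1)%nat), (P ((4 * INR n + 1 + 1 + 1 + 1) * (PI / 2)) (2 * PI) n), cos_2PI;
      rewrite ?plus_INR, ?mult_INR; simpl; field.
Qed.

(* Integrating [sum sin (m a) / m = (PI - a) / 2] over [PI/2, PI]. *)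
Lemma cos_over_sq_sum (n : nat) :
  Rabs (PI ^ 2 / 16 +
        psum (fun m => (cos (INR (S m) * PI) - cos (INR (S m) * (PI / 2))) / INR (S m) ^ 2) n)
  <= PI * / INR (S n).
Proof.
  set (F := fun a => PI * a / 2 - a ^ 2 / 4
                     + psum (fun m => cos (INR (S m) * a) / INR (S m) ^ 2) n).
  pose proof PI_RGT_0 as HPI.
  destruct (mean_value F (fun a => (PI - a) / 2 - psum (fun m => sin (INR (S m) * a) / INR (S m)) n)
    (PI / 2) PI) as [c [Hc E]]; [lra| |].
  - intros a _. unfold F.
    apply (is_derive_plus (fun a => PI * a / 2 - a ^ 2 / 4)
      (fun a => psum (fun m => cos (INR (S m) * a) / INR (S m) ^ 2) n)).
    + auto_derive; [easy|field].
    + replace (- psum (fun m => sin (INR (S m) * a) / INR (S m)) n)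
        with (psum (fun m => - (sin (INR (S m) * a) / INR (S m))) n).
      2:{ rewrite (psum_ext _ (fun m => (-1) * (sin (INR (S m) * a) / INR (S m))))
            by (intros; ring). rewrite psum_scal. ring. }
      clear. induction n as [|n IH]; [apply (is_derive_const 0)|]. cbn [psum].
      apply (is_derive_plus (fun a => psum (fun m => cos (INR (S m) * a) / INR (S m) ^ 2) n)
        (fun a => cos (INR (S n) * a) / INR (S n) ^ 2)); [exact IH|].
      pose proof (INR_S_pos n). set (x := INR (S n)) in *. clearbody x.
      auto_derive; [easy|field; lra].
  - replace (PI ^ 2 / 16 +
        psum (fun m => (cos (INR (S m) * PI) - cos (INR (S m) * (PI / 2))) / INR (S m) ^ 2) n)
      with (F PI - F (PI / 2)).
    2:{ unfold F. 
        rewrite (psum_ext (fun m => (cos (INR (S m) * PI) - cos (INR (S m) * (PI / 2))) / INR (S m) ^ 2)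
          (fun m => cos (INR (S m) * PI) / INR (S m) ^ 2 - cos (INR (S m) * (PI / 2)) / INR (S m) ^ 2))
          by (intros; unfold Rdiv; ring).
        rewrite psum_minus. field. }
    rewrite E, Rabs_mult, (Rabs_right (PI - PI / 2)) by lra.
    assert (A := atan_quad_error c 1 1 n ltac:(lra) ltac:(lra)).
    rewrite atan_quad_1 in A by lra.
    rewrite (psum_ext _ (fun m => sin (INR (S m) * c) / INR (S m))) in A.
    2:{ intros k _. rewrite pow1. unfold Rdiv. ring. }
    rewrite pow1 in A. rewrite Rabs_minus_sym.
    pose proof (INR_S_pos n) as Hn. apply Rinv_0_lt_compat in Hn.
    apply Rle_trans with (2 * / INR (S n) * (PI - PI / 2)); [|right; field; apply not_0_INR; lia].
    apply Rmult_le_compat_r; [lra|].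
    eapply Rle_trans; [apply A|right; field; apply not_0_INR; lia].
    intros t Ht. unfold quad.
    assert (cos c <= 0) by (apply cos_le_0; lra).
    pose proof (pow2_ge_0 t). nra.
Qed.

Theorem basel : is_series (fun n => / INR (S n) ^ 2) (PI ^ 2 / 6).
Proof.
  destruct ex_series_inv_sq as [z Hz].
  enough (z = PI ^ 2 / 6) by (subst; exact Hz).
  apply is_series_psum in Hz.
  set (Z := psum (fun n => / INR (S n) ^ 2)) in *.
  assert (L : forall p, (0 < p)%nat -> is_lim_seq (fun n => Z (p * n)%nat) z).
  { intros p Hp. apply (is_lim_seq_subseq Z z (fun n => (p * n)%nat)); [|exact Hz].
    apply eventually_subseq. intros n. nia. }
  (* The numerators [-1, 2, -1, 0] have period 4 and equal [-1], plus 3 on even indices, minus 2 on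
     multiples of 4; after scaling the coefficients are [-1], [3/4] and [- 2/16]. In the limit
     [PI^2 / 16 = 3/8 z]. *)
  assert (E : forall n,
    psum (fun m => (cos (INR (S m) * PI) - cos (INR (S m) * (PI / 2))) / INR (S m) ^ 2) (4 * n)
    = - Z (4 * n)%nat + 3 / 4 * Z (2 * n)%nat - / 8 * Z (1 * n)%nat).
  { induction n as [|n IH].
    - simpl. unfold Z. simpl. field.
    - destruct (cos_quarter_block n) as [c1 [c2 [c3 c4]]].
      replace (4 * S n)%nat with (S (S (S (S (4 * n))))) by lia.
      replace (2 * S n)%nat with (S (S (2 * n))) by lia.
      replace (1 * S n)%nat with (S (1 * n)) by lia.
      unfold Z in *. cbn [psum].
      rewrite IH, c1, c2, c3, c4.
      rewrite !S_INR, !mult_INR. simpl (INR 4). simpl (INR 2). simpl (INR 1).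
      pose proof (pos_INR n). field. lra. }
  assert (L0 : is_lim_seq (fun n => PI ^ 2 / 16 +
    (- Z (4 * n)%nat + 3 / 4 * Z (2 * n)%nat - / 8 * Z (1 * n)%nat)) 0).
  { apply is_lim_seq_0_le with (v := fun n => PI * / INR (S n)) (N := 0%nat).
    2:{ apply is_lim_seq_scal_0, is_lim_seq_inv_S. }
    intros n _. rewrite <- E. eapply Rle_trans; [apply cos_over_sq_sum|].
    apply Rmult_le_compat_l; [pose proof PI_RGT_0; lra|].
    apply Rinv_le_contravar; [apply INR_S_pos|]. apply le_INR. lia. }
  assert (L1 : is_lim_seq (fun n => PI ^ 2 / 16 +
    (- Z (4 * n)%nat + 3 / 4 * Z (2 * n)%nat - / 8 * Z (1 * n)%nat))
    (PI ^ 2 / 16 + (- z + 3 / 4 * z - / 8 * z))).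
  { apply is_lim_seq_plus'; [apply is_lim_seq_const|].
    apply is_lim_seq_minus'; [apply is_lim_seq_plus'|].
    - apply (is_lim_seq_opp _ z), L. lia.
    - apply (is_lim_seq_scal_l _ (3 / 4) z), L. lia.
    - apply (is_lim_seq_scal_l _ (/ 8) z), L. lia. }
  apply is_lim_seq_unique in L0. apply is_lim_seq_unique in L1.
  rewrite L0 in L1. injection L1 as L1. lra.
Qed.

Lemma cv_radius_ge (a : nat -> R) (x : R) :
  ex_series (fun n => a n * x ^ n) -> Rbar_le (Rabs x) (CV_radius a).
Proof.
  intros H. apply Rbar_not_lt_le. intros C.
  apply (CV_disk_outside a x C). apply (ex_series_lim_0 (fun n => a n * x ^ n)), H.
Qed.

(** The Cauchy product needs [r] strictly inside both discs of convergence; convergence at the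
    midpoint of [r] and 1 provides this. *)
Lemma is_series_PS_mult (a b : nat -> R) (A B : R -> R) (r : R) :
  0 <= r < 1 ->
  (forall t, 0 <= t < 1 -> is_series (fun n => a n * t ^ n) (A t)) ->
  (forall t, 0 <= t < 1 -> is_series (fun n => b n * t ^ n) (B t)) ->
  is_series (fun n => PS_mult a b n * r ^ n) (A r * B r).
Proof.
  intros Hr HA HB. set (t := (1 + r) / 2).
  assert (Ht : 0 <= t < 1) by (unfold t; lra).
  assert (Lt : Rabs r < Rabs t) by (rewrite !Rabs_right by (unfold t; lra); unfold t; lra).
  apply is_pseries_R. apply is_pseries_mult.
  - apply is_pseries_R, HA, Hr.
  - apply is_pseries_R, HB, Hr.
  - apply Rbar_lt_le_trans with (Rabs t); [exact Lt|]. apply cv_radius_ge.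
    eexists. apply HA, Ht.
  - apply Rbar_lt_le_trans with (Rabs t); [exact Lt|]. apply cv_radius_ge.
    eexists. apply HB, Ht.
Qed.

(** The coefficients of [ln^2 (1 - z)]. Since [/ 0 = 0], the index 0 and the two end terms of each
    convolution drop out by themselves. *)
Definition inv_conv : nat -> R := PS_mult (fun m => / INR m) (fun m => / INR m).

Lemma PS_mult_cos_sin (a : R) (n : nat) :
  PS_mult (cos_coef a) (cos_coef a) n - PS_mult (sin_coef a) (sin_coef a) n
  = cos (INR n * a) * inv_conv n.
Proof.
  unfold inv_conv, PS_mult. rewrite <- !sum_n_Reals, !sum_n_psum, <- psum_minus, <- psum_scal.
  apply psum_ext. intros k Hk. unfold cos_coef, sin_coef.
  replace (INR n * a) with (INR k * a + INR (n - k) * a) by (rewrite minus_INR by lia; ring).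
  rewrite cos_plus. unfold Rdiv. ring.
Qed.

(* The real part of [ln (1 - r e^(i a)) ^ 2]. *)
Lemma is_series_log_atan_sq (a r : R) :
  0 <= r < 1 ->
  is_series (fun n => cos (INR n * a) * inv_conv n * r ^ n) (log_quad a r ^ 2 - atan_quad a r ^ 2).
Proof.
  intros Hr.
  pose proof (is_series_PS_mult _ _ _ _ r Hr (is_series_cos_coef a) (is_series_cos_coef a)) as C.
  pose proof (is_series_PS_mult _ _ _ _ r Hr (is_series_sin_coef a) (is_series_sin_coef a)) as D.
  replace (log_quad a r ^ 2 - atan_quad a r ^ 2)
    with (minus (- log_quad a r * - log_quad a r) (atan_quad a r * atan_quad a r)).
  2:{ unfold minus, plus, opp. simpl. ring. }
  eapply is_series_ext; [|exact (is_series_minus _ _ _ _ C D)].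
  intros n. cbv beta. rewrite <- PS_mult_cos_sin. unfold minus, plus, opp. simpl. ring.
Qed.

Lemma inv_conv_0 : inv_conv 0 = 0.
Proof. unfold inv_conv, PS_mult. simpl. rewrite Rinv_0. ring. Qed.

(** Partial fractions: [1 / (k (n - k)) = (1 / k + 1 / (n - k)) / n]. *)
Lemma inv_conv_S (m : nat) : inv_conv (S m) = 2 * harmonic m / INR (S m).
Proof.
  unfold inv_conv, PS_mult. rewrite <- sum_n_Reals, sum_n_psum.
  rewrite psum_Sl. cbn [psum]. simpl (INR 0). rewrite Nat.sub_diag. simpl (INR 0).
  rewrite Rinv_0, Rmult_0_l, Rmult_0_r, Rplus_0_l, Rplus_0_r.
  rewrite (psum_ext _ (fun k => / INR (S m) * (/ INR (S k) + / INR (S (m - 1 - k))))).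
  - rewrite psum_scal, psum_plus, (psum_rev (fun k => / INR (S k))).
    unfold harmonic, Rdiv. ring.
  - intros k Hk.
    replace (S m - S k)%nat with (S (m - 1 - k)) by lia.
    assert (E : INR (S m) = INR (S k) + INR (S (m - 1 - k))).
    { rewrite <- plus_INR. f_equal. lia. }
    rewrite E. pose proof (INR_S_pos k). pose proof (INR_S_pos (m - 1 - k)). field. lra.
Qed.

(** Off the multiples of [M], multiplication by [2 sin (PI k / M)], which is nonzero, makes the sum
    telescope over a full period. *)
Lemma psum_cos_roots (M k : nat) :
  (0 < M)%nat ->
  psum (fun j => cos (INR k * (2 * PI * INR j / INR M))) M
  = if Nat.eq_dec (k mod M) 0 then INR M else 0.
Proof.
  intros HM. assert (HM' : INR M <> 0) by (apply not_0_INR; lia).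
  destruct (Nat.eq_dec (k mod M) 0) as [E|E].
  - apply Nat.Div0.mod_divides in E. destruct E as [c ->].
    rewrite (psum_ext _ (fun _ => 1)); [rewrite psum_const; ring|].
    intros j _. rewrite <- (cos_0), <- (cos_period 0 (c * j)). f_equal.
    rewrite !mult_INR. field. easy.
  - set (x := INR k * PI / INR M).
    assert (Hs : sin x <> 0).
    { intros Z. apply sin_eq_0_0 in Z. destruct Z as [z Hz]. apply E.
      assert (K : INR k = IZR z * INR M).
      { unfold x in Hz. pose proof PI_neq0.
        apply Rmult_eq_reg_r with PI; [|easy].
        replace (IZR z * INR M * PI) with (IZR z * PI * INR M) by ring.
        rewrite <- Hz. field. easy. }
      rewrite !INR_IZR_INZ, <- mult_IZR in K. apply eq_IZR in K.
      apply Nat.Div0.mod_divides. exists (Z.to_nat z). nia. }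
    apply Rmult_eq_reg_l with (2 * sin x); [|lra]. rewrite Rmult_0_r, <- psum_scal.
    rewrite (psum_ext _ (fun j => sin (2 * x * INR (S j) - x) - sin (2 * x * INR j - x))).
    + rewrite (psum_telescope (fun j => sin (2 * x * INR j - x))).
      replace (2 * x * INR M - x) with (- x + 2 * INR k * PI) by (unfold x; field; easy).
      rewrite sin_period. simpl (INR 0).
      replace (2 * x * 0 - x) with (- x) by ring. ring.
    + intros j _. rewrite S_INR.
      replace (INR k * (2 * PI * INR j / INR M)) with (2 * x * INR j) by (unfold x; field; easy).
      replace (2 * x * (INR j + 1) - x) with (2 * x * INR j + x) by ring.
      rewrite sin_plus, sin_minus. ring.
Qed.

Lemma is_series_psum_finite (f : nat -> nat -> R) (s : nat -> R) (M : nat) :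
  (forall j, (j < M)%nat -> is_series (f j) (s j)) ->
  is_series (fun n => psum (fun j => f j n) M) (psum s M).
Proof.
  induction M as [|M IH]; intros H.
  - cbn [psum]. apply is_series_psum. apply is_lim_seq_ext with (fun _ => 0).
    + intros n. rewrite psum_const. ring.
    + apply is_lim_seq_const.
  - cbn [psum]. apply (is_series_plus (fun n => psum (fun j => f j n) M) (f M)).
    + apply IH. intros; apply H; lia.
    + apply H. lia.
Qed.

Lemma is_series_multiples (f : nat -> R) (l : R) (M : nat) :
  (0 < M)%nat -> (forall k, k mod M <> 0%nat -> f k = 0) ->
  is_series f l -> is_series (fun m => f (M * m)%nat) l.
Proof.
  intros HM Hf H. apply is_series_psum in H. apply is_series_psum.
  apply is_lim_seq_ext with (fun N => psum f (M * N)).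
  - intros N. induction N as [|N IH]; [rewrite Nat.mul_0_r; easy|].
    replace (M * S N)%nat with (M * N + M)%nat by lia.
    rewrite psum_add, IH. cbn [psum]. f_equal.
    destruct M as [|M]; [lia|]. rewrite psum_Sl, Nat.add_0_r.
    rewrite (psum_ext _ (fun _ => 0)); [rewrite psum_const; ring|].
    intros k Hk. apply Hf. rewrite Nat.add_comm, Nat.mul_comm, Nat.Div0.mod_add.
    rewrite Nat.mod_small; lia.
  - apply (is_lim_seq_subseq (psum f) l (fun N => (M * N)%nat)); [|exact H].
    apply eventually_subseq. intros n. nia.
Qed.

Lemma is_series_roots_filter (f : nat -> R) (S0 : nat -> R) (M : nat) (r : R) :
  (0 < M)%nat ->
  (forall j, (j < M)%nat ->
     is_series (fun n => cos (INR n * (2 * PI * INR j / INR M)) * f n * r ^ n) (S0 j)) ->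
  is_series (fun m => INR M * f (M * m)%nat * (r ^ M) ^ m) (psum S0 M).
Proof.
  intros HM H. apply is_series_psum_finite in H.
  apply (is_series_ext _ (fun n => (if Nat.eq_dec (n mod M) 0 then INR M else 0) * f n * r ^ n)) in H.
  - apply (is_series_multiples _ _ M HM) in H.
    + eapply is_series_ext; [|exact H]. intros m. cbv beta.
      rewrite Nat.mul_comm, Nat.Div0.mod_mul. destruct (Nat.eq_dec 0 0); [|easy].
      rewrite <- pow_mult. f_equal. f_equal. lia.
    + intros k Hk. destruct (Nat.eq_dec (k mod M) 0); [easy|]. ring.
  - intros n. cbv beta. rewrite <- psum_cos_roots by easy.
    rewrite (psum_ext _ (fun j => (f n * r ^ n) * cos (INR n * (2 * PI * INR j / INR M))))
      by (intros; ring).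
    rewrite psum_scal. match goal with |- ?x = ?y => change (@eq R x y) end. ring.
Qed.

(** * Logarithms of sines at the roots of unity *)


(** The two sequences are adjacent and enclose gamma at every index; the width [1 / (n + 1)] of the
    enclosure gives the bound on [rho]. The definition of [euler_gamma] uses the decreasing one. *)
Lemma euler_gamma_spec :
  is_lim_seq (fun n => harmonic n - ln (INR (S n))) euler_gamma /\
  forall n, harmonic n - ln (INR (S n)) <= euler_gamma <= harmonic (S n) - ln (INR (S n)).
Proof.
  set (u := fun n => harmonic n - ln (INR (S n))).
  set (v := fun n => harmonic (S n) - ln (INR (S n))).
  assert (Hu : forall n, u n <= u (S n)).
  { intros n. unfold u. change (harmonic (S n)) with (harmonic n + / INR (S n)).
    destruct (ln_succ_bounds (INR (S n)) (INR_S_pos n)) as [_ B].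
    rewrite <- S_INR in B. lra. }
  assert (Hv : forall n, v (S n) <= v n).
  { intros n. unfold v. change (harmonic (S (S n))) with (harmonic (S n) + / INR (S (S n))).
    destruct (ln_succ_bounds (INR (S n)) (INR_S_pos n)) as [B _].
    rewrite <- S_INR in B. lra. }
  assert (Hd : is_lim_seq (fun n => v n - u n) 0).
  { apply is_lim_seq_ext with (fun n => / INR (S n)); [|apply is_lim_seq_inv_S].
    intros n. unfold v, u. change (harmonic (S n)) with (harmonic n + / INR (S n)). ring. }
  destruct (ex_lim_seq_adj u v Hu Hv Hd) as [[l Hl] [[l' Hl'] E]].
  assert (l' = l).
  { apply is_lim_seq_unique in Hl. apply is_lim_seq_unique in Hl'.
    rewrite Hl, Hl' in E. now injection E. }
  subst l'.
  assert (G : euler_gamma = l).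
  { unfold euler_gamma.
    rewrite (Lim_seq_ext _ v).
    - apply is_lim_seq_unique in Hl'. now rewrite Hl'.
    - intros n. unfold v, harmonic. now rewrite sum_n_psum. }
  rewrite G. split; [exact Hl|]. intros n. split.
  - exact (is_lim_seq_incr_compare u l Hl Hu n).
  - exact (is_lim_seq_decr_compare v l Hl' Hv n).
Qed.

Lemma is_series_zeta_diff_0 : is_series zeta_diff_0 euler_gamma.
Proof.
  apply is_series_psum.
  apply is_lim_seq_ext with (2 := proj1 euler_gamma_spec).
  intros n. unfold zeta_diff_0. rewrite psum_minus.
  rewrite (psum_ext (fun k => ln (INR (S k) + 1) - ln (INR (S k)))
    (fun k => ln (INR (S (S k))) - ln (INR (S k)))).
  - rewrite (psum_telescope (fun k => ln (INR (S k)))).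
    change (INR 1) with 1. rewrite ln_1. unfold harmonic. ring.
  - intros k _. now rewrite (S_INR (S k)).
Qed.

Definition rho (k : nat) : R := harmonic (pred k) - ln (INR k) - euler_gamma.

Lemma rho_bound (k : nat) : (0 < k)%nat -> Rabs (rho k) <= / INR k.
Proof.
  intros Hk. destruct k as [|k]; [lia|]. unfold rho. cbn [pred].
  destruct (proj2 euler_gamma_spec k) as [A B].
  change (harmonic (S k)) with (harmonic k + / INR (S k)) in B.
  apply Rabs_le. pose proof (INR_S_pos k) as H. apply Rinv_0_lt_compat in H. lra.
Qed.

Definition root_angle (M j : nat) : R := 2 * PI * INR j / INR M.

Definition near_one (i : nat) : R := 1 - / INR (S (S i)).

Lemma near_one_bounds (i : nat) : 0 <= near_one i < 1.
Proof.
  unfold near_one. pose proof (INR_S_pos (S i)) as H.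
  assert (1 <= INR (S (S i))) by apply INR_S_ge_1.
  assert (0 < / INR (S (S i))) by now apply Rinv_0_lt_compat.
  assert (/ INR (S (S i)) <= 1) by (rewrite <- Rinv_1; apply Rinv_le_contravar; lra). lra.
Qed.

Lemma is_lim_seq_near_one : is_lim_seq near_one 1.
Proof.
  unfold near_one. replace (Finite 1) with (Finite (1 - 0)) by (f_equal; ring).
  apply is_lim_seq_minus'; [apply is_lim_seq_const|].
  apply (is_lim_seq_incr_1 (fun i => / INR (S i))), is_lim_seq_inv_S.
Qed.

(** The quotient [(1 - r^M) / (1 - r)]. It splits [ln (1 - r^M)] into the singular [ln (1 - r)] and
    a part tending to [ln M]. *)
Definition geom (M : nat) (r : R) : R := psum (fun k => r ^ k) M.

Lemma geom_mult (M : nat) (r : R) : geom M r * (1 - r) = 1 - r ^ M.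
Proof.
  unfold geom. induction M as [|M IH]; [simpl; ring|]. cbn [psum].
  rewrite Rmult_plus_distr_r, IH. simpl. ring.
Qed.

Lemma geom_bounds (M : nat) (r : R) :
  (0 < M)%nat -> 0 <= r < 1 -> 1 <= geom M r <= INR M.
Proof.
  intros HM Hr. unfold geom. split.
  - destruct M as [|M]; [lia|]. rewrite psum_Sl. simpl (r ^ 0).
    assert (0 <= psum (fun k => r ^ S k) M); [|lra].
    rewrite <- (Rmult_0_r (INR M)), <- (psum_const 0 M). apply psum_le. intros. apply pow_le. lra.
  - rewrite <- (Rmult_1_r (INR M)), <- (psum_const 1 M). apply psum_le. intros k _.
    rewrite <- (pow1 k). apply pow_incr. lra.
Qed.

Lemma one_sub_pow_le (k : nat) (r : R) : 0 <= r < 1 -> 1 - r ^ k <= INR k * (1 - r).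
Proof.
  intros Hr. induction k as [|k IH]; [simpl; lra|]. rewrite S_INR. simpl.
  assert (0 <= r ^ k <= 1).
  { split; [apply pow_le; lra|]. rewrite <- (pow1 k). apply pow_incr. lra. }
  nra.
Qed.

(** A linear rate in [1 - r] is needed because the gap gets multiplied by the divergent
    [ln (1 - r)]. *)
Lemma geom_near_M (M : nat) (r : R) : 0 <= r < 1 -> INR M - geom M r <= INR M * INR M * (1 - r).
Proof.
  intros Hr. unfold geom. rewrite <- (Rmult_1_r (INR M)) at 1.
  rewrite <- (psum_const 1 M), <- psum_minus.
  replace (INR M * INR M * (1 - r)) with (INR M * (INR M * (1 - r))) by ring.
  rewrite <- (psum_const (INR M * (1 - r)) M). apply psum_le. intros k Hk.
  eapply Rle_trans; [apply one_sub_pow_le, Hr|]. apply Rmult_le_compat_r; [lra|].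
  apply le_INR. lia.
Qed.

Lemma is_lim_seq_geom (M : nat) : is_lim_seq (fun i => geom M (near_one i)) (INR M).
Proof.
  unfold geom. replace (INR M) with (psum (fun _ => 1) M) by (rewrite psum_const; ring).
  apply (is_lim_seq_psum (fun i k => near_one i ^ k) (fun _ => 1)).
  intros k. induction k as [|k IH]; [apply is_lim_seq_const|].
  replace (Finite 1) with (Finite (1 * 1)) by (f_equal; ring).
  simpl. apply is_lim_seq_mult'; [apply is_lim_seq_near_one|exact IH].
Qed.

Lemma ln_one_sub_pow (M : nat) (r : R) :
  (0 < M)%nat -> 0 <= r < 1 -> ln (1 - r ^ M) = ln (1 - r) + ln (geom M r).
Proof.
  intros HM Hr. rewrite <- geom_mult. pose proof (geom_bounds M r HM Hr).
  rewrite ln_mult by lra. ring.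
Qed.

Lemma pow_M_bounds (M : nat) (r : R) : (0 < M)%nat -> 0 <= r < 1 -> 0 <= r ^ M < 1.
Proof.
  intros HM Hr. split; [apply pow_le; lra|].
  pose proof (geom_mult M r). pose proof (geom_bounds M r HM Hr). nra.
Qed.

Lemma log_quad_0 (r : R) : 0 <= r < 1 -> log_quad 0 r = ln (1 - r).
Proof.
  intros Hr. unfold log_quad, quad. rewrite cos_0.
  replace (1 - 2 * r * 1 + r ^ 2) with ((1 - r) * (1 - r)) by ring.
  rewrite ln_mult by lra. field.
Qed.

Lemma atan_quad_0 (r : R) : atan_quad 0 r = 0.
Proof.
  unfold atan_quad. rewrite sin_0. unfold Rdiv. rewrite Rmult_0_r, Rmult_0_l. apply atan_0.
Qed.

Lemma root_angle_0 (M : nat) : root_angle M 0 = 0.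
Proof. unfold root_angle. simpl. unfold Rdiv. ring. Qed.

Lemma root_angle_bounds (M j : nat) : (0 < j < M)%nat -> 0 < root_angle M j < 2 * PI.
Proof.
  intros H. unfold root_angle. pose proof PI_RGT_0.
  assert (0 < INR j) by (apply lt_0_INR; lia). assert (INR j < INR M) by (apply lt_INR; lia).
  split.
  - apply Rdiv_lt_0_compat; [|lra]. nra.
  - apply Rmult_lt_reg_r with (INR M); [lra|].
    replace (2 * PI * INR j / INR M * INR M) with (2 * PI * INR j) by (field; lra). nra.
Qed.

Lemma quad_1_pos (a : R) : 0 < a < 2 * PI -> 0 < quad a 1.
Proof.
  intros Ha. unfold quad.
  assert (Hs : 0 < sin (a / 2)) by (apply sin_gt_0; lra).
  replace (cos a) with (1 - 2 * sin (a / 2) * sin (a / 2)); [nra|].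
  rewrite <- cos_2a_sin. f_equal. field.
Qed.

Lemma is_lim_seq_derive (f : R -> R) (u : nat -> R) (x l : R) :
  is_derive f x l -> is_lim_seq u x -> is_lim_seq (fun n => f (u n)) (f x).
Proof.
  intros Hf Hu. apply is_lim_seq_continuous; [|exact Hu].
  apply continuity_pt_filterlim.
  apply (ex_derive_continuous (K := R_AbsRing) (V := R_NormedModule)). now exists l.
Qed.

Lemma is_lim_seq_log_quad (a : R) :
  0 < a < 2 * PI -> is_lim_seq (fun i => log_quad a (near_one i)) (log_quad a 1).
Proof.
  intros Ha. eapply is_lim_seq_derive; [|apply is_lim_seq_near_one].
  apply is_derive_log_quad. now apply quad_1_pos.
Qed.

Lemma is_lim_seq_atan_quad (a : R) :
  0 < a < 2 * PI -> is_lim_seq (fun i => atan_quad a (near_one i)) (atan_quad a 1).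
Proof.
  intros Ha. eapply is_lim_seq_derive; [|apply is_lim_seq_near_one].
  apply is_derive_atan_quad. apply one_minus_cos_pos; [lra|]. now apply quad_1_pos.
Qed.

Lemma is_series_ln_one_sub (q : R) :
  0 <= q < 1 -> is_series (fun m => / INR m * q ^ m) (- ln (1 - q)).
Proof.
  intros Hq. rewrite <- log_quad_0 by easy.
  eapply is_series_ext; [|apply is_series_cos_coef, Hq].
  intros m. cbv beta. unfold cos_coef. rewrite Rmult_0_r, cos_0. unfold Rdiv.
  match goal with |- ?x = ?y => change (@eq R x y) end. ring.
Qed.

Lemma is_series_ln_one_sub_sq (q : R) :
  0 <= q < 1 -> is_series (fun m => inv_conv m * q ^ m) (ln (1 - q) ^ 2).
Proof.
  intros Hq.
  pose proof (is_series_log_atan_sq 0 q Hq) as H. rewrite log_quad_0, atan_quad_0 in H by easy.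
  replace (ln (1 - q) ^ 2) with (ln (1 - q) ^ 2 - 0 ^ 2) by ring.
  eapply is_series_ext; [|exact H].
  intros m. cbv beta. rewrite Rmult_0_r, cos_0.
  match goal with |- ?x = ?y => change (@eq R x y) end. ring.
Qed.

Lemma is_lim_seq_eq (u : nat -> R) (a b : R) : is_lim_seq u a -> is_lim_seq u b -> a = b.
Proof.
  intros Ha Hb. apply is_lim_seq_unique in Ha. apply is_lim_seq_unique in Hb.
  rewrite Ha in Hb. now injection Hb.
Qed.

(** The product of [2 sin (PI j / M)] over [0 < j < M] is [M], obtained inside the disc: the root 1
    contributes [ln (1 - r)], which cancels against the singular part of [ln (1 - r^M)] before
    [r -> 1]. *)
Theorem psum_log_roots (M : nat) :
  psum (fun j => log_quad (root_angle (S M) (S j)) 1) M = ln (INR (S M)).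
Proof.
  apply (is_lim_seq_eq
    (fun i => psum (fun j => log_quad (root_angle (S M) (S j)) (near_one i)) M)).
  - cut (forall N, (N <= M)%nat ->
      is_lim_seq (fun i => psum (fun j => log_quad (root_angle (S M) (S j)) (near_one i)) N)
      (psum (fun j => log_quad (root_angle (S M) (S j)) 1) N)); [intros C; now apply C|].
    intros N. induction N as [|N IH]; intros HN; [apply is_lim_seq_const|].
    cbn [psum]. apply is_lim_seq_plus'; [apply IH; lia|].
    apply is_lim_seq_log_quad, root_angle_bounds. lia.
  - apply is_lim_seq_ext with (fun i => ln (geom (S M) (near_one i))).
    + intros i. pose proof (near_one_bounds i) as Hr. set (r := near_one i) in *.
      pose proof (pow_M_bounds (S M) r ltac:(lia) Hr) as Hq.
      assert (E : psum (fun j => - log_quad (root_angle (S M) j) r) (S M) = - ln (1 - r ^ S M)).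
      { assert (H := is_series_roots_filter (fun m => / INR m)
          (fun j => - log_quad (root_angle (S M) j) r) (S M) r ltac:(lia)).
        apply is_series_unique in H.
        - rewrite <- H. apply is_series_unique.
          eapply is_series_ext; [|apply is_series_ln_one_sub, Hq].
          intros m. cbv beta. match goal with |- ?x = ?y => change (@eq R x y) end.
          rewrite mult_INR, Rinv_mult, <- Rmult_assoc, Rinv_r by (apply not_0_INR; lia). ring.
        - intros j _. eapply is_series_ext; [|apply is_series_cos_coef, Hr].
          intros n. cbv beta. unfold cos_coef, root_angle, Rdiv.
          match goal with |- ?x = ?y => change (@eq R x y) end. ring. }
      rewrite psum_Sl, root_angle_0, log_quad_0, ln_one_sub_pow in E by (lia || easy).
      rewrite (psum_ext _ (fun j => (-1) * log_quad (root_angle (S M) (S j)) r)) in E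
        by (intros; ring).
      rewrite psum_scal in E. lra.
    + eapply (is_lim_seq_derive ln); [|apply is_lim_seq_geom].
      apply is_derive_Reals, derivable_pt_lim_ln, INR_S_pos.
Qed.

Definition rho_term (M m : nat) : R := 2 * (rho (M * S m) - rho (S m)) / INR (S m).

Lemma rho_term_bound (M m : nat) :
  (0 < M)%nat -> Rabs (rho_term M m) <= 4 * / INR (S m) ^ 2.
Proof.
  intros HM. unfold rho_term.
  pose proof (rho_bound (S m) ltac:(lia)) as B1.
  pose proof (rho_bound (M * S m) ltac:(lia)) as B2.
  pose proof (INR_S_pos m) as Hm.
  assert (B3 : / INR (M * S m) <= / INR (S m)).
  { apply Rinv_le_contravar; [easy|]. apply le_INR. nia. }
  assert (Hi : 0 < / INR (S m)) by now apply Rinv_0_lt_compat.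
  replace (4 * / INR (S m) ^ 2) with (2 * (2 * / INR (S m)) * / INR (S m)) by (field; lra).
  unfold Rdiv. rewrite !Rabs_mult, (Rabs_right 2), (Rabs_right (/ INR (S m))) by lra.
  apply Rmult_le_compat_r; [lra|]. apply Rmult_le_compat_l; [lra|].
  apply Rabs_le_between in B1. apply Rabs_le_between in B2. apply Rabs_le. lra.
Qed.

(** With [n = m + 1], the three terms are [2 H_(M n - 1) / n], [2 H_(n-1) / n] and [2 ln M / n].
    Their logarithms and gamma cancel, leaving only [rho], so the coefficient is [O(1 / n^2)]
    uniformly in [M]. *)
Lemma root_coefficient (M m : nat) :
  (0 < M)%nat ->
  INR M * inv_conv (M * S m) - inv_conv (S m) - 2 * ln (INR M) * / INR (S m) = rho_term M m.
Proof.
  intros HM. destruct (M * S m)%nat as [|p] eqn:E; [nia|].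
  rewrite !inv_conv_S. unfold rho_term. rewrite E. unfold rho. cbn [pred].
  assert (E' : INR (S p) = INR M * INR (S m)) by (rewrite <- E; apply mult_INR).
  assert (0 < INR M) by (apply lt_0_INR; lia). pose proof (INR_S_pos m).
  rewrite E', ln_mult by easy. field. lra.
Qed.

Lemma is_series_drop_0 (a : nat -> R) (l : R) :
  a 0%nat = 0 -> is_series a l -> is_series (fun n => a (S n)) l.
Proof.
  intros H0 H. apply is_series_psum in H. apply is_series_psum.
  apply is_lim_seq_incr_1 in H. apply is_lim_seq_ext with (2 := H).
  intros n. rewrite psum_Sl, H0. ring.
Qed.

Lemma is_series_rho_term_pow (M : nat) (r : R) :
  (0 < M)%nat -> 0 <= r < 1 ->
  is_series (fun m => rho_term M m * (r ^ M) ^ S m)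
    (psum (fun j => log_quad (root_angle M j) r ^ 2 - atan_quad (root_angle M j) r ^ 2) M
     - ln (1 - r ^ M) ^ 2 + 2 * ln (INR M) * ln (1 - r ^ M)).
Proof.
  intros HM Hr. pose proof (pow_M_bounds M r HM Hr) as Hq.
  assert (H1 := is_series_roots_filter inv_conv
    (fun j => log_quad (root_angle M j) r ^ 2 - atan_quad (root_angle M j) r ^ 2) M r HM
    ltac:(intros; apply is_series_log_atan_sq, Hr)).
  pose proof (is_series_ln_one_sub_sq _ Hq) as H2.
  pose proof (is_series_scal (2 * ln (INR M)) _ _ (is_series_ln_one_sub _ Hq)) as H3.
  pose proof (is_series_minus _ _ _ _ (is_series_minus _ _ _ _ H1 H2) H3) as H.
  apply is_series_drop_0 in H.
  - match type of H with is_series _ ?s => match goal with |- is_series _ ?t =>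
      replace t with s end end.
    + eapply is_series_ext; [|exact H]. intros m. cbv beta.
      rewrite <- root_coefficient by easy.
      unfold minus, plus, opp, scal. simpl. unfold mult. simpl. ring.
    + unfold minus, plus, opp, scal. simpl. unfold mult. simpl. ring.
  - rewrite Nat.mul_0_r, inv_conv_0. unfold minus, plus, opp, scal. simpl. unfold mult. simpl.
    rewrite Rinv_0. ring.
Qed.

Lemma is_lim_seq_ln_correction (M : nat) :
  (0 < M)%nat ->
  is_lim_seq (fun i => ln (1 - near_one i) * (ln (INR M) - ln (geom M (near_one i)))) 0.
Proof.
  intros HM.
  apply is_lim_seq_0_le with
    (v := fun i => INR M * INR M * (ln (INR (S (S i))) / INR (S (S i)))) (N := 0%nat).
  2:{ apply is_lim_seq_scal_0.
      apply is_lim_seq_ext with (fun n => ln (INR (n + 2)) / INR (n + 2)).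
      { intros n. replace (n + 2)%nat with (S (S n)) by lia. easy. }
      apply (is_lim_seq_incr_n (fun n => ln (INR n) / INR n) 2).
      apply (is_lim_comp_seq (fun y => ln y / y) INR p_infty 0).
      - apply is_lim_div_ln_p.
      - exists 0%nat. intros n _. easy.
      - apply is_lim_seq_INR. }
  intros i _. pose proof (near_one_bounds i) as Hr.
  pose proof (geom_bounds M _ HM Hr) as G. pose proof (geom_near_M M _ Hr) as G2.
  set (p := geom M (near_one i)) in *.
  replace (1 - near_one i) with (/ INR (S (S i))) in * by (unfold near_one; ring).
  pose proof (INR_S_ge_1 (S i)) as Ht. set (t := INR (S (S i))) in *.
  pose proof (ln_nonneg t Ht) as Lt.
  rewrite ln_Rinv, Rabs_mult, Rabs_Ropp, (Rabs_right (ln t)) by lra.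
  assert (L1 : ln p <= ln (INR M)) by (apply ln_le; lra).
  rewrite (Rabs_right (ln (INR M) - ln p)) by lra.
  assert (L2 := ln_le_sub_1 (INR M / p) ltac:(apply Rdiv_lt_0_compat; lra)).
  rewrite ln_div in L2 by lra.
  assert (L3 : INR M / p - 1 <= INR M - p).
  { apply Rmult_le_reg_r with p; [lra|].
    replace ((INR M / p - 1) * p) with (INR M - p) by (field; lra). nra. }
  replace (INR M * INR M * (ln t / t)) with (ln t * (INR M * INR M * / t)) by (field; lra).
  apply Rmult_le_compat_l; lra.
Qed.

(** The passage [r -> 1] is by dominated convergence on the series side. On the other side all roots
    but 1 are harmless, and the divergent part of the root 1 cancels. *)
Theorem is_series_rho_term (M : nat) :
  is_series (rho_term (S M))
    (psum (fun j => log_quad (root_angle (S M) (S j)) 1 ^ 2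
                    - atan_quad (root_angle (S M) (S j)) 1 ^ 2) M + ln (INR (S M)) ^ 2).
Proof.
  set (w := fun j r => log_quad (root_angle (S M) j) r ^ 2 - atan_quad (root_angle (S M) j) r ^ 2).
  set (s := fun i => psum (fun j => w j (near_one i)) (S M) - ln (1 - near_one i ^ S M) ^ 2
     + 2 * ln (INR (S M)) * ln (1 - near_one i ^ S M)).
  destruct (tannery (fun i m => rho_term (S M) m * (near_one i ^ S M) ^ S m) (rho_term (S M))
    (fun m => 4 * / INR (S m) ^ 2) s) as [Hex Hlim].
  - intros i m. pose proof (pow_M_bounds (S M) _ ltac:(lia) (near_one_bounds i)) as Hq.
    rewrite Rabs_mult. eapply Rle_trans; [|apply (rho_term_bound (S M) m); lia].
    rewrite <- Rmult_1_r. apply Rmult_le_compat_l; [apply Rabs_pos|].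
    rewrite <- RPow_abs, <- (pow1 (S m)). apply pow_incr.
    rewrite Rabs_right; lra.
  - apply (ex_series_scal 4 (fun m => / INR (S m) ^ 2)), ex_series_inv_sq.
  - intros i. apply is_series_rho_term_pow; [lia|apply near_one_bounds].
  - intros m. replace (Finite (rho_term (S M) m)) with (Finite (rho_term (S M) m * 1))
      by (f_equal; ring).
    apply (is_lim_seq_scal_l _ (rho_term (S M) m) 1).
    assert (P : forall (u : nat -> R) k, is_lim_seq u 1 -> is_lim_seq (fun i => u i ^ k) 1).
    { intros u k Hu. induction k as [|k IH]; [apply is_lim_seq_const|].
      replace (Finite 1) with (Finite (1 * 1)) by (f_equal; ring).
      simpl. now apply is_lim_seq_mult'. }
    apply P, P, is_lim_seq_near_one.
  - replace (psum _ M + ln (INR (S M)) ^ 2) with (Series (rho_term (S M)));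
      [now apply Series_correct|].
    apply (is_lim_seq_eq s); [exact Hlim|].
    (* With [L = ln (1 - r)] and [G = ln (geom M r)], the term of the root 1 together with the
       corrections is [L^2 - (L + G)^2 + 2 ln M (L + G)], that is [2 L (ln M - G) + 2 ln M G - G^2],
       which tends to [ln^2 M]. *)
    apply is_lim_seq_ext with (fun i => psum (fun j => w (S j) (near_one i)) M
      + (2 * (ln (1 - near_one i) * (ln (INR (S M)) - ln (geom (S M) (near_one i))))
         + (2 * ln (INR (S M)) * ln (geom (S M) (near_one i))
            - ln (geom (S M) (near_one i)) * ln (geom (S M) (near_one i))))).
    { intros i. unfold s. rewrite psum_Sl. unfold w at 2.
      pose proof (near_one_bounds i) as Hr.
      rewrite root_angle_0, log_quad_0, atan_quad_0, ln_one_sub_pow by (lia || easy). ring. }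
    assert (Lg : is_lim_seq (fun i => ln (geom (S M) (near_one i))) (ln (INR (S M)))).
    { eapply (is_lim_seq_derive ln); [|apply is_lim_seq_geom].
      apply is_derive_Reals, derivable_pt_lim_ln, INR_S_pos. }
    apply is_lim_seq_plus'.
    + cut (forall N, (N <= M)%nat ->
        is_lim_seq (fun i => psum (fun j => w (S j) (near_one i)) N)
        (psum (fun j => w (S j) 1) N)); [intros C; now apply C|].
      intros N. induction N as [|N IH]; intros HN; [apply is_lim_seq_const|].
      cbn [psum]. apply is_lim_seq_plus'; [apply IH; lia|].
      assert (Hb : 0 < root_angle (S M) (S N) < 2 * PI) by (apply root_angle_bounds; lia).
      unfold w. simpl pow.
      apply is_lim_seq_minus'.
      * apply is_lim_seq_mult'; [now apply is_lim_seq_log_quad|].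
        apply is_lim_seq_mult'; [now apply is_lim_seq_log_quad|apply is_lim_seq_const].
      * apply is_lim_seq_mult'; [now apply is_lim_seq_atan_quad|].
        apply is_lim_seq_mult'; [now apply is_lim_seq_atan_quad|apply is_lim_seq_const].
    + replace (Finite (ln (INR (S M)) ^ 2))
        with (Finite (2 * 0 + (2 * ln (INR (S M)) * ln (INR (S M)) - ln (INR (S M)) * ln (INR (S M)))))
        by (f_equal; ring).
      apply is_lim_seq_plus'.
      * apply (is_lim_seq_scal_l _ 2 0). apply is_lim_seq_ln_correction. lia.
      * apply is_lim_seq_minus'; [|now apply is_lim_seq_mult'].
        apply (is_lim_seq_scal_l _ (2 * ln (INR (S M))) (ln (INR (S M)))), Lg.
Qed.

(** * The trapezoidal rule and the sinc factor *)


(** Extension by 0 to the left of 0. It turns the removable singularity at 0 into an interior point,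
    so that two-sided derivatives, integration and uniform continuity on [[0, b]] become
    available. *)
Definition pos_part (h : R -> R) (y : R) : R := if Rle_dec y 0 then 0 else h y.

Lemma pos_part_pos (h : R -> R) (y : R) : 0 < y -> pos_part h y = h y.
Proof. intros Hy. unfold pos_part. destruct (Rle_dec y 0); [lra|easy]. Qed.

Lemma pos_part_nonpos (h : R -> R) (y : R) : y <= 0 -> pos_part h y = 0.
Proof. intros Hy. unfold pos_part. destruct (Rle_dec y 0); [easy|lra]. Qed.

Lemma locally_pos_part_pos (h : R -> R) (y : R) :
  0 < y -> locally y (fun t => h t = pos_part h t).
Proof.
  intros Hy. exists (mkposreal y Hy). intros t Ht.
  rewrite pos_part_pos; [easy|]. apply Rabs_def2 in Ht.
  unfold minus, plus, opp in Ht. simpl in Ht. lra.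
Qed.

Lemma locally_pos_part_neg (h : R -> R) (y : R) :
  y < 0 -> locally y (fun t => 0 = pos_part h t).
Proof.
  intros Hy. assert (Hy' : 0 < - y) by lra. exists (mkposreal (- y) Hy'). intros t Ht.
  rewrite pos_part_nonpos; [easy|]. apply Rabs_def2 in Ht.
  unfold minus, plus, opp in Ht. simpl in Ht. lra.
Qed.

Lemma small_sqrt (K e d : R) :
  0 <= K -> 0 < e -> 0 < d -> exists t, 0 < t <= d /\ forall y, 0 <= y < t -> K * sqrt y < e.
Proof.
  intros HK He Hd. set (q := e / (K + 1)).
  assert (Hq : 0 < q) by (apply Rdiv_lt_0_compat; lra).
  exists (Rmin d (q ^ 2)). assert (0 < q ^ 2) by (apply pow_lt; lra).
  split; [split; [apply Rmin_glb_lt; lra|apply Rmin_l]|].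
  intros y Hy. pose proof (Rmin_r d (q ^ 2)).
  assert (S1 : sqrt y < q).
  { rewrite <- (sqrt_pow2 q) by lra. apply sqrt_lt_1_alt. lra. }
  pose proof (sqrt_pos y).
  assert (q * (K + 1) = e) by (unfold q; field; lra). nra.
Qed.

Lemma trapezoid_rule (h h' : R -> R) (b c d K : R) :
  0 < b < c -> 0 < d -> 0 <= K ->
  (forall y, 0 < y < c -> is_derive h y (h' y)) ->
  (forall y, 0 < y < c -> continuous h' y) ->
  (forall y, 0 < y <= d -> Rabs (h y) <= K * sqrt y * y /\ Rabs (h' y) <= K * sqrt y) ->
  exists alpha : R,
    is_lim_seq (fun n => psum (fun j => h (b * INR (S j) / INR (S n))) (S n) - h b / 2
                         - alpha * INR (S n)) 0.
Proof.
  intros Hb Hd HK Hder Hcont Hsmall.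
  set (H := pos_part h). set (H' := pos_part h').
  assert (DH : forall y, y < c -> is_derive H y (H' y)).
  { intros y Hy. destruct (Rtotal_order y 0) as [Hn|[Hz|Hp]].
    - unfold H'. rewrite pos_part_nonpos by lra.
      apply (is_derive_ext_loc (fun _ => 0)); [now apply locally_pos_part_neg|].
      apply (is_derive_const 0).
    - subst y. unfold H'. rewrite pos_part_nonpos by lra.
      apply is_derive_Reals. intros e He.
      destruct (small_sqrt K e d HK He Hd) as [t [Ht Hs]].
      exists (mkposreal t (proj1 Ht)). intros u Hu Hut. simpl in Hut.
      unfold H. rewrite (pos_part_nonpos h 0), Rplus_0_l by lra.
      destruct (Rle_lt_dec u 0) as [Hu0|Hu0].
      + rewrite pos_part_nonpos by lra.
        replace ((0 - 0) / u - 0) with 0 by (unfold Rdiv; ring). now rewrite Rabs_R0.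
      + rewrite pos_part_pos by lra. rewrite Rabs_right in Hut by lra.
        destruct (Hsmall u ltac:(lra)) as [B _]. specialize (Hs u ltac:(lra)).
        rewrite !Rminus_0_r. unfold Rdiv. rewrite Rabs_mult, (Rabs_right (/ u)).
        2:{ left. now apply Rinv_0_lt_compat. }
        apply Rle_lt_trans with (K * sqrt u * u * / u).
        * apply Rmult_le_compat_r; [left; now apply Rinv_0_lt_compat|easy].
        * rewrite Rmult_assoc, Rinv_r by lra. lra.
    - unfold H'. rewrite pos_part_pos by lra.
      apply (is_derive_ext_loc h); [now apply locally_pos_part_pos|]. apply Hder. lra. }
  assert (CH' : forall y, 0 <= y <= b -> continuity_pt H' y).
  { intros y Hy. apply continuity_pt_filterlim. destruct (Req_dec y 0) as [->|Hy0].
    - apply filterlim_locally. intros e.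
      destruct (small_sqrt K e d HK (cond_pos e) Hd) as [t [Ht Hs]].
      exists (mkposreal t (proj1 Ht)). intros u Hu.
      unfold H'. rewrite (pos_part_nonpos h' 0) by lra.
      change (Rabs (u - 0) < t) in Hu. rewrite Rminus_0_r in Hu.
      change (Rabs (pos_part h' u - 0) < e). rewrite Rminus_0_r.
      destruct (Rle_lt_dec u 0) as [Hu0|Hu0].
      + rewrite pos_part_nonpos, Rabs_R0 by lra. apply cond_pos.
      + rewrite pos_part_pos by lra. rewrite Rabs_right in Hu by lra.
        destruct (Hsmall u ltac:(lra)) as [_ B]. specialize (Hs u ltac:(lra)). lra.
    - apply (continuous_ext_loc H' h').
      + apply locally_pos_part_pos. lra.
      + apply Hcont. lra. }
  assert (CH : forall y, y < c -> continuous H y).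
  { intros y Hy. apply (ex_derive_continuous (K := R_AbsRing) (V := R_NormedModule)).
    exists (H' y). now apply DH. }
  set (W := fun x => RInt H 0 x).
  assert (DW : forall y, 0 <= y <= b -> is_derive W y (H y)).
  { intros y Hy. apply (is_derive_RInt H W 0 y).
    - assert (Hc : 0 < c - y) by lra. exists (mkposreal (c - y) Hc). intros z Hz.
      change (Rabs (z - y) < c - y) in Hz. apply Rabs_def2 in Hz.
      apply (RInt_correct (V := R_CompleteNormedModule)).
      apply (ex_RInt_continuous (V := R_CompleteNormedModule)).
      intros t Ht. apply CH. pose proof (Rmax_lub 0 z (Rmax 0 z)).
      unfold Rmax in Ht. destruct (Rle_dec 0 z); lra.
    - apply CH. lra. }
  assert (W0 : W 0 = 0).
  { unfold W. apply (RInt_point (V := R_CompleteNormedModule)). }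
  exists (W b / b). apply is_lim_seq_eps. intros e He.
  assert (He' : 0 < e / b) by (apply Rdiv_lt_0_compat; lra).
  destruct (@Heine_cor1 H' 0 b ltac:(lra) CH' (mkposreal _ He')) as [delta [_ Hu]].
  simpl in Hu.
  assert (Lh : is_lim_seq (fun n => b * / INR (S n)) 0)
    by apply is_lim_seq_scal_0, is_lim_seq_inv_S.
  destruct (proj1 (is_lim_seq_eps _ _) Lh delta (cond_pos delta)) as [N HN].
  exists N. intros n Hn. specialize (HN n Hn). rewrite Rminus_0_r in *.
  pose proof (INR_S_pos n) as Hx. set (x := INR (S n)) in *.
  assert (Hh : 0 < b * / x) by (apply Rmult_lt_0_compat; [lra|now apply Rinv_0_lt_compat]).
  rewrite Rabs_right in HN by lra. set (q := b * / x) in *.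
  assert (Hnode : forall j, (j <= S n)%nat -> 0 <= q * INR j <= b).
  { intros j Hj. split; [apply Rmult_le_pos; [lra|apply pos_INR]|].
    apply le_INR in Hj. fold x in Hj. replace b with (q * x) by (unfold q; field; lra).
    apply Rmult_le_compat_l; lra. }
  assert (Cell : forall j, (j < S n)%nat ->
    Rabs (q / 2 * (H (q * INR j) + H (q * INR (S j))) - (W (q * INR (S j)) - W (q * INR j)))
    <= q ^ 2 / 2 * (e / b)).
  { intros j Hj. pose proof (Hnode j ltac:(lia)) as N1. pose proof (Hnode (S j) ltac:(lia)) as N2.
    replace (q * INR (S j)) with (q * INR j + q) in * by (rewrite S_INR; ring).
    apply (trapezoid_cell W H H'); [lra| | |].
    - intros y Hy. apply DW. lra.
    - intros y Hy. apply DH. lra.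
    - intros y z Hy Hz. left. apply Hu; [lra|lra|]. apply Rabs_def1; lra. }
  assert (Sum : Rabs (q * (psum (fun j => h (b * INR (S j) / x)) (S n) - h b / 2) - W b)
                <= INR (S n) * (q ^ 2 / 2 * (e / b))).
  { rewrite <- psum_const.
    replace (q * (psum (fun j => h (b * INR (S j) / x)) (S n) - h b / 2) - W b)
      with (psum (fun j => q / 2 * (H (q * INR j) + H (q * INR (S j)))
                           - (W (q * INR (S j)) - W (q * INR j))) (S n)).
    - eapply Rle_trans; [apply psum_Rabs|]. apply psum_le. exact Cell.
    - rewrite psum_minus, (psum_telescope (fun j => W (q * INR j))).
      rewrite (psum_ext _ (fun j => q * H (q * INR (S j))
        + - (q / 2) * (H (q * INR (S j)) - H (q * INR j)))) by (intros; field).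
      rewrite psum_plus, !psum_scal, (psum_telescope (fun j => H (q * INR j))).
      replace (q * INR (S n)) with b by (unfold q, x; field; apply not_0_INR; lia).
      simpl (INR 0). rewrite Rmult_0_r, W0.
      unfold H at 2 3. rewrite (pos_part_nonpos h 0), (pos_part_pos h b) by lra.
      rewrite (psum_ext (fun j => H (q * INR (S j))) (fun j => h (b * INR (S j) / x))).
      + field.
      + intros k _. unfold H. rewrite pos_part_pos.
        * f_equal. unfold q. field. lra.
        * apply Rmult_lt_0_compat; [lra|apply INR_S_pos]. }
  fold x in Sum.
  set (T := psum (fun j => h (b * INR (S j) / x)) (S n) - h b / 2) in *.
  replace (T - W b / b * x) with ((q * T - W b) * / q) by (unfold q; field; lra).
  assert (Hq : 0 < / q) by now apply Rinv_0_lt_compat.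
  rewrite Rabs_mult, (Rabs_right (/ q)) by lra.
  apply Rle_lt_trans with (x * (q ^ 2 / 2 * (e / b)) * / q).
  - apply Rmult_le_compat_r; lra.
  - replace (x * (q ^ 2 / 2 * (e / b)) * / q) with (e / 2) by (unfold q; field; lra). lra.
Qed.

Definition log_sinc (y : R) : R := ln (sin y / y).
Definition log_sinc' (y : R) : R := cos y / sin y - / y.
(** For [0 < y < PI] this is [ln^2 (2 sin y) - ln^2 (2 y)], of order [y^2 ln y] at 0. *)
Definition sinc_cross (y : R) : R := 2 * ln (2 * y) * log_sinc y + log_sinc y ^ 2.
Definition sinc_cross' (y : R) : R :=
  2 / y * log_sinc y + 2 * ln (2 * y) * log_sinc' y + 2 * log_sinc y * log_sinc' y.

Lemma sin_cos_small (y : R) :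
  0 <= y -> Rabs (sin y) <= y /\ Rabs (cos y - 1) <= y ^ 2 / 2 /\ Rabs (sin y - y) <= y ^ 3 / 6.
Proof.
  assert (H1 : forall t, 0 <= t -> Rabs (sin t) <= t).
  { intros t Ht. assert (D := derive_dominated sin (fun x => x) cos (fun _ => 1) 0 t Ht).
    rewrite sin_0, !Rminus_0_r in D. apply D.
    - intros x _. auto_derive; [easy|ring].
    - intros x _. auto_derive; [easy|ring].
    - intros x _. apply Rabs_le. apply COS_bound. }
  assert (H2 : forall t, 0 <= t -> Rabs (cos t - 1) <= t ^ 2 / 2).
  { intros t Ht.
    assert (D := derive_dominated cos (fun x => x ^ 2 / 2) (fun x => - sin x) (fun x => x) 0 t Ht).
    rewrite cos_0 in D. replace (t ^ 2 / 2) with (t ^ 2 / 2 - 0 ^ 2 / 2) by field. apply D.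
    - intros x _. auto_derive; [easy|ring].
    - intros x _. auto_derive; [easy|field].
    - intros x Hx. rewrite Rabs_Ropp. apply H1. lra. }
  intros Hy. repeat split; [now apply H1|now apply H2|].
  assert (D := derive_dominated (fun x => sin x - x) (fun x => x ^ 3 / 6) (fun x => cos x - 1)
                 (fun x => x ^ 2 / 2) 0 y Hy).
  cbv beta in D. rewrite sin_0 in D. replace (y ^ 3 / 6) with (y ^ 3 / 6 - 0 ^ 3 / 6) by field.
  replace (sin y - y) with (sin y - y - (0 - 0)) by ring. apply D.
  - intros x _. auto_derive; [easy|ring].
  - intros x _. auto_derive; [easy|field].
  - intros x Hx. apply H2. lra.
Qed.

Lemma log_sinc_small (y : R) :
  0 < y <= / 2 -> Rabs (log_sinc y) <= y ^ 2 /\ Rabs (log_sinc' y) <= y.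
Proof.
  intros Hy. destruct (sin_cos_small y ltac:(lra)) as [B1 [B2 B3]].
  apply Rabs_le_between in B1. apply Rabs_le_between in B2. apply Rabs_le_between in B3.
  assert (Y2 : 0 < y ^ 2 <= / 4) by (split; [apply pow_lt; lra|simpl; nra]).
  assert (Y3 : y ^ 3 = y ^ 2 * y) by ring.
  assert (Sb : y * (1 - y ^ 2 / 6) <= sin y) by nra.
  set (u := sin y / y).
  assert (U : 1 - y ^ 2 / 6 <= u <= 1).
  { unfold u. split; apply Rmult_le_reg_r with y; try lra;
      replace (sin y / y * y) with (sin y) by (field; lra); lra. }
  split.
  - unfold log_sinc. fold u.
    assert (L1 := ln_le_sub_1 u ltac:(lra)).
    assert (L2 := ln_le_sub_1 (/ u) ltac:(apply Rinv_0_lt_compat; lra)).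
    rewrite ln_Rinv in L2 by lra.
    assert (/ u <= 1 + y ^ 2).
    { apply Rmult_le_reg_r with u; [lra|]. rewrite Rinv_l by lra. nra. }
    apply Rabs_le. lra.
  - unfold log_sinc'.
    assert (Sp : 2 / 3 * y <= sin y) by nra.
    replace (cos y / sin y - / y) with ((y * (cos y - 1) - (sin y - y)) * / (y * sin y))
      by (field; lra).
    assert (P : 0 < y * sin y) by (apply Rmult_lt_0_compat; lra).
    rewrite Rabs_mult, (Rabs_right (/ _)) by (left; now apply Rinv_0_lt_compat).
    apply Rmult_le_reg_r with (y * sin y); [easy|].
    rewrite Rmult_assoc, Rinv_l, Rmult_1_r by lra.
    apply Rle_trans with (2 / 3 * y ^ 3); [apply Rabs_le; nra|].
    replace (2 / 3 * y ^ 3) with (y * (y * (2 / 3 * y))) by ring.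
    repeat apply Rmult_le_compat_l; lra.
Qed.

Lemma sqrt_small (y : R) :
  0 < y <= / 2 ->
  0 < sqrt y /\ sqrt y * sqrt y = y /\ y <= sqrt y /\ Rabs (ln (2 * y)) * sqrt y <= 2.
Proof.
  intros Hy. assert (S0 : 0 < sqrt y) by (apply sqrt_lt_R0; lra).
  assert (SS : sqrt y * sqrt y = y) by (apply sqrt_sqrt; lra).
  assert (S1 : sqrt y <= 1) by (apply Rnot_lt_le; intros C; nra).
  repeat split; [easy|easy|nra|].
  assert (L : - ln (2 * y) <= 2 * / sqrt y).
  { assert (A := ln_le_sub_1 (/ sqrt y) ltac:(now apply Rinv_0_lt_compat)).
    rewrite ln_Rinv in A by easy.
    assert (E : ln y = 2 * ln (sqrt y)).
    { rewrite <- SS at 1. rewrite ln_mult by easy. ring. }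
    rewrite ln_mult by lra. pose proof (ln_nonneg 2 ltac:(lra)). lra. }
  assert (L0 : ln (2 * y) <= 0).
  { rewrite <- ln_1. apply ln_le; lra. }
  rewrite Rabs_left1 by easy.
  replace 2 with (2 * / sqrt y * sqrt y) at 2 by (field; lra).
  apply Rmult_le_compat_r; lra.
Qed.

Lemma is_derive_log_sinc (y : R) : 0 < y < PI -> is_derive log_sinc y (log_sinc' y).
Proof.
  intros Hy. assert (Hs : 0 < sin y) by (apply sin_gt_0; lra).
  unfold log_sinc, log_sinc'. auto_derive.
  - split; [lra|]. split; [|easy]. apply Rmult_lt_0_compat; [easy|apply Rinv_0_lt_compat; lra].
  - field. lra.
Qed.

Lemma continuous_log_sinc' (y : R) : 0 < y < PI -> continuous log_sinc' y.
Proof.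
  intros Hy. assert (Hs : 0 < sin y) by (apply sin_gt_0; lra).
  apply (ex_derive_continuous (K := R_AbsRing) (V := R_NormedModule)).
  unfold log_sinc'. auto_derive. repeat split; lra.
Qed.

Lemma is_derive_sinc_cross (y : R) : 0 < y < PI -> is_derive sinc_cross y (sinc_cross' y).
Proof.
  intros Hy. pose proof (is_derive_log_sinc y Hy) as D.
  unfold sinc_cross, sinc_cross'. auto_derive.
  - repeat split; [lra|now exists (log_sinc' y)|now exists (log_sinc' y)].
  - apply is_derive_unique in D.
    change (Derive log_sinc y) with (Derive (fun x : R => log_sinc x) y) in D.
    rewrite D. field. lra.
Qed.

Lemma continuous_sinc_cross' (y : R) : 0 < y < PI -> continuous sinc_cross' y.
Proof.
  intros Hy. assert (Hs : 0 < sin y) by (apply sin_gt_0; lra).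
  apply (ex_derive_continuous (K := R_AbsRing) (V := R_NormedModule)).
  unfold sinc_cross', log_sinc, log_sinc'. auto_derive.
  assert (0 < sin y * / y) by (apply Rmult_lt_0_compat; [easy|apply Rinv_0_lt_compat; lra]).
  repeat split; lra.
Qed.

Lemma trapezoid_log_sinc :
  exists alpha : R,
    is_lim_seq (fun n => psum (fun j => log_sinc (PI / 2 * INR (S j) / INR (S n))) (S n)
                         - log_sinc (PI / 2) / 2 - alpha * INR (S n)) 0.
Proof.
  pose proof PI_RGT_0.
  apply (trapezoid_rule log_sinc log_sinc' (PI / 2) PI (/ 2) 1); [lra|lra|lra| | |].
  - apply is_derive_log_sinc.
  - apply continuous_log_sinc'.
  - intros y Hy. destruct (log_sinc_small y Hy) as [A B].
    destruct (sqrt_small y Hy) as [S0 [SS [S1 _]]]. split; [|lra].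
    eapply Rle_trans; [exact A|]. simpl. nra.
Qed.

Lemma trapezoid_sinc_cross :
  exists alpha : R,
    is_lim_seq (fun n => psum (fun j => sinc_cross (PI / 2 * INR (S j) / INR (S n))) (S n)
                         - sinc_cross (PI / 2) / 2 - alpha * INR (S n)) 0.
Proof.
  pose proof PI_RGT_0.
  (* The constant 8 comes from the derivative: its three terms are at most [2 y], [4 sqrt y] and
     [2 y], with [y <= sqrt y]. *)
  apply (trapezoid_rule sinc_cross sinc_cross' (PI / 2) PI (/ 2) 8); [lra|lra|lra| | |].
  - apply is_derive_sinc_cross.
  - apply continuous_sinc_cross'.
  - intros y Hy. destruct (log_sinc_small y Hy) as [A B].
    destruct (sqrt_small y Hy) as [S0 [SS [S1 S2]]].
    unfold sinc_cross, sinc_cross'.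
    set (l := log_sinc y) in *. set (l' := log_sinc' y) in *. set (L := ln (2 * y)) in *.
    set (s := sqrt y) in *.
    pose proof (Rabs_pos l) as P1. pose proof (Rabs_pos l') as P2. pose proof (Rabs_pos L) as P3.
    assert (E1 : Rabs L * y <= 2 * s) by (rewrite <- SS; nra).
    split.
    + eapply Rle_trans; [apply Rabs_triang|].
      rewrite !Rabs_mult, <- RPow_abs, (Rabs_right 2) by lra.
      assert (Rabs L * Rabs l <= 2 * s * y).
      { apply Rle_trans with (Rabs L * y ^ 2); [apply Rmult_le_compat_l; lra|].
        replace (Rabs L * y ^ 2) with (Rabs L * y * y) by ring.
        apply Rmult_le_compat_r; lra. }
      assert (Rabs l ^ 2 <= y * y).
      { simpl. rewrite Rmult_1_r. apply Rmult_le_compat; try lra; simpl in A; nra. }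
      nra.
    + eapply Rle_trans; [apply Rabs_triang|].
      eapply Rle_trans; [apply Rplus_le_compat_r, Rabs_triang|].
      unfold Rdiv. rewrite !Rabs_mult, (Rabs_right 2), (Rabs_right (/ y)) by
        (try lra; left; apply Rinv_0_lt_compat; lra).
      assert (2 * / y * Rabs l <= 2 * y).
      { apply Rmult_le_reg_r with y; [lra|].
        replace (2 * / y * Rabs l * y) with (2 * Rabs l) by (field; lra). simpl in A. nra. }
      assert (Rabs L * Rabs l' <= 2 * s).
      { apply Rle_trans with (Rabs L * y); [apply Rmult_le_compat_l; lra|easy]. }
      assert (Rabs l * Rabs l' <= y * 1).
      { apply Rmult_le_compat; try lra. simpl in A. nra. }
      lra.
Qed.

(** * Evaluation of the constants *)


Definition sum_ln (n : nat) : R := psum (fun k => ln (INR (S k))) n.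
Definition sum_ln_sq (n : nat) : R := psum (fun k => ln (INR (S k)) ^ 2) n.
Definition sum_ln_div (n : nat) : R := psum (fun k => ln (INR (S k)) / INR (S k)) n.

Definition ln_remainder (s : R) (n : nat) : R :=
  let x := INR (S n) in sum_ln (S n) - (x * ln x - x + ln x / 2 + s).
Definition ln_sq_remainder (s : R) (n : nat) : R :=
  let x := INR (S n) in
  sum_ln_sq (S n) - (x * ln x ^ 2 - 2 * x * ln x + 2 * x + ln x ^ 2 / 2 + s).
Definition ln_div_remainder (s : R) (n : nat) : R :=
  let x := INR (S n) in sum_ln_div (S n) - (ln x ^ 2 / 2 + ln x / x / 2 + s).

Lemma inv_pow_bound (K L y : R) (n : nat) :
  1 <= y -> Rabs K <= L -> Rabs (K / y ^ (2 + n)) <= L / y ^ 2.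
Proof.
  intros Hy HK. assert (0 < y ^ 2) by (apply pow_lt; lra).
  assert (I : 0 < / y ^ (2 + n) <= / y ^ 2).
  { split; [apply Rinv_0_lt_compat, pow_lt; lra|].
    apply Rinv_le_contravar; [easy|]. apply Rle_pow; [lra|lia]. }
  unfold Rdiv. rewrite Rabs_mult, (Rabs_right (/ y ^ (2 + n))) by lra.
  pose proof (Rabs_pos K). apply Rmult_le_compat; lra.
Qed.

Lemma sum_ln_asymptotic :
  exists s, forall n, Rabs (ln_remainder s n) <= lntail (INR (S n)).
Proof.
  destruct (euler_maclaurin_constant (fun x => x * ln x - x) ln Rinv (fun x => - / x ^ 2) 1)
    as [s Hs].
  - intros y Hy. auto_derive; [lra|field; lra].
  - intros y Hy. apply is_derive_Reals, derivable_pt_lim_ln. lra.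
  - intros y Hy. auto_derive; [lra|field; lra].
  - intros y Hy. pose proof (ln_nonneg y Hy).
    replace (- / y ^ 2) with ((-1) / y ^ (2 + 0)) by (simpl; field; lra).
    apply inv_pow_bound; [easy|]. rewrite Rabs_m1. lra.
  - exists s. intros n. specialize (Hs n). rewrite Rmult_1_l in Hs.
    eapply Rle_trans; [right|exact Hs]. f_equal. unfold ln_remainder, sum_ln. ring.
Qed.

Lemma sum_ln_sq_asymptotic :
  exists s, forall n, Rabs (ln_sq_remainder s n) <= 2 * lntail (INR (S n)).
Proof.
  destruct (euler_maclaurin_constant (fun x => x * ln x ^ 2 - 2 * x * ln x + 2 * x)
    (fun x => ln x ^ 2) (fun x => 2 * ln x / x) (fun x => (2 - 2 * ln x) / x ^ 2) 2) as [s Hs].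
  - intros y Hy. auto_derive; [lra|field; lra].
  - intros y Hy. auto_derive; [lra|field; lra].
  - intros y Hy. auto_derive; [lra|field; lra].
  - intros y Hy. pose proof (ln_nonneg y Hy).
    apply (inv_pow_bound _ _ _ 0); [easy|]. apply Rabs_le. lra.
  - exists s. intros n. eapply Rle_trans; [right|apply Hs]. f_equal.
    unfold ln_sq_remainder, sum_ln_sq. field.
Qed.

Lemma sum_ln_div_asymptotic :
  exists s, forall n, Rabs (ln_div_remainder s n) <= 3 * lntail (INR (S n)).
Proof.
  destruct (euler_maclaurin_constant (fun x => ln x ^ 2 / 2)
    (fun x => ln x / x) (fun x => (1 - ln x) / x ^ 2) (fun x => (2 * ln x - 3) / x ^ 3) 3)
    as [s Hs].
  - intros y Hy. auto_derive; [lra|field; lra].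
  - intros y Hy. auto_derive; [lra|field; lra].
  - intros y Hy. auto_derive; [simpl; nra|field; lra].
  - intros y Hy. pose proof (ln_nonneg y Hy).
    apply (inv_pow_bound _ _ _ 1); [easy|]. apply Rabs_le. lra.
  - exists s. intros n. eapply Rle_trans; [right|apply Hs]. f_equal.
    unfold ln_div_remainder, sum_ln_div. field. apply not_0_INR. lia.
Qed.

Lemma is_lim_seq_remainder (u : nat -> R) (K : R) :
  (forall n, Rabs (u n) <= K * lntail (INR (S n))) -> is_lim_seq u 0.
Proof.
  intros H. apply is_lim_seq_0_le with (v := fun n => K * lntail (INR (S n))) (N := 0%nat).
  - intros n _. apply H.
  - apply is_lim_seq_scal_0, is_lim_seq_lntail.
Qed.

(** [ln^2 x / x] is 4 times the square of [ln t / t] at [t = sqrt x]. *)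
Lemma is_lim_seq_ln_sq_over_S : is_lim_seq (fun n => ln (INR (S n)) ^ 2 / INR (S n)) 0.
Proof.
  assert (L : is_lim_seq (fun n => ln (sqrt (INR (S n))) / sqrt (INR (S n))) 0).
  { apply (is_lim_comp_seq (fun y => ln y / y) (fun n => sqrt (INR (S n))) p_infty 0).
    - apply is_lim_div_ln_p.
    - exists 0%nat. intros n _. easy.
    - apply (is_lim_seq_incr_1 (fun n => sqrt (INR n))).
      apply (is_lim_comp_seq sqrt INR p_infty p_infty).
      + exact filterlim_sqrt_p.
      + exists 0%nat. intros n _. easy.
      + apply is_lim_seq_INR. }
  apply is_lim_seq_ext with
    (fun n => 4 * ((ln (sqrt (INR (S n))) / sqrt (INR (S n))) * (ln (sqrt (INR (S n))) / sqrt (INR (S n))))).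
  - intros n. pose proof (INR_S_pos n) as Hx. set (x := INR (S n)) in *.
    assert (S0 : 0 < sqrt x) by now apply sqrt_lt_R0.
    assert (SS : sqrt x * sqrt x = x) by (apply sqrt_sqrt; lra).
    assert (E : ln x = 2 * ln (sqrt x)).
    { rewrite <- SS at 1. rewrite ln_mult by easy. ring. }
    rewrite E. apply Rmult_eq_reg_r with x; [|lra].
    replace ((2 * ln (sqrt x)) ^ 2 / x * x) with ((2 * ln (sqrt x)) ^ 2) by (field; lra).
    rewrite <- SS at 5. field. lra.
  - apply is_lim_seq_scal_0. replace (Finite 0) with (Finite (0 * 0)) by (f_equal; ring).
    now apply is_lim_seq_mult'.
Qed.

(** Squaring [ln PI + ln j - ln n] produces [ln n] times the sum of [ln j]; mere convergence to 0 of
    Stirling's remainder would not control that product. *)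
Lemma is_lim_seq_ln_mult_remainder (u : nat -> R) (K : R) :
  (forall n, Rabs (u n) <= K * lntail (INR (S n))) ->
  is_lim_seq (fun n => ln (INR (S n)) * u n) 0.
Proof.
  intros H. apply is_lim_seq_0_le with (N := 0%nat)
    (v := fun n => K * (3 * (ln (INR (S n)) / INR (S n)) + ln (INR (S n)) ^ 2 / INR (S n))).
  - intros n _. specialize (H n). pose proof (INR_S_ge_1 n) as Hx.
    set (x := INR (S n)) in *. pose proof (ln_nonneg x Hx) as L.
    rewrite Rabs_mult, (Rabs_right (ln x)) by lra.
    replace (K * (3 * (ln x / x) + ln x ^ 2 / x)) with (ln x * (K * lntail x))
      by (unfold lntail; field; lra).
    apply Rmult_le_compat_l; lra.
  - apply is_lim_seq_scal_0. replace (Finite 0) with (Finite (3 * 0 + 0)) by (f_equal; ring).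
    apply is_lim_seq_plus'; [|apply is_lim_seq_ln_sq_over_S].
    apply (is_lim_seq_scal_l _ 3 0), is_lim_seq_ln_over_S.
Qed.

Lemma affine_limit_0 (A B c : R) :
  is_lim_seq (fun n => A + B * INR (S n)) c -> A = c.
Proof.
  intros H.
  assert (HB : B = 0).
  { apply (is_lim_seq_eq (fun n => (A + B * INR (S (S n))) - (A + B * INR (S n)))).
    - apply is_lim_seq_ext with (fun _ => B); [|apply is_lim_seq_const].
      intros n. rewrite (S_INR (S n)). ring.
    - replace (Finite 0) with (Finite (c - c)) by (f_equal; ring).
      apply is_lim_seq_minus'; [|exact H].
      now apply (is_lim_seq_incr_1 (fun n => A + B * INR (S n))) in H. }
  apply (is_lim_seq_eq (fun n => A + B * INR (S n))); [|exact H].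
  apply is_lim_seq_ext with (fun _ => A); [|apply is_lim_seq_const].
  intros n. rewrite HB. ring.
Qed.

(** Folds the sum over [0 < j < 2 N], with [N = n + 1], about its centre, which is counted once.
    Restricting to an even number of roots makes the centre a node, so that the folded nodes fill
    [(0, PI/2]] and end exactly at [PI/2]. *)
Lemma psum_symmetric (f : nat -> R) (n : nat) :
  (forall j, (0 < j <= n)%nat -> f (2 * S n - j)%nat = f j) ->
  psum (fun j => f (S j)) (2 * n + 1) = 2 * psum (fun j => f (S j)) (S n) - f (S n).
Proof.
  intros H. replace (2 * n + 1)%nat with (S n + n)%nat by lia.
  rewrite psum_add.
  rewrite (psum_ext (fun k => f (S (S n + k))) (fun k => f (S (n - 1 - k)))).
  - rewrite (psum_rev (fun k => f (S k))). cbn [psum]. ring.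
  - intros k Hk. replace (S (S n + k)) with (2 * S n - S (n - 1 - k))%nat by lia. apply H. lia.
Qed.

(* The angle [2 PI j / (2 N)] is twice the node [PI/2 * j / N] of the trapezoidal rule. *)
Definition half_node (n j : nat) : R := PI / 2 * INR j / INR (S n).

Lemma log_quad_root_angle (n j : nat) :
  (0 < j < 2 * S n)%nat ->
  log_quad (root_angle (2 * S n) j) 1 = ln (2 * sin (half_node n j)).
Proof.
  intros Hj. rewrite log_quad_1 by (apply root_angle_bounds; lia). do 3 f_equal.
  unfold root_angle, half_node. rewrite mult_INR. simpl (INR 2). field. apply not_0_INR. lia.
Qed.

Lemma half_node_symmetric (n j : nat) :
  (0 < j <= n)%nat -> sin (half_node n (2 * S n - j)) = sin (half_node n j).
Proof.
  intros Hj. rewrite <- (sin_PI_x (half_node n j)). f_equal. unfold half_node.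
  rewrite minus_INR, mult_INR by lia. simpl (INR 2). field. apply not_0_INR. lia.
Qed.

Lemma half_node_bounds (n j : nat) : (j < S n)%nat -> 0 < half_node n (S j) <= PI / 2.
Proof.
  intros Hj. unfold half_node. pose proof PI_RGT_0. pose proof (INR_S_pos n). pose proof (INR_S_pos j).
  split; [apply Rdiv_lt_0_compat; [apply Rmult_lt_0_compat; lra|lra]|].
  apply Rmult_le_reg_r with (INR (S n)); [lra|].
  replace (PI / 2 * INR (S j) / INR (S n) * INR (S n)) with (PI / 2 * INR (S j)) by (field; lra).
  apply Rmult_le_compat_l; [lra|]. apply le_INR. lia.
Qed.

Lemma half_node_last (n : nat) : half_node n (S n) = PI / 2.
Proof. unfold half_node. field. apply not_0_INR. lia. Qed.

Lemma ln_2_sin_half_node (n j : nat) :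
  (j < S n)%nat ->
  ln (2 * sin (half_node n (S j))) = ln (2 * half_node n (S j)) + log_sinc (half_node n (S j)) /\
  ln (2 * half_node n (S j)) = ln PI + ln (INR (S j)) - ln (INR (S n)).
Proof.
  intros Hj. pose proof (half_node_bounds n j Hj) as Hb. pose proof PI_RGT_0 as HPI.
  set (y := half_node n (S j)) in *.
  assert (Hs : 0 < sin y) by (apply sin_gt_0; lra).
  split.
  - unfold log_sinc. rewrite <- ln_mult by (try apply Rdiv_lt_0_compat; lra).
    f_equal. field. lra.
  - replace (2 * y) with (PI * INR (S j) / INR (S n)).
    2:{ unfold y, half_node. field. apply not_0_INR. lia. }
    pose proof (INR_S_pos j). pose proof (INR_S_pos n).
    rewrite ln_div, ln_mult by (first [lra | apply Rmult_lt_0_compat; lra]). ring.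
Qed.

Lemma ln_2PI : ln (2 * PI) = ln 2 + ln PI.
Proof. apply ln_mult; [lra|apply PI_RGT_0]. Qed.

Lemma log_sinc_PI2 : log_sinc (PI / 2) = ln 2 - ln PI.
Proof.
  unfold log_sinc. rewrite sin_PI2. pose proof PI_RGT_0.
  replace (1 / (PI / 2)) with (2 / PI) by (field; lra). apply ln_div; lra.
Qed.

(** The product formula with [2 N] roots, written with [ln (2 sin y) = ln (2 y) + log_sinc y]. The
    unknown mean of [log_sinc] affects only the slope in [N]; the constant term comes from the
    endpoint value at [PI/2]. *)
Theorem stirling_constant (s : R) :
  (forall n, Rabs (ln_remainder s n) <= lntail (INR (S n))) -> 2 * s = ln (2 * PI).
Proof.
  intros Hs. destruct trapezoid_log_sinc as [al Hal].
  set (T := fun n => psum (fun j => log_sinc (PI / 2 * INR (S j) / INR (S n))) (S n)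
                     - log_sinc (PI / 2) / 2 - al * INR (S n)) in *.
  assert (E : forall n, (2 * s - ln (2 * PI)) + 2 * (ln PI - 1 + al) * INR (S n)
                        = - 2 * (ln_remainder s n + T n)).
  { intros n.
    pose proof (psum_log_roots (2 * n + 1)) as P.
    replace (S (2 * n + 1)) with (2 * S n)%nat in P by lia.
    rewrite (psum_ext _ (fun j => ln (2 * sin (half_node n (S j))))) in P
      by (intros k Hk; apply log_quad_root_angle; lia).
    rewrite (psum_symmetric (fun j => ln (2 * sin (half_node n j)))) in P
      by (intros j Hj; now rewrite half_node_symmetric).
    rewrite half_node_last, sin_PI2, Rmult_1_r in P.
    rewrite (psum_ext _ (fun j => (ln PI - ln (INR (S n))) + (ln (INR (S j))
      + log_sinc (half_node n (S j))))) in P.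
    2:{ intros k Hk. destruct (ln_2_sin_half_node n k Hk) as [A B]. rewrite A, B. ring. }
    rewrite !psum_plus, psum_const, mult_INR, ln_mult in P by (simpl; try apply INR_S_pos; lra).
    change (psum (fun j => ln (INR (S j))) (S n)) with (sum_ln (S n)) in P.
    simpl (INR 2) in P. change (1 + 1) with 2 in P.
    unfold ln_remainder, T. rewrite ln_2PI, log_sinc_PI2.
    change (fun j => log_sinc (PI / 2 * INR (S j) / INR (S n)))
      with (fun j => log_sinc (half_node n (S j))).
    set (X := psum (fun j => log_sinc (half_node n (S j))) (S n)) in *.
    cbv zeta. lra. }
  assert (L : is_lim_seq (fun n => (2 * s - ln (2 * PI)) + 2 * (ln PI - 1 + al) * INR (S n)) 0).
  { apply is_lim_seq_ext with (fun n => - 2 * (ln_remainder s n + T n)); [intros; now rewrite E|].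
    apply is_lim_seq_scal_0. replace (Finite 0) with (Finite (0 + 0)) by (f_equal; ring).
    apply is_lim_seq_plus'; [|exact Hal].
    apply (is_lim_seq_remainder _ 1). intros n. rewrite Rmult_1_l. apply Hs. }
  apply affine_limit_0 in L. lra.
Qed.

(** The left side sums [1 / (i j)] over [i < j <= n]: half of the full square without its
    diagonal. *)
Lemma psum_harmonic_div (n : nat) :
  psum (fun m => harmonic m / INR (S m)) n
  = (harmonic n ^ 2 - psum (fun m => / INR (S m) ^ 2) n) / 2.
Proof.
  induction n as [|n IH]; [unfold harmonic; simpl; field|].
  cbn [psum]. rewrite IH. change (harmonic (S n)) with (harmonic n + / INR (S n)).
  field. apply not_0_INR. lia.
Qed.

(** Partial sums combine [ln^2 n + 2 gamma H_n - H_n^2], and inserting [H_n = ln n + gamma + d]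
    leaves [gamma^2 - 2 d ln n - d^2]. The bound [d = O(1 / n)] disposes of the product with the
    logarithm; the diagonal of [H_n^2] supplies the Basel sum. *)
Lemma is_series_rho_div (c : R) :
  (forall n, Rabs (ln_div_remainder c n) <= 3 * lntail (INR (S n))) ->
  is_series (fun m => - 2 * rho (S m) / INR (S m)) (euler_gamma ^ 2 + 2 * c + PI ^ 2 / 6).
Proof.
  intros Hc. apply is_series_psum, is_lim_seq_incr_1.
  set (d := fun n => harmonic (S n) - ln (INR (S n)) - euler_gamma).
  assert (D : forall n, Rabs (d n) <= / INR (S n)).
  { intros n. unfold d. destruct (proj2 euler_gamma_spec n) as [A B].
    change (harmonic (S n)) with (harmonic n + / INR (S n)) in *.
    pose proof (Rinv_0_lt_compat _ (INR_S_pos n)). apply Rabs_le. lra. }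
  assert (Dlim : is_lim_seq d 0).
  { apply is_lim_seq_0_le with (v := fun n => / INR (S n)) (N := 0%nat);
      [intros; apply D|apply is_lim_seq_inv_S]. }
  assert (Dln : is_lim_seq (fun n => ln (INR (S n)) * d n) 0).
  { apply is_lim_seq_0_le with (v := fun n => ln (INR (S n)) / INR (S n)) (N := 0%nat);
      [|apply is_lim_seq_ln_over_S].
    intros n _. pose proof (ln_nonneg _ (INR_S_ge_1 n)).
    rewrite Rabs_mult, (Rabs_right (ln _)) by lra. apply Rmult_le_compat_l; [easy|apply D]. }
  apply is_lim_seq_ext with (fun n => (euler_gamma ^ 2 + 2 * c
    + (ln (INR (S n)) / INR (S n) + (2 * ln_div_remainder c n
       + (- 2 * (ln (INR (S n)) * d n) + - 1 * (d n * d n))))) + psum (fun m => / INR (S m) ^ 2) (S n)).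
  - intros n. rewrite (psum_ext (fun m => - 2 * rho (S m) / INR (S m))
      (fun m => 2 * (ln (INR (S m)) / INR (S m) + euler_gamma * / INR (S m))
                - 2 * (harmonic m / INR (S m)))).
    2:{ intros k _. unfold rho. cbn [pred]. field. apply not_0_INR. lia. }
    rewrite psum_minus, !psum_scal, psum_plus, psum_scal, psum_harmonic_div.
    change (psum (fun k => / INR (S k)) (S n)) with (harmonic (S n)).
    change (psum (fun k => ln (INR (S k)) / INR (S k)) (S n)) with (sum_ln_div (S n)).
    unfold ln_div_remainder, d. cbv zeta.
    set (Z := psum (fun m => / INR (S m) ^ 2) (S n)). set (HH := harmonic (S n)).
    field. apply not_0_INR. lia.
  - replace (Finite (euler_gamma ^ 2 + 2 * c + PI ^ 2 / 6))
      with (Finite (euler_gamma ^ 2 + 2 * c + (0 + (2 * 0 + (- 2 * 0 + - 1 * (0 * 0)))) + PI ^ 2 / 6))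
      by (f_equal; ring).
    apply is_lim_seq_plus'.
    + apply is_lim_seq_plus'; [apply is_lim_seq_const|].
      apply is_lim_seq_plus'; [apply is_lim_seq_ln_over_S|].
      apply is_lim_seq_plus'.
      * apply (is_lim_seq_scal_l _ 2 0). now apply (is_lim_seq_remainder _ 3).
      * apply is_lim_seq_plus'.
        -- now apply (is_lim_seq_scal_l _ (- 2) 0).
        -- apply (is_lim_seq_scal_l _ (- 1) (0 * 0)). now apply is_lim_seq_mult'.
    + apply (is_lim_seq_incr_1 (psum (fun m => / INR (S m) ^ 2))).
      apply is_series_psum, basel.
Qed.

Lemma is_lim_seq_Series_rho_term (c : R) :
  (forall n, Rabs (ln_div_remainder c n) <= 3 * lntail (INR (S n))) ->
  is_lim_seq (fun n => Series (rho_term (2 * S n))) (euler_gamma ^ 2 + 2 * c + PI ^ 2 / 6).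
Proof.
  intros Hc. rewrite <- (is_series_unique _ _ (is_series_rho_div c Hc)).
  apply (tannery (fun n => rho_term (2 * S n)) _ (fun m => 4 * / INR (S m) ^ 2)).
  - intros n m. apply rho_term_bound. lia.
  - apply (ex_series_scal 4 (fun m => / INR (S m) ^ 2)), ex_series_inv_sq.
  - intros n. apply Series_correct. replace (2 * S n)%nat with (S (2 * n + 1)) by lia.
    eexists. apply is_series_rho_term.
  - intros m. apply is_lim_seq_dist.
    apply is_lim_seq_0_le with (v := fun n => 2 / INR (S m) * / INR (S n)) (N := 0%nat).
    2:{ apply is_lim_seq_scal_0, is_lim_seq_inv_S. }
    intros n _. unfold rho_term.
    replace (2 * (rho (2 * S n * S m) - rho (S m)) / INR (S m) - - 2 * rho (S m) / INR (S m))
      with (2 / INR (S m) * rho (2 * S n * S m)) by (field; apply not_0_INR; lia).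
    pose proof (INR_S_pos m) as Hm. pose proof (Rinv_0_lt_compat _ Hm).
    assert (0 < 2 / INR (S m)) by (apply Rdiv_lt_0_compat; lra).
    rewrite Rabs_mult, (Rabs_right (2 / _)) by lra.
    apply Rmult_le_compat_l; [lra|].
    eapply Rle_trans; [apply rho_bound; lia|].
    apply Rinv_le_contravar; [apply INR_S_pos|]. apply le_INR. nia.
Qed.

Lemma psum_affine_sq (A B : R) (n : nat) :
  psum (fun j => (A - B * INR (S j)) ^ 2) n
  = INR n * A ^ 2 - A * B * (INR n * (INR n + 1)) + B ^ 2 * (INR n * (INR n + 1) * (2 * INR n + 1)) / 6.
Proof.
  induction n as [|n IH]; [simpl; field|].
  cbn [psum]. rewrite IH, S_INR. field.
Qed.

(** The arguments are [PI (1/2 - j / (2 N))] with [N = n + 1]. The constant term [- PI^2 / 4] is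
    what later turns [PI^2 / 6] into [- PI^2 / 12]. *)
Lemma psum_atan_quad_sq (n : nat) :
  psum (fun j => atan_quad (root_angle (2 * S n) (S j)) 1 ^ 2) (2 * n + 1)
  = PI ^ 2 * (INR (S n) / 6 - / 4 + / (12 * INR (S n))).
Proof.
  pose proof (INR_S_pos n) as Hx.
  rewrite (psum_ext _ (fun j => (PI / 2 - PI / (2 * INR (S n)) * INR (S j)) ^ 2)).
  - rewrite psum_affine_sq.
    replace (INR (2 * n + 1)) with (2 * INR (S n) - 1).
    2:{ rewrite plus_INR, mult_INR, S_INR. simpl. ring. }
    field. lra.
  - intros k Hk. rewrite atan_quad_1 by (apply root_angle_bounds; lia).
    f_equal. unfold root_angle. rewrite mult_INR. simpl (INR 2). field. lra.
Qed.

(* The slope [al], an integral, need not be computed: the affine term in [n] must vanish since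
   everything else converges. *)
Theorem ln_sq_constant (c s : R) :
  (forall n, Rabs (ln_div_remainder c n) <= 3 * lntail (INR (S n))) ->
  (forall n, Rabs (ln_sq_remainder s n) <= 2 * lntail (INR (S n))) ->
  2 * s + ln (2 * PI) ^ 2 = euler_gamma ^ 2 + 2 * c - PI ^ 2 / 12.
Proof.
  intros Hc Hs.
  destruct sum_ln_asymptotic as [sg Hsg]. pose proof (stirling_constant sg Hsg) as Esg.
  destruct trapezoid_sinc_cross as [al Hal].
  set (T := fun n => psum (fun j => sinc_cross (PI / 2 * INR (S j) / INR (S n))) (S n)
                     - sinc_cross (PI / 2) / 2 - al * INR (S n)) in *.
  assert (Wb : sinc_cross (PI / 2) = ln 2 ^ 2 - ln PI ^ 2).
  { unfold sinc_cross. rewrite log_sinc_PI2. replace (2 * (PI / 2)) with PI by field. ring. }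
  assert (E : forall n,
    (2 * s + ln (2 * PI) ^ 2 + PI ^ 2 / 4)
    + 2 * (ln PI ^ 2 - 2 * ln PI + 2 + al - PI ^ 2 / 12) * INR (S n)
    = Series (rho_term (2 * S n))
      + (PI ^ 2 / 12 * / INR (S n)
         + (- 2 * T n + (- 2 * ln_sq_remainder s n
            + (- 4 * ln PI * ln_remainder sg n + 4 * (ln (INR (S n)) * ln_remainder sg n)))))).
  { intros n.
    pose proof (is_series_unique _ _ (is_series_rho_term (2 * n + 1))) as P.
    replace (S (2 * n + 1)) with (2 * S n)%nat in P by lia.
    rewrite psum_minus, psum_atan_quad_sq in P.
    rewrite (psum_ext _ (fun j => ln (2 * sin (half_node n (S j))) ^ 2)) in P
      by (intros k Hk; rewrite log_quad_root_angle by lia; easy).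
    rewrite (psum_symmetric (fun j => ln (2 * sin (half_node n j)) ^ 2)) in P
      by (intros j Hj; now rewrite half_node_symmetric).
    rewrite half_node_last, sin_PI2, Rmult_1_r in P.
    set (l := ln (INR (S n))) in *.
    rewrite (psum_ext _ (fun j => (ln PI - l) ^ 2 + (2 * (ln PI - l) * ln (INR (S j))
      + (ln (INR (S j)) ^ 2 + sinc_cross (half_node n (S j)))))) in P.
    2:{ intros k Hk. destruct (ln_2_sin_half_node n k Hk) as [A B]. rewrite A.
        unfold sinc_cross. rewrite B. fold l. ring. }
    rewrite !psum_plus, psum_const, psum_scal, mult_INR, ln_mult in P
      by (simpl; try apply INR_S_pos; lra).
    change (psum (fun j => ln (INR (S j))) (S n)) with (sum_ln (S n)) in P.
    change (psum (fun j => ln (INR (S j)) ^ 2) (S n)) with (sum_ln_sq (S n)) in P.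
    simpl (INR 2) in P. change (1 + 1) with 2 in P. fold l in P.
    rewrite P. unfold ln_remainder, ln_sq_remainder, T. rewrite Wb. cbv zeta. fold l.
    change (fun j => sinc_cross (PI / 2 * INR (S j) / INR (S n)))
      with (fun j => sinc_cross (half_node n (S j))).
    set (X := psum (fun j => sinc_cross (half_node n (S j))) (S n)).
    (* Stirling's constant enters through the cross term [2 (ln PI - ln n)] times the sum of [ln j].
       Only with its exact value do the remaining multiples of [ln n] cancel. *)
    replace sg with ((ln 2 + ln PI) / 2) by (rewrite <- ln_2PI; lra).
    rewrite ln_2PI. field. apply not_0_INR. lia. }
  assert (L : is_lim_seq (fun n => (2 * s + ln (2 * PI) ^ 2 + PI ^ 2 / 4)
    + 2 * (ln PI ^ 2 - 2 * ln PI + 2 + al - PI ^ 2 / 12) * INR (S n))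
    (euler_gamma ^ 2 + 2 * c + PI ^ 2 / 6)).
  { eapply is_lim_seq_ext; [intros n; symmetry; apply E|].
    replace (Finite (euler_gamma ^ 2 + 2 * c + PI ^ 2 / 6))
      with (Finite (euler_gamma ^ 2 + 2 * c + PI ^ 2 / 6
        + (PI ^ 2 / 12 * 0 + (- 2 * 0 + (- 2 * 0 + (- 4 * ln PI * 0 + 4 * 0))))))
      by (f_equal; ring).
    assert (R1 : is_lim_seq (ln_remainder sg) 0).
    { apply (is_lim_seq_remainder _ 1). intros n. rewrite Rmult_1_l. apply Hsg. }
    apply is_lim_seq_plus'; [now apply is_lim_seq_Series_rho_term|].
    apply is_lim_seq_plus'; [apply (is_lim_seq_scal_l _ (PI ^ 2 / 12) 0), is_lim_seq_inv_S|].
    apply is_lim_seq_plus'; [now apply (is_lim_seq_scal_l _ (- 2) 0)|].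
    apply is_lim_seq_plus'.
    - apply (is_lim_seq_scal_l _ (- 2) 0). now apply (is_lim_seq_remainder _ 2).
    - apply is_lim_seq_plus'; [now apply (is_lim_seq_scal_l _ (- 4 * ln PI) 0)|].
      apply (is_lim_seq_scal_l _ 4 0). apply (is_lim_seq_ln_mult_remainder _ 1).
      intros n. rewrite Rmult_1_l. apply Hsg. }
  apply affine_limit_0 in L. lra.
Qed.

Lemma stieltjes_1_limit (Z : C -> C) (g : nat -> R) (c : R) :
  is_riemann_zeta Z -> is_stieltjes Z g ->
  (forall n, Rabs (ln_div_remainder c n) <= 3 * lntail (INR (S n))) -> g 1%nat = c.
Proof.
  intros HZ Hg Hc.
  pose proof (stieltjes_1_series Z g _ HZ Hg is_series_zeta_diff_0) as H.
  apply is_series_psum in H.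
  enough (- g 1%nat = - c) by lra.
  apply (is_lim_seq_eq _ _ _ H).
  apply is_lim_seq_ext with (fun n => (ln (INR (S n)) / INR (S n) / 2 - ln_div_remainder c n) + - c).
  - intros n. unfold stieltjes_term.
    rewrite (psum_ext _ (fun k => (-1) * (ln (INR (S k)) / INR (S k))
      + (ln (INR (S (S k))) ^ 2 / 2 - ln (INR (S k)) ^ 2 / 2))).
    2:{ intros k _. rewrite (S_INR (S k)). field. apply not_0_INR. lia. }
    rewrite psum_plus, psum_scal, (psum_telescope (fun k => ln (INR (S k)) ^ 2 / 2)).
    change (INR 1) with 1. rewrite ln_1. unfold ln_div_remainder, sum_ln_div. cbn [psum]. cbv zeta.
    field. apply not_0_INR. lia.
  - replace (Finite (- c)) with (Finite (0 / 2 - 0 + - c)) by (f_equal; field).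
    apply is_lim_seq_plus'; [|apply is_lim_seq_const].
    apply is_lim_seq_minus'; [|now apply (is_lim_seq_remainder _ 3)].
    apply (is_lim_seq_mult' _ (fun _ => / 2)); [apply is_lim_seq_ln_over_S|apply is_lim_seq_const].
Qed.

(** The antiderivatives chosen in the three remainders combine to exactly [(x - 1) ln^2 x], that is
    [xlnsq] with no additive constant, and the half terms combine to [xlnsq' / 2]. Hence nothing but
    the constants and the remainders survives. *)
Lemma is_lim_seq_hasse_constants (c s : R) :
  (forall n, Rabs (ln_div_remainder c n) <= 3 * lntail (INR (S n))) ->
  (forall n, Rabs (ln_sq_remainder s n) <= 2 * lntail (INR (S n))) ->
  is_lim_seq (hasse_psum 1) (2 * c - s - ln (2 * PI)).
Proof.
  intros Hc Hs. destruct sum_ln_asymptotic as [sg Hsg].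
  rewrite <- (stirling_constant sg Hsg).
  apply is_lim_seq_hasse_psum.
  apply is_lim_seq_ext with (fun n => (2 * c - s - 2 * sg) +
    (2 * ln_div_remainder c n + (- 1 * ln_sq_remainder s n + - 2 * ln_remainder sg n))).
  - intros n.
    assert (E : forall y, 0 < y -> xlnsq' y = ln y ^ 2 + (2 * ln y + - 2 * (ln y / y))).
    { intros y Hy. unfold xlnsq', lnsq_der, harmonic. simpl. field. lra. }
    assert (P : psum (fun j => xlnsq' (INR (S j))) n
                = sum_ln_sq (S n) + (2 * sum_ln (S n) + - 2 * sum_ln_div (S n)) - xlnsq' (INR (S n))).
    { unfold sum_ln_sq, sum_ln, sum_ln_div. rewrite <- !psum_scal, <- !psum_plus. cbn [psum].
      rewrite (E (INR (S n))) by apply INR_S_pos.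
      rewrite (psum_ext (fun j => xlnsq' (INR (S j)))
        (fun k => ln (INR (S k)) ^ 2 + (2 * ln (INR (S k)) + -2 * (ln (INR (S k)) / INR (S k)))))
        by (intros k _; apply E, INR_S_pos).
      ring. }
    rewrite P, E by apply INR_S_pos.
    unfold ln_div_remainder, ln_sq_remainder, ln_remainder, xlnsq, lnsq_der. cbv zeta.
    pose proof (INR_S_pos n). field. lra.
  - replace (Finite (2 * c - s - 2 * sg))
      with (Finite (2 * c - s - 2 * sg + (2 * 0 + (- 1 * 0 + - 2 * 0)))) by (f_equal; ring).
    apply is_lim_seq_plus'; [apply is_lim_seq_const|].
    apply is_lim_seq_plus'; [apply (is_lim_seq_scal_l _ 2 0); now apply (is_lim_seq_remainder _ 3)|].
    apply is_lim_seq_plus'.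
    + apply (is_lim_seq_scal_l _ (- 1) 0). now apply (is_lim_seq_remainder _ 2).
    + apply (is_lim_seq_scal_l _ (- 2) 0). apply (is_lim_seq_remainder _ 1).
      intros n. rewrite Rmult_1_l. apply Hsg.
Qed.

Theorem mainTheorem4 :
  forall (zeta : C -> C) (stieltjes : nat -> R),
    is_riemann_zeta zeta ->
    is_stieltjes zeta stieltjes ->
    is_series
      (fun n : nat =>
         / INR (n + 1) *
         sum_n (fun k : nat =>
                  Binomial.C n k * (-1) ^ k * INR k * (ln (INR (k + 1))) ^ 2) n)
      (stieltjes 1%nat - ln (2 * PI) - / 2 * euler_gamma ^ 2
       + / 24 * PI ^ 2 + / 2 * (ln (2 * PI)) ^ 2).
Proof.
  intros zeta stieltjes Hzeta Hst.
  destruct sum_ln_div_asymptotic as [c Hc]. destruct sum_ln_sq_asymptotic as [s Hs].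
  rewrite (stieltjes_1_limit _ _ c Hzeta Hst Hc).
  (* Half of the relation in [ln_sq_constant] expresses [s] and cancels one of the two copies of
     [c]. *)
  replace (c - ln (2 * PI) - / 2 * euler_gamma ^ 2 + / 24 * PI ^ 2 + / 2 * ln (2 * PI) ^ 2)
    with (2 * c - s - ln (2 * PI)) by (pose proof (ln_sq_constant c s Hc Hs); lra).
  apply is_series_psum.
  apply is_lim_seq_ext with (2 := is_lim_seq_hasse_constants c s Hc Hs).
  intros N. unfold hasse_psum. apply psum_ext. intros n _.
  (* At base point 1 the k-th node is [k + 1], where [xlnsq] takes the value [k ln^2 (k + 1)]. *)
  rewrite bdiff_binomial, sum_n_psum, Nat.add_1_r. unfold Rdiv. rewrite Rmult_comm. f_equal.
  apply psum_ext. intros k _. rewrite Nat.add_1_r. unfold xlnsq, lnsq_der.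
  replace (1 + INR k * 1) with (INR (S k)) by (rewrite S_INR; ring).
  rewrite S_INR. ring.
Qed.
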